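(* Let $d\ge1$, $T>0$, $H\in(1/4,1)$, and let $X$ be a $d$-dimensional fractional Brownian motion with Hurst index $H$. Set $\alpha_H=\frac d2-1+\frac1{2H}$. Then for every $\alpha>\alpha_H$, $$\sup_{\varepsilon\in(0,1)}E\left[Z_{\alpha,\varepsilon}\right]<\infty,\qquad Z_{\alpha,\varepsilon}:=\int_0^T\int_0^T K_\alpha(X_t-X_s)\langle D^0_\varepsilon X_t,D^0_\varepsilon X_s\rangle\,ds\,dt .$$
   Context: A real fractional Brownian motion with Hurst index $H\in(0,1)$ is a mean-zero continuous Gaussian process $(B_t)_{t\ge0}$ with $\mathrm{Cov}(B_s,B_t)=\frac12(|s|^{2H}+|t|^{2H}-|s-t|^{2H})$; a $d$-dimensional one has independent components which are real fractional Brownian motions with index $H$. $D^0_\varepsilon X_t=\frac{X_{t+\varepsilon}-X_{t-\varepsilon}}{2\varepsilon}$, with $X_{t-\varepsilon}=0$ for $t<\varepsilon$. For $\alpha>0$, $K_\alpha(x)=\frac{1}{\Gamma(\alpha)(4\pi)^{d/2}}\int_0^\infty t^{\alpha-\frac d2}e^{-\frac{|x|^2}{4t}-t}\frac{dt}{t}$, $x\in\mathbb{R}^d$, the convolution kernel of $(1-\Delta)^{-\alpha}$. *)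

(* Defs.v *)
(* MathComp-Analysis *)
From HB Require Import structures.
From mathcomp Require Import all_boot all_order all_algebra.
From mathcomp Require Import all_classical all_reals all_analysis.

Set Implicit Arguments.
Unset Strict Implicit.
Unset Printing Implicit Defensive.

Import Order.TTheory GRing.Theory Num.Theory.
Import numFieldNormedType.Exports.

Local Open Scope classical_set_scope.
Local Open Scope ring_scope.

(* The library's norm on 'rV[R]_n is the sup norm, hence the explicit Euclidean
   inner product; |x|^2 is [dotp x x]. *)
Definition dotp (R : realType) (n : nat) (u v : 'rV[R]_n) : R :=
  \sum_(i < n) u ord0 i * v ord0 i.

(* [normal_prob m 0] is not the degenerate normal law in the library (it is the
   uniform law on [0, 1]), so standard deviation 0 is treated apart. *)
Definition gaussian_law (R : realType) (m s : R) (A : set R) : \bar R :=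
  if s == 0 then \d_m A else normal_prob m s A.

Definition gaussian_rv (dO : measure_display) (Omega : measurableType dO)
    (R : realType) (P : probability Omega R) (Y : Omega -> R) : Prop :=
  measurable_fun setT Y /\
  exists m s : R, 0 <= s /\
    forall A : set R, measurable A -> P (Y @^-1` A) = gaussian_law m s A.

(* Processes indexed by [0, +oo[ are functions on R; their values at negative
   times are never constrained nor used. *)
Definition gaussian_process (dO : measure_display) (Omega : measurableType dO)
    (R : realType) (P : probability Omega R) (B : R -> Omega -> R) : Prop :=
  forall (k : nat) (a t : 'I_k -> R), (forall j, 0 <= t j) ->
    gaussian_rv P (fun w => \sum_(j < k) a j * B (t j) w).

Definition real_fBm (dO : measure_display) (Omega : measurableType dO)
    (R : realType) (P : probability Omega R) (H : R)
    (B : R -> Omega -> R) : Prop :=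
  [/\ gaussian_process P B,
      forall w : Omega, {within `[0, +oo[, continuous (fun t => B t w)},
      forall t : R, 0 <= t -> ('E_P[B t] = 0)%E &
      forall s t : R, 0 <= s -> 0 <= t ->
        covariance P (B s) (B t) =
        (2^-1 * (`|s| `^ (2 * H) + `|t| `^ (2 * H)
                 - `|s - t| `^ (2 * H)))%:E].

Definition process_sigma_algebra (R : realType) (dO : measure_display)
    (Omega : measurableType dO) (B : R -> Omega -> R) : set (set Omega) :=
  <<s [set E | exists (t : R) (A : set R),
         [/\ 0 <= t, measurable A & E = B t @^-1` A]] >>.

Definition mutually_independent (dO : measure_display)
    (Omega : measurableType dO) (R : realType) (P : probability Omega R)
    (n : nat) (F : 'I_n -> set (set Omega)) : Prop :=
  forall (J : {set 'I_n}) (E : 'I_n -> set Omega),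
    (forall i, i \in J -> F i (E i)) ->
    (P (\bigcap_(i in [set` J]) E i) = \prod_(i in J) P (E i))%E.

Definition fBm (dO : measure_display) (Omega : measurableType dO)
    (R : realType) (P : probability Omega R) (n : nat) (H : R)
    (X : R -> Omega -> 'rV[R]_n) : Prop :=
  (forall i : 'I_n, real_fBm P H (fun t w => X t w ord0 i)) /\
  mutually_independent P
    (fun i : 'I_n => process_sigma_algebra (fun t w => X t w ord0 i)).

(* Applied to a single path x of the process. *)
Definition D0 (R : realType) (n : nat) (eps : R) (x : R -> 'rV[R]_n) (t : R) :
    'rV[R]_n :=
  (2 * eps)^-1 *: (x (t + eps) - (if t < eps then 0 else x (t - eps))).

Definition Gamma (R : realType) (a : R) : R :=
  \int[lebesgue_measure]_(t in `]0, +oo[) (t `^ (a - 1) * expR (- t)).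

(* Extended-real valued: [K alpha 0 = +oo] when alpha <= n / 2. *)
Definition K (R : realType) (n : nat) (alpha : R) (x : 'rV[R]_n) : \bar R :=
  (((Gamma alpha * (4 * pi) `^ (n%:R / 2))^-1)%:E *
   \int[lebesgue_measure]_(t in `]0%R, +oo[)
     (t `^ (alpha - n%:R / 2) * expR (- (dotp x x / (4 * t)) - t) / t)%:E)%E.

Definition Z_integrand (R : realType) (n : nat) (alpha eps : R)
    (x : R -> 'rV[R]_n) (t s : R) : \bar R :=
  (K alpha (x t - x s)%R * (dotp (D0 eps x t) (D0 eps x s))%:E)%E.

Definition Z (R : realType) (n : nat) (T alpha eps : R) (x : R -> 'rV[R]_n) :
    \bar R :=
  (\int[lebesgue_measure]_(t in `[0%R, T])
     \int[lebesgue_measure]_(s in `[0%R, T]) Z_integrand alpha eps x t s)%E.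

(* Main.v *)
Require Import Defs.
From HB Require Import structures.
From mathcomp Require Import all_boot all_order all_algebra.
From mathcomp Require Import all_classical all_reals all_analysis.
From mathcomp Require Import measurable_realfun ring lra.

Set Implicit Arguments.
Unset Strict Implicit.
Unset Printing Implicit Defensive.

Import Order.TTheory GRing.Theory Num.Theory.
Import numFieldNormedType.Exports.

Local Open Scope classical_set_scope.
Local Open Scope ring_scope.

(** Write [A] and [B] for the difference quotients of [X] at [t] and [s], and [W]
    for [X_t - X_s].  All three are linear in [X], so that their coordinates are
    centred Gaussian and the [d] coordinates are independent copies of each other.

    The kernel is a mixture of Gaussians: up to a constant, [K_alpha(x)] is the
    integral over [u > 0] of [kern u * exp(-|x|^2/(4u))].  For a centred Gaussian
    pair with [v = E A^2], [c = E AW], [s = E W^2] one has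
      [E[A^2 exp(-l W^2)] = (1+2ls)^(-1/2) (v - 2 l c^2/(1+2ls))].
    Independence of the coordinates and an integration in [u] turn this into a
    formula for [E[K_alpha(W) |A|^2]] ([K_sqr_expectation]), and polarisation gives
      [E[K_alpha(W) <A,B>] <= C d Cov(A,B) w(|t-s|^(2H))]
    ([K_dotp_le]), where [Cov] is the covariance of one coordinate and [w] is the
    function [wgt].  The term that is dropped is
    proportional to [Cov(A,W) Cov(B,W)] and has the right sign: computing both
    covariances shows that their product is nonnegative ([cross_mul_ge0]).

    Three deterministic facts then suffice.
    - [wgt_asymp]: [|w(r^(2H)) - w0| <= C r^beta] with [beta > 1 - 2H].  Here
      [alpha > alpha_H] is used; [w0 = 0] can be taken when [H > 1/2], while for
      [H <= 1/2] one needs [1/(2H) < 2], that is [H > 1/4].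
    - [Ceps_le]: [|Cov(A,B)| <= 144 |t-s|^(2H-2)] uniformly in [eps].
    - [double_integral_Ceps]: the double integral of [Cov(A,B)] over the square
      telescopes and is bounded uniformly in [eps].
    Replacing [w] by [w0] costs at most a multiple of the integral of
    [|t-s|^(beta+2H-2)], which is finite because [beta + 2H - 2 > -1]; what remains
    is [w0] times the double integral of the covariance.

    For fixed [eps] the expectation of the absolute value of the integrand is at
    most [C_eps (w0 + C |t-s|^beta)] with [beta > -1].  The integrand is therefore
    integrable for the product of [P] and the Lebesgue measure on the square, which
    gives the integrability assertions and justifies exchanging the expectation
    and the time integrals.  Joint measurability comes from continuity of paths. *)

(** * Layer-cake formula and differentiation under the integral *)

Section layer_cake.
Local Open Scope ereal_scope.
Context d (T : measurableType d) (R : realType).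
Variable m : {sigma_finite_measure set T -> \bar R}.

(** Layer-cake formula with a weight [g]: [y] runs over the levels of [f]. *)
Lemma ge0_integral_layer (f : T -> R) (g : T -> \bar R) :
  measurable_fun setT f -> measurable_fun setT g ->
  (forall x, (0 <= f x)%R) -> (forall x, 0 <= g x) ->
  \int[m]_x ((f x)%:E * g x) =
  \int[lebesgue_measure]_(y in `]0%R, +oo[)
     \int[m]_(x in [set x | (y < f x)%R]) g x.
Proof.
move=> mf mg f0 g0.
pose U := measurableTypeR R.
pose A := [set p : T * U | (0 < p.2)%R /\ (p.2 < f p.1)%R].
have mA : measurable A.
  have -> : A = [set: T * U] `&` (fun p => (0 < p.2)%R && (p.2 < f p.1)%R) @^-1` [set true].
    by rewrite setTI; apply/seteqP; split => [p /= [-> ->]//|p /= /andP].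
  have mb : measurable_fun [set: T * U] (fun p : T * U => (0 < p.2)%R && (p.2 < f p.1)%R).
    apply: measurable_and; apply: measurable_fun_ltr => //.
    exact: measurableT_comp.
  exact: mb.
pose h (p : T * U) := (\1_A p)%:E * g p.1.
have mh : measurable_fun setT h.
  apply: emeasurable_funM; first by apply/measurable_EFinP; exact: measurable_indic.
  exact: measurableT_comp.
have h0 p : 0 <= h p by rewrite mule_ge0// lee_fin.
have := @fubini_tonelli _ _ T U R m (@lebesgue_measure R) h mh h0.
move=> fub; transitivity (\int[m]_x \int[lebesgue_measure]_y h (x, y)).
  apply: eq_integral => x _.
  have hE (y : R) : h (x, y) = (\1_`]0%R, f x[ y)%:E * g x.
    rewrite /h !indicE; suff -> : ((x, y) \in A) = (y \in `]0%R, f x[%classic) by [].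
    apply/idP/idP; rewrite !inE /A/= in_itv/=; first by move=> []-> ->.
    by move=> /andP.
  under [RHS]eq_integral do rewrite hE.
  rewrite ge0_integralZr//; last by apply/measurable_EFinP; exact: measurable_indic.
  congr (_ * _).
  rewrite integral_indic// setIT [RHS]lebesgue_measure_itv/= lte_fin.
  by case: ltP => [|fx0]; [rewrite oppr0 addr0|congr (_%:E); apply/eqP; rewrite eq_le f0 fx0].
rewrite fub [RHS]integral_mkcond; apply: eq_integral => y _.
rewrite patchE; case: ifPn => [|]; rewrite ?inE ?notin_setE/= in_itv/= andbT => y0.
  rewrite [RHS]integral_mkcond; apply: eq_integral => x _.
  rewrite patchE /h/= indicE; case: ifPn => [|]; rewrite ?inE ?notin_setE/= => yf.
    by rewrite mem_set ?mul1e.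
  by rewrite memNset ?mul0e// => -[].
apply: integral0_eq => x _; rewrite /h/= indicE memNset ?mul0e//.
by move=> -[].
Qed.

Lemma ge0_integral_layer1 (f : T -> R) :
  measurable_fun setT f -> (forall x, (0 <= f x)%R) ->
  \int[m]_x (f x)%:E =
  \int[lebesgue_measure]_(y in `]0%R, +oo[) m [set x | (y < f x)%R].
Proof.
move=> mf f0; transitivity (\int[m]_x ((f x)%:E * cst 1 x)).
  by apply: eq_integral => x _; rewrite mule1.
rewrite ge0_integral_layer//; apply: eq_integral => y _.
rewrite integral_cst ?mul1e//.
rewrite -[X in measurable X]setTI.
have mb : measurable_fun setT (fun x => y < f x)%R by exact: measurable_fun_ltr.
exact: (mb measurableT [set true]).
Qed.

End layer_cake.

Lemma measurable_superlevel d (T : measurableType d) (R : realType) (f : T -> R) y :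
  measurable_fun setT f -> measurable [set x | y < f x].
Proof.
move=> mf; rewrite -[X in measurable X]setTI.
have mb : measurable_fun setT (fun x => y < f x)%R by exact: measurable_fun_ltr.
exact: (mb measurableT [set true]).
Qed.

(** Differentiation under the integral sign, with a domination [G] of the derivative on an open interval. *)
Lemma is_derive_Rintegral d (T : measurableType d) (R : realType)
    (m : {measure set T -> \bar R}) (f f' : R -> T -> R) (G : T -> R) (a u v : R) :
  a \in `]u, v[ ->
  (forall x, x \in `]u, v[ -> m.-integrable setT (EFin \o f x)) ->
  (forall x y, x \in `]u, v[ -> is_derive x 1 (f^~ y) (f' x y)) ->
  m.-integrable setT (EFin \o G) ->
  (forall x y, x \in `]u, v[ -> `|f' x y| <= G y) ->
  is_derive a 1 (fun x => \int[m]_y f x y) (\int[m]_y f' a y).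
Proof.
move=> auv fi fd Gi fG.
have Ia : `]u, v[%classic a by [].
have dE x y : x \in `]u, v[ -> partial1of2 f x y = f' x y.
  by move=> xuv; rewrite partial1of2E; have [_ ->] := fd x y xuv.
have d1 x y : `]u, v[%classic x -> setT y -> derivable (f^~ y) x 1.
  by move=> xuv _; have [] := fd x y xuv.
have G0 y : 0 <= G y by rewrite (le_trans _ (fG a y auv)).
have Gub x y : `]u, v[%classic x -> setT y -> `|partial1of2 f x y| <= G y.
  by move=> xuv _; rewrite dE// fG.
apply: DeriveDef.
  exact: (derivable_under_integral measurableT Ia fi d1 G0 Gi Gub).
rewrite -derive1E (differentiation_under_integral measurableT Ia fi d1 G0 Gi Gub).
by apply: eq_Rintegral => y _; rewrite dE.
Qed.

Lemma is_derive_expR_comp (R : realType) (f : R -> R) (x a : R) :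
  is_derive x 1 f a -> is_derive x 1 (fun y => expR (f y)) (expR (f x) * a).
Proof. by move=> fa; apply: (is_derive1_comp (f := expR)). Qed.

Lemma is_derive_powR_comp (R : realType) (f : R -> R) (x a p : R) : 0 < f x ->
  is_derive x 1 f a ->
  is_derive x 1 (fun y => f y `^ p) (p * f x `^ (p - 1) * a).
Proof.
move=> fx0 fa; apply: (is_derive1_comp (f := (@powR R)^~ p)).
exact: is_derive1_powR.
Qed.

Lemma normal_pdfE_expR (R : realType) (m s x : R) : s != 0 ->
  normal_pdf m s x = normal_peak s * expR (- (x - m) ^+ 2 / (s ^+ 2 *+ 2)).
Proof. by move=> s0; rewrite normal_pdfE. Qed.

(** * Exponential moments of Gaussian variables *)

Section gaussian_law.
Context d (T : measurableType d) (R : realType) (P : probability T R).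

(** Transfer to the image law.  Only the probabilities [P (Y @^-1` A)] are known, so
    the expectation is recovered from the superlevel sets of [f]; the degenerate law
    is a Dirac mass. *)
Lemma ge0_expectation_gaussian (Y : T -> R) (m s : R) (f : R -> R) :
  measurable_fun setT Y ->
  (forall A : set R, measurable A -> P (Y @^-1` A) = gaussian_law m s A) ->
  measurable_fun setT f -> (forall x, 0 <= f x) ->
  (\int[P]_w (f (Y w))%:E =
   if s == 0%R then (f m)%:E
   else \int[lebesgue_measure]_x ((f x)%:E * (normal_pdf m s x)%:E))%E.
Proof.
move=> mY YE mf f0.
have mfY : measurable_fun setT (fun w => f (Y w)) by exact: measurableT_comp.
rewrite (@ge0_integral_layer1 _ _ _ P (fun w => f (Y w)))//.
transitivity (\int[lebesgue_measure]_(y in `]0%R, +oo[) gaussian_law m s [set x | (y < f x)%R])%E.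
  apply: eq_integral => y _; rewrite -YE//; exact: measurable_superlevel.
rewrite /gaussian_law; case: eqVneq => [_|s0].
  transitivity (\int[\d_m]_x (f x)%:E)%E.
    by rewrite (@ge0_integral_layer1 _ R R (@dirac _ R m R) f).
  rewrite integral_dirac// ?diracT ?mul1e//.
  exact/measurable_EFinP.
rewrite (@ge0_integral_layer _ (measurableTypeR R) _ (@lebesgue_measure R))//.
  by apply/measurable_EFinP; exact: measurable_normal_pdf.
by move=> x; rewrite lee_fin normal_pdf_ge0.
Qed.

Lemma normal_pdf_expR (m s h x : R) : s != 0 ->
  expR (h * x) * normal_pdf m s x =
  expR (h * m + h ^+ 2 * s ^+ 2 / 2) * normal_pdf (m + h * s ^+ 2) s x.
Proof.
move=> s0; rewrite !normal_pdfE_expR// mulrCA [RHS]mulrCA -!expRD.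
by congr (_ * expR _); field.
Qed.

Lemma mgf_gaussian (Y : T -> R) (m s h : R) :
  measurable_fun setT Y ->
  (forall A : set R, measurable A -> P (Y @^-1` A) = gaussian_law m s A) ->
  (\int[P]_w (expR (h * Y w))%:E = (expR (h * m + h ^+ 2 * s ^+ 2 / 2))%:E)%E.
Proof.
move=> mY YE; rewrite (ge0_expectation_gaussian (f := fun x => expR (h * x)) mY YE).
- case: eqVneq => [->|s0]; first by rewrite expr0n/= mulr0 mul0r addr0.
  under eq_integral do rewrite -EFinM normal_pdf_expR// EFinM.
  rewrite ge0_integralZl//; first by rewrite integral_normal_pdf mule1.
  + by apply/measurable_EFinP; exact: measurable_normal_pdf.
  + by move=> x _; rewrite lee_fin normal_pdf_ge0.
- by apply: measurableT_comp => //; exact: measurable_funM.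
- by move=> x; exact: expR_ge0.
Qed.

Lemma normal_pdf_gauss (s x : R) : 0 < s ->
  expR (- x ^+ 2) * normal_pdf 0 s x =
  (1 + 2 * s ^+ 2) `^ (- 2^-1) * normal_pdf 0 (s / Num.sqrt (1 + 2 * s ^+ 2)) x.
Proof.
move=> s0; have q0 : 0 < 1 + 2 * s ^+ 2 by rewrite ltr_wpDr// mulr_ge0 ?sqr_ge0.
have sq0 : 0 < Num.sqrt (1 + 2 * s ^+ 2) by rewrite sqrtr_gt0.
have s'0 : s / Num.sqrt (1 + 2 * s ^+ 2) != 0 by rewrite gt_eqF// divr_gt0.
rewrite (normal_pdfE_expR _ _ s'0) (normal_pdfE_expR _ _ (lt0r_neq0 s0)) mulrCA -expRD mulrA; congr (_ * expR _).
  rewrite powRN powR12_sqrt ?(ltW q0)// /normal_peak.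
  rewrite -invfM; congr (_^-1); rewrite -sqrtrM ?ltW//; congr Num.sqrt.
  by rewrite expr_div_n sqr_sqrtr ?ltW//; field; rewrite gt_eqF.
rewrite expr_div_n sqr_sqrtr ?(ltW q0)//; field.
by rewrite !gt_eqF.
Qed.

Lemma expectation_gauss_gaussian (Y : T -> R) (s : R) : 0 <= s ->
  measurable_fun setT Y ->
  (forall A : set R, measurable A -> P (Y @^-1` A) = gaussian_law 0 s A) ->
  (\int[P]_w (expR (- Y w ^+ 2))%:E = ((1 + 2 * s ^+ 2) `^ (- 2^-1))%:E)%E.
Proof.
move=> s0 mY YE; rewrite (ge0_expectation_gaussian (f := fun x => expR (- x ^+ 2)) mY YE).
- case: eqVneq => [->|sn0].
    by rewrite expr0n/= oppr0 expR0 mulr0 addr0 powR1.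
  have {}s0 : 0 < s by rewrite lt_neqAle eq_sym sn0.
  under eq_integral do rewrite -EFinM normal_pdf_gauss// EFinM.
  rewrite ge0_integralZl//.
  + by rewrite integral_normal_pdf mule1.
  + by apply/measurable_EFinP; exact: measurable_normal_pdf.
  + by move=> x _; rewrite lee_fin normal_pdf_ge0.
  + by rewrite lee_fin powR_ge0.
- by apply: measurableT_comp => //; apply: measurableT_comp => //; exact: measurable_funX.
- by move=> x; exact: expR_ge0.
Qed.

End gaussian_law.

Lemma is_derive_unique (R : realType) (f : R -> R) (x a b : R) :
  is_derive x 1 f a -> is_derive x 1 f b -> a = b.
Proof. by move=> [_ <-] [_ <-]. Qed.

Section integrable_aux.
Context d (T : measurableType d) (R : realType) (m : {measure set T -> \bar R}).

Lemma integrable_dom (f g : T -> R) :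
  measurable_fun setT f -> m.-integrable setT (EFin \o g) ->
  (forall x, `|f x| <= g x) -> m.-integrable setT (EFin \o f).
Proof.
move=> mf ig fg; apply: (@le_integrable _ _ _ m setT measurableT (EFin \o f) (EFin \o g)) => //.
  exact/measurable_EFinP.
by move=> x _; rewrite /= lee_fin (le_trans (fg x))// ler_norm.
Qed.

Lemma RintegralE (f : T -> R) : m.-integrable setT (EFin \o f) ->
  (\int[m]_x (f x)%:E = (\int[m]_x f x)%:E)%E.
Proof. by move=> fi; rewrite /Rintegral fineK//; exact: integrable_fin_num. Qed.

End integrable_aux.

Section mgf_moments.
Context d (T : measurableType d) (R : realType) (P : probability T R).

Lemma sqr_le_expR (x : R) : x ^+ 2 <= 4 * expR `|x|.
Proof.
have h : 1 + `|x| / 2 <= expR (`|x| / 2) by exact: expR_ge1Dx.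
have -> : expR `|x| = expR (`|x| / 2) ^+ 2.
  by rewrite expr2 -expRD; congr expR; field.
have x0 : 0 <= `|x| by [].
have : (1 + `|x| / 2) ^+ 2 <= expR (`|x| / 2) ^+ 2.
  by rewrite ler_pXn2r// nnegrE ?expR_ge0// addr_ge0// divr_ge0.
rewrite -(real_normK (num_real x)); nra.
Qed.

Lemma norm_le_expR (x : R) : `|x| <= expR `|x|.
Proof. by rewrite (le_trans _ (expR_ge1Dx _))// lerDr. Qed.

Lemma expR_norm_le (x : R) : expR `|x| <= expR x + expR (- x).
Proof.
have [x0|x0] := leP 0 x; first by rewrite ger0_norm// lerDl expR_ge0.
by rewrite ltr0_norm// lerDr expR_ge0.
Qed.

Variables (Y : T -> R) (m s : R).
Hypothesis mY : measurable_fun setT Y.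
Hypothesis mgfY : forall h,
  (\int[P]_w (expR (h * Y w))%:E = (expR (h * m + h ^+ 2 * s ^+ 2 / 2))%:E)%E.

Let eY h : P.-integrable setT (EFin \o (fun w => expR (h * Y w))).
Proof.
apply/integrableP; split.
  by apply/measurable_EFinP; apply: measurableT_comp => //; exact: measurable_funM.
under eq_integral do rewrite /= ger0_norm ?expR_ge0//.
by rewrite mgfY ltry.
Qed.

Let mgfR h : \int[P]_w expR (h * Y w) = expR (h * m + h ^+ 2 * s ^+ 2 / 2).
Proof. by rewrite /Rintegral mgfY. Qed.

(** A common domination, for [|h| < 1], of the first two derivatives of [exp(h Y)] in [h]. *)
Let G w := 4 * (expR (2 * Y w) + expR (- 2 * Y w)).

Let iG : P.-integrable setT (EFin \o G).
Proof.
rewrite (_ : _ \o _ = (fun w => 4%:E * ((expR (2 * Y w))%:E + (expR (- 2 * Y w))%:E))%E).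
  by apply: integrableZl => //; apply: integrableD => //; exact: eY.
by apply/funext => w; rewrite /= /G EFinM EFinD.
Qed.

Let G_ub (h y : R) : h \in `]-1, 1[%R -> expR (h * y) * expR `|y| <= expR (2 * y) + expR (- 2 * y).
Proof.
rewrite in_itv/= => /andP[h1 h2].
rewrite mulNr; apply: le_trans (expR_norm_le _); rewrite -expRD ler_expR.
rewrite normrM (ger0_norm (_ : 0 <= 2))// (_ : 2 = 1 + 1)// mulrDl mul1r lerD2r.
rewrite (le_trans (ler_norm _))// normrM ler_piMl// ltW// ltr_norml h1 h2//.
Qed.

Let d1 (h : R) : h \in `]-1, 1[ ->
  is_derive h 1 (fun h => \int[P]_w expR (h * Y w)) (\int[P]_w (Y w * expR (h * Y w))).
Proof.
move=> hI; apply: (is_derive_Rintegral (f := fun h w => expR (h * Y w))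
  (f' := fun h w => Y w * expR (h * Y w)) (G := G) hI) => //.
- by move=> x y _; rewrite mulrC; apply: is_derive_expR_comp; apply: is_derive_eq; rewrite /GRing.scale/=; ring.
- move=> x y xI; rewrite normrM (ger0_norm (expR_ge0 _)) mulrC.
  apply: (@le_trans _ _ (expR (2 * Y y) + expR (- 2 * Y y))).
    by apply: le_trans (G_ub _ xI); rewrite ler_pM2l ?expR_gt0// norm_le_expR.
  by rewrite /G ler_peMl ?addr_ge0 ?expR_ge0// ler1n.
Qed.

Let iYe (h : R) : h \in `]-1, 1[ -> P.-integrable setT (EFin \o (fun w => Y w * expR (h * Y w))).
Proof.
move=> hI; apply: (integrable_dom _ iG).
  by apply: measurable_funM => //; apply: measurableT_comp => //; exact: measurable_funM.
move=> x; rewrite normrM (ger0_norm (expR_ge0 _)) mulrC.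
apply: (@le_trans _ _ (expR (2 * Y x) + expR (- 2 * Y x))).
  by apply: le_trans (G_ub _ hI); rewrite ler_pM2l ?expR_gt0// norm_le_expR.
by rewrite /G ler_peMl ?addr_ge0 ?expR_ge0// ler1n.
Qed.

Let d2 (h : R) : h \in `]-1, 1[ ->
  is_derive h 1 (fun h => \int[P]_w (Y w * expR (h * Y w)))
     (\int[P]_w (Y w ^+ 2 * expR (h * Y w))).
Proof.
move=> hI; apply: (is_derive_Rintegral (f := fun h w => Y w * expR (h * Y w))
  (f' := fun h w => Y w ^+ 2 * expR (h * Y w)) (G := G) hI) => //.
- move=> x y _; rewrite expr2 -mulrA; apply: is_deriveZ.
  by rewrite mulrC; apply: is_derive_expR_comp; apply: is_derive_eq; rewrite /GRing.scale/=; ring.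
- move=> x y xI; rewrite normrM (ger0_norm (expR_ge0 _)) (ger0_norm (sqr_ge0 _)) mulrC.
  rewrite /G; apply: le_trans (ler_wpM2l _ (G_ub _ xI)) => //.
  by rewrite [leRHS]mulrCA ler_pM2l ?expR_gt0// sqr_le_expR.
Qed.

Let in0 : (0 : R) \in `]-1, 1[.
Proof. by rewrite in_itv/= ltrN10 ltr01. Qed.

Lemma mgf_integrable_sqr : P.-integrable setT (EFin \o (fun w => Y w ^+ 2)).
Proof.
apply: (integrable_dom _ iG); first exact: measurable_funX.
move=> x; rewrite ger0_norm ?sqr_ge0// (le_trans (sqr_le_expR _))//.
rewrite /G ler_pM2l//; have := G_ub (Y x) in0; by rewrite mul0r expR0 mul1r.
Qed.

Let dmgf (h : R) : is_derive h 1 (fun h => expR (h * m + h ^+ 2 * s ^+ 2 / 2))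
  (expR (h * m + h ^+ 2 * s ^+ 2 / 2) * (m + h * s ^+ 2)).
Proof.
apply: is_derive_expR_comp; apply: is_derive_eq.
by rewrite /GRing.scale/=; field.
Qed.

(** Mean and variance are read off the moment generating function by differentiating
    it once and twice at [0]; this covers the degenerate law as well. *)
Lemma mgf_mean : \int[P]_w Y w = m.
Proof.
have h1 := d1 in0; have h2 := dmgf 0.
rewrite (_ : (fun h => \int[P]_w expR (h * Y w)) =
  (fun h => expR (h * m + h ^+ 2 * s ^+ 2 / 2))) in h1; last exact/funext/mgfR.
have := is_derive_unique h1 h2.
rewrite expr0n/= !(mul0r, addr0) expR0 mul1r => <-.
by apply: eq_Rintegral => w _; rewrite mul0r expR0 mulr1.
Qed.

Lemma mgf_second_moment : \int[P]_w (Y w ^+ 2) = m ^+ 2 + s ^+ 2.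
Proof.
have h1 := d2 in0.
have {h1} h1 : is_derive (0 : R) 1
   (fun h => expR (h * m + h ^+ 2 * s ^+ 2 / 2) * (m + h * s ^+ 2))
   (\int[P]_w (Y w ^+ 2 * expR (0 * Y w))).
  apply: near_eq_is_derive h1.
  near=> h.
  have hI : h \in `]-1, 1[ by near: h; exact: near_in_itvoo.
  have h1 := d1 hI; have h2 := dmgf h.
  rewrite (_ : (fun h => \int[P]_w expR (h * Y w)) =
    (fun h => expR (h * m + h ^+ 2 * s ^+ 2 / 2))) in h1; last exact/funext/mgfR.
  exact: is_derive_unique h1 h2.
have h2 : is_derive (0 : R) 1
   (fun h => expR (h * m + h ^+ 2 * s ^+ 2 / 2) * (m + h * s ^+ 2)) (m ^+ 2 + s ^+ 2).
  clear h1; have h3 := dmgf 0; apply: is_derive_eq.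
  by rewrite /GRing.scale/= expr0n/= !(mul0r, addr0) expR0; ring.
rewrite -(is_derive_unique h1 h2).
by apply: eq_Rintegral => w _; rewrite mul0r expR0 mulr1.
Unshelve. all: by end_near. Qed.

End mgf_moments.

Lemma powR_pred (R : realType) (x p : R) : 0 < x -> x `^ p = x * x `^ (p - 1).
Proof.
move=> x0; rewrite -{2}(powRr1 (ltW x0)) -powRD; first by congr (_ `^ _); ring.
by rewrite (gt_eqF x0) implybT.
Qed.

Lemma norm_mul_gauss_le1 (R : realType) (z : R) : `|z| * expR (- z ^+ 2) <= 1.
Proof.
rewrite expRN -ler_pdivlMr ?invr_gt0 ?expR_gt0// invrK mul1r.
apply: le_trans (expR_ge1Dx _).
rewrite -(real_normK (num_real z)); have : 0 <= `|z| by []; nra.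
Qed.

Lemma sqr_mul_gauss_le1 (R : realType) (z : R) : z ^+ 2 * expR (- z ^+ 2) <= 1.
Proof.
rewrite expRN -ler_pdivlMr ?invr_gt0 ?expR_gt0// invrK mul1r.
by apply: le_trans (expR_ge1Dx _); rewrite lerDr.
Qed.

Lemma gauss_le1 (R : realType) (z : R) : expR (- z ^+ 2) <= 1.
Proof. by rewrite -[leRHS]expR0 ler_expR oppr_le0 sqr_ge0. Qed.

(** * The expectation of A^2 exp(-W^2) for a centred Gaussian pair *)

Section gaussian_square.
Context d (T : measurableType d) (R : realType) (P : probability T R).
Variables (A W : T -> R) (v c s : R).
Hypotheses (mA : measurable_fun setT A) (mW : measurable_fun setT W).
Hypothesis iA : P.-integrable setT (EFin \o (fun w => A w ^+ 2)).
Hypothesis q0 : forall x y : R, 0 <= y ^+ 2 * s + 2 * x * y * c + x ^+ 2 * v.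
Hypothesis EAW : forall x y : R,
  \int[P]_w expR (- (y * W w + x * A w) ^+ 2) =
  (1 + 2 * (y ^+ 2 * s + 2 * x * y * c + x ^+ 2 * v)) `^ (- 2^-1).

Let Q (y x : R) := 1 + 2 * (y ^+ 2 * s + 2 * x * y * c + x ^+ 2 * v).
Let Q0 y x : 0 < Q y x. Proof. by rewrite ltr_wpDr// mulr_ge0. Qed.

Let z y x w := y * W w + x * A w.

Let mz y x : measurable_fun setT (z y x).
Proof. by apply: measurable_funD; exact: measurable_funM. Qed.

Let mg y x : measurable_fun setT (fun w => expR (- z y x w ^+ 2)).
Proof.
by apply: measurableT_comp => //; apply: measurableT_comp => //; apply: measurable_funX; exact: mz.
Qed.

Let i1 : P.-integrable setT (EFin \o (fun w => `|A w|)).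
Proof.
have i1A : P.-integrable setT (EFin \o (fun w => 1 + A w ^+ 2)).
  rewrite (_ : _ \o _ = (fun w => 1%:E + (A w ^+ 2)%:E)%E)//.
  by apply: integrableD => //; exact: finite_measure_integrable_cst.
apply: (integrable_dom _ i1A); first exact: measurableT_comp.
move=> w; rewrite normr_id -(real_normK (num_real (A w))).
by have : 0 <= `|A w| by []; nra.
Qed.

Let ball_itv (x : R) : x \in `](x - 1), (x + 1)[.
Proof. by rewrite in_itv/= ltrBlDr ltrDl ltr01. Qed.

Let dz (y x : R) w : is_derive x 1 (fun x => expR (- z y x w ^+ 2))
  (- 2 * (A w * z y x w * expR (- z y x w ^+ 2))).
Proof.
have dz1 : is_derive x 1 (fun x => - z y x w ^+ 2) (- 2 * (A w * z y x w)).
  by rewrite /z; apply: is_derive_eq; rewrite /GRing.scale/=; ring.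
by apply: (is_derive_eq (is_derive_expR_comp dz1)); ring.
Qed.

Let iz (y x : R) : P.-integrable setT (EFin \o (fun w => A w * z y x w * expR (- z y x w ^+ 2))).
Proof.
apply: (integrable_dom _ i1).
  by apply: measurable_funM; [apply: measurable_funM => //; exact: mz|exact: mg].
move=> w; rewrite -mulrA normrM ler_piMr//.
by rewrite normrM (ger0_norm (expR_ge0 _)) norm_mul_gauss_le1.
Qed.

Let ig (y x : R) : P.-integrable setT (EFin \o (fun w => expR (- z y x w ^+ 2))).
Proof.
apply: (integrable_dom (g := cst 1)) => //; first exact: finite_measure_integrable_cst.
by move=> w; rewrite ger0_norm ?expR_ge0 ?gauss_le1.
Qed.

(** The first derivative in [x] of [E[exp(-(yW+xA)^2)]], divided by [-2]. *)
Let F1E (y x : R) : \int[P]_w (A w * z y x w * expR (- z y x w ^+ 2)) =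
  (y * c + x * v) * Q y x `^ (- 2^-1 - 1).
Proof.
have h1 : is_derive x 1 (fun x => \int[P]_w expR (- z y x w ^+ 2))
    (\int[P]_w (- 2 * (A w * z y x w * expR (- z y x w ^+ 2)))).
  apply: (is_derive_Rintegral (f := fun x w => expR (- z y x w ^+ 2))
   (f' := fun x w => - 2 * (A w * z y x w * expR (- z y x w ^+ 2)))
   (G := fun w => 2 * `|A w|) (ball_itv x)) => //.
  - rewrite (_ : _ \o _ = (fun w => 2%:E * (`|A w|)%:E)%E)//.
    exact: integrableZl.
  - move=> x' w _; rewrite normrM normrN (ger0_norm (_ : 0 <= 2))// ler_pM2l//.
    rewrite -mulrA normrM ler_piMr//.
    by rewrite normrM (ger0_norm (expR_ge0 _)) norm_mul_gauss_le1.
rewrite (_ : (fun x => \int[P]_w expR (- z y x w ^+ 2)) = (fun x => Q y x `^ (- 2^-1))) in h1; last first.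
  by apply/funext => x'; rewrite EAW.
have h2 : is_derive x 1 (fun x => Q y x `^ (- 2^-1)) (- 2^-1 * Q y x `^ (- 2^-1 - 1) * (4 * (y * c + x * v))).
  apply: is_derive_powR_comp => //.
  by rewrite /Q; apply: is_derive_eq; rewrite /GRing.scale/=; ring.
have := is_derive_unique h1 h2; rewrite RintegralZl//.
move=> /(congr1 (fun t => - 2^-1 * t)) h.
by apply: etrans (etrans _ h) _; field.
Qed.

Let d3 (y a : R) : is_derive y 1 (fun y => y * expR (- (y * a) ^+ 2))
   ((1 - 2 * (y * a) ^+ 2) * expR (- (y * a) ^+ 2)).
Proof.
have h : is_derive y 1 (fun y => - (y * a) ^+ 2) (- 2 * (y * a ^+ 2)).
  by apply: is_derive_eq; rewrite /GRing.scale/=; ring.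
have {}h := is_derive_expR_comp h; apply: is_derive_eq; rewrite /GRing.scale/=; ring.
Qed.

Let ub3 (z' : R) : `|(1 - 2 * z' ^+ 2) * expR (- z' ^+ 2)| <= 3.
Proof.
have := sqr_mul_gauss_le1 z'; have := gauss_le1 z'; have := expR_ge0 (- z' ^+ 2).
have := sqr_ge0 z'.
move: (z' ^+ 2) => t; move: (expR (- t)) => e t0 e0 e1 te.
have te0 : 0 <= t * e by exact: mulr_ge0.
by rewrite ler_norml; apply/andP; split; lra.
Qed.

Let iA3 : P.-integrable setT (EFin \o (fun w => A w ^+ 2 * 3)).
Proof.
rewrite (_ : _ \o _ = (fun w => 3%:E * (A w ^+ 2)%:E)%E); last first.
  by apply/funext => w; rewrite /= mulrC EFinM.
exact: integrableZl.
Qed.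

(** The derivative in [x] of the previous expectation at [x = 0]. *)
Let F2E (y : R) : \int[P]_w (A w ^+ 2 * ((1 - 2 * (y * W w) ^+ 2) * expR (- (y * W w) ^+ 2))) =
  v * Q y 0 `^ (- 2^-1 - 1) - 6 * (y ^+ 2 * c ^+ 2) * Q y 0 `^ (- 2^-1 - 1 - 1).
Proof.
have h1 : is_derive (0 : R) 1 (fun x => \int[P]_w (A w * z y x w * expR (- z y x w ^+ 2)))
    (\int[P]_w (A w ^+ 2 * ((1 - 2 * (z y 0 w) ^+ 2) * expR (- z y 0 w ^+ 2)))).
  apply: (is_derive_Rintegral (f := fun x w => A w * z y x w * expR (- z y x w ^+ 2))
   (f' := fun x w => (A w ^+ 2 * ((1 - 2 * (z y x w) ^+ 2) * expR (- z y x w ^+ 2))))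
   (G := fun w => A w ^+ 2 * 3) (ball_itv 0)) => //.
  - move=> x' w _; have := dz y x' w.
    have h : is_derive x' 1 (fun x => A w * z y x w) (A w ^+ 2).
      by rewrite /z; apply: is_derive_eq; rewrite /GRing.scale/=; ring.
    move=> h'; apply: is_derive_eq; rewrite /GRing.scale/=; ring.
  - move=> x' w _; rewrite normrM (ger0_norm (sqr_ge0 _)).
    by apply: ler_wpM2l; [exact: sqr_ge0|exact: ub3].
rewrite (_ : (fun x => \int[P]_w (A w * z y x w * expR (- z y x w ^+ 2))) =
  (fun x => (y * c + x * v) * Q y x `^ (- 2^-1 - 1))) in h1; last first.
  by apply/funext => x'; rewrite F1E.
have h2 : is_derive (0 : R) 1 (fun x => (y * c + x * v) * Q y x `^ (- 2^-1 - 1))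
  (v * Q y 0 `^ (- 2^-1 - 1) - 6 * (y ^+ 2 * c ^+ 2) * Q y 0 `^ (- 2^-1 - 1 - 1)).
  clear h1; have h : is_derive (0 : R) 1 (Q y) (4 * (y * c)).
    by rewrite /Q; apply: is_derive_eq; rewrite /GRing.scale/=; ring.
  have {}h := is_derive_powR_comp (- 2^-1 - 1) (Q0 y 0) h.
  by apply: is_derive_eq; rewrite /GRing.scale/=; field.
rewrite -(is_derive_unique h1 h2); apply: eq_Rintegral => w _.
by rewrite /z mul0r addr0.
Qed.

(** The formula for [E[A^2 exp(-W^2)]], from the values of [E[exp(-(yW+xA)^2)]] alone; no joint
    law is needed.  Differentiating twice in [x] at [0] gives
    [E[A^2 (1 - 2 y^2 W^2) exp(-y^2 W^2)]], which is the derivative in [y] of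
    [E[A^2 y exp(-y^2 W^2)]].  The latter is thus known up to its value at [y = 0]. *)
Lemma gaussian_sqr_gauss :
  \int[P]_w (A w ^+ 2 * expR (- W w ^+ 2)) =
  (1 + 2 * s) `^ (- 2^-1) * (v - 2 * c ^+ 2 / (1 + 2 * s)).
Proof.
pose Th y := \int[P]_w (A w ^+ 2 * (y * expR (- (y * W w) ^+ 2))).
(* [La] vanishes at [0] and its derivative is the right-hand side of [F2E]. *)
pose La y := v * y * Q y 0 `^ (- 2^-1) - 2 * c ^+ 2 * y ^+ 3 * Q y 0 `^ (- 2^-1 - 1).
have dTh (y : R) : is_derive y 1 Th (\int[P]_w (A w ^+ 2 * ((1 - 2 * (y * W w) ^+ 2) * expR (- (y * W w) ^+ 2)))).
  apply: (is_derive_Rintegral (f := fun y w => A w ^+ 2 * (y * expR (- (y * W w) ^+ 2)))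
   (f' := fun y w => A w ^+ 2 * ((1 - 2 * (y * W w) ^+ 2) * expR (- (y * W w) ^+ 2)))
   (G := fun w => A w ^+ 2 * 3) (ball_itv y)) => //.
  - move=> x _.
    have ix : P.-integrable setT (EFin \o (fun w => `|x| * A w ^+ 2)).
      by rewrite (_ : _ \o _ = (fun w => `|x|%:E * (A w ^+ 2)%:E)%E)//; exact: integrableZl.
    apply: (integrable_dom _ ix).
      apply: measurable_funM; first exact: measurable_funX.
      apply: measurable_funM => //; apply: measurableT_comp => //; apply: measurableT_comp => //.
      by apply: measurable_funX; exact: measurable_funM.
    move=> w; rewrite normrM (ger0_norm (sqr_ge0 _)) mulrC ler_wpM2r ?sqr_ge0//.
    by rewrite normrM ler_piMr// ger0_norm ?expR_ge0 ?gauss_le1.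
  - move=> x w _; apply: is_deriveZ; exact: d3.
  - move=> x w _; rewrite normrM (ger0_norm (sqr_ge0 _)).
    by apply: ler_wpM2l; [exact: sqr_ge0|exact: ub3].
have dLa (y : R) : is_derive y 1 La (v * Q y 0 `^ (- 2^-1 - 1) - 6 * (y ^+ 2 * c ^+ 2) * Q y 0 `^ (- 2^-1 - 1 - 1)).
  have h : is_derive y 1 (Q ^~ 0) (4 * y * s).
    by rewrite /Q; apply: is_derive_eq; rewrite /GRing.scale/=; ring.
  have h1 := is_derive_powR_comp (f := Q ^~ 0) (- 2^-1) (Q0 y 0) h.
  have h2 := is_derive_powR_comp (f := Q ^~ 0) (- 2^-1 - 1) (Q0 y 0) h.
  rewrite /La; apply: is_derive_eq; rewrite /GRing.scale/=.
  rewrite (powR_pred (- 2^-1) (Q0 y 0)) (powR_pred (- 2^-1 - 1) (Q0 y 0)).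
  by move: (Q y 0 `^ (- 2^-1 - 1 - 1)) => e; rewrite /Q; field.
have dTL (y : R) : is_derive y 1 (Th - La) 0.
  rewrite -(subrr (\int[P]_w (A w ^+ 2 * ((1 - 2 * (y * W w) ^+ 2) * expR (- (y * W w) ^+ 2))))).
  by apply: is_deriveB; rewrite F2E; exact: dLa.
have TL : Th 1 - La 1 = Th 0 - La 0 := is_derive_0_is_cst 1 0 dTL.
have Th0 : Th 0 = 0.
  rewrite /Th; under eq_Rintegral do rewrite mul0r mulr0.
  by rewrite Rintegral_cst// mul0r.
have La0 : La 0 = 0 by rewrite /La expr0n/= !(mulr0, mul0r) subr0.
have {}TL : Th 1 = La 1 by apply: subr0_eq; rewrite TL Th0 La0 subr0.
transitivity (Th 1); first by apply: eq_Rintegral => w _; rewrite !mul1r.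
rewrite TL /La expr1n !mulr1 (powR_pred (- 2^-1) (Q0 1 0)).
have := Q0 1 0; rewrite /Q expr1n mul1r !(mulr0, mul0r) expr0n/= mul0r !addr0 => qs.
rewrite (powR_pred (- 2^-1) qs).
by field; rewrite gt_eqF.
Qed.

End gaussian_square.

(** * The Gaussian space of a fractional Brownian motion *)

Section square_integrable.
Context d (T : measurableType d) (R : realType) (P : probability T R).

(** Measurable and square-integrable variables. *)
Definition sqint (Y : T -> R) : Prop :=
  measurable_fun setT Y /\ P.-integrable setT (EFin \o (fun w => Y w ^+ 2)).

Lemma sqint_mul (Y Z : T -> R) : sqint Y -> sqint Z ->
  P.-integrable setT (EFin \o (fun w => Y w * Z w)).
Proof.
move=> [mY iY] [mZ iZ].
have iYZ : P.-integrable setT (EFin \o (fun w => Y w ^+ 2 + Z w ^+ 2)).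
  rewrite (_ : _ \o _ = (fun w => (Y w ^+ 2)%:E + (Z w ^+ 2)%:E)%E)//.
  exact: integrableD.
apply: (integrable_dom _ iYZ); first exact: measurable_funM.
move=> w; rewrite ler_norml.
have := sqr_ge0 (Y w - Z w); have := sqr_ge0 (Y w + Z w).
by have := sqr_ge0 (Y w); have := sqr_ge0 (Z w); nra.
Qed.

Lemma sqint_comb (a b : R) (Y Z : T -> R) : sqint Y -> sqint Z ->
  sqint (fun w => a * Y w + b * Z w).
Proof.
move=> sY sZ; have iYZ := sqint_mul sY sZ; case: sY sZ => mY iY [mZ iZ].
split; first by apply: measurable_funD; exact: measurable_funM.
rewrite (_ : _ \o _ = (fun w => (a ^+ 2)%:E * (Y w ^+ 2)%:E +
   ((2 * a * b)%:E * (Y w * Z w)%:E + (b ^+ 2)%:E * (Z w ^+ 2)%:E))%E).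
  by do 2?apply: integrableD => //; exact: integrableZl.
by apply/funext => w /=; rewrite -!EFinM -!EFinD; congr EFin; ring.
Qed.

(** The covariance of centred variables, as a real number; means are not subtracted,
    since it is only used on the linear span of a centred process. *)
Definition covar (Y Z : T -> R) : R := \int[P]_w (Y w * Z w).

Lemma covarC Y Z : covar Y Z = covar Z Y.
Proof. by apply: eq_Rintegral => w _; rewrite mulrC. Qed.

Lemma covar_combl (a b : R) (Y Z V : T -> R) : sqint Y -> sqint Z -> sqint V ->
  covar (fun w => a * Y w + b * Z w) V = a * covar Y V + b * covar Z V.
Proof.
move=> sY sZ sV.
have iYV := sqint_mul sY sV; have iZV := sqint_mul sZ sV.
rewrite /covar -!RintegralZl//.
rewrite -RintegralD//.
- by apply: eq_Rintegral => w _; ring.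
- rewrite (_ : _ \o _ = (fun w => a%:E * (Y w * V w)%:E)%E)//.
  by apply: integrableZl => //; exact: sqint_mul.
- rewrite (_ : _ \o _ = (fun w => b%:E * (Z w * V w)%:E)%E)//.
  by apply: integrableZl => //; exact: sqint_mul.
Qed.

Lemma covar_combr (a b : R) (Y Z V : T -> R) : sqint Y -> sqint Z -> sqint V ->
  covar V (fun w => a * Y w + b * Z w) = a * covar V Y + b * covar V Z.
Proof. by move=> sY sZ sV; rewrite covarC covar_combl// !(covarC V). Qed.

Lemma covar_ge0 Y : 0 <= covar Y Y.
Proof. by apply: Rintegral_ge0 => w _; rewrite -expr2 sqr_ge0. Qed.

End square_integrable.

Section gaussian_span.
Context d (T : measurableType d) (R : realType) (P : probability T R).
Variables (H : R) (B : R -> T -> R).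
Hypothesis hB : real_fBm P H B.

(** Finite linear combinations of the values of the process at nonnegative times; the
    coefficients and times are explicit so that the Gaussian hypothesis applies. *)
Definition span (Y : T -> R) : Prop :=
  exists (k : nat) (a t : 'I_k -> R), (forall j, 0 <= t j) /\
    Y = (fun w => \sum_(j < k) a j * B (t j) w).

Lemma span_proc t : 0 <= t -> span (B t).
Proof.
move=> t0; exists 1%N, (fun=> 1), (fun=> t); split=> //.
by apply/funext => w; rewrite big_ord1 mul1r.
Qed.

Lemma span_comb (a b : R) Y Z : span Y -> span Z -> span (fun w => a * Y w + b * Z w).
Proof.
move=> [k [c [t [t0 ->]]]] [l [e [u [u0 ->]]]].
exists (k + l)%N, (fun j => match fintype.split j with inl i => a * c i | inr i => b * e i end),
  (fun j => match fintype.split j with inl i => t i | inr i => u i end).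
split; first by move=> j; case: fintype.split.
apply/funext => w; rewrite big_split_ord/= !mulr_sumr; congr (_ + _).
- by apply: eq_bigr => i _; rewrite (unsplitK (inl i)) mulrA.
- by apply: eq_bigr => i _; rewrite (unsplitK (inr i)) mulrA.
Qed.

Lemma span_law Y : span Y -> measurable_fun setT Y /\
  exists m s : R, 0 <= s /\
    forall A : set R, measurable A -> P (Y @^-1` A) = gaussian_law m s A.
Proof.
by move=> [k [a [t [t0 ->]]]]; case: hB => gB _ _ _; exact: gB.
Qed.

Lemma span_sqint Y : span Y -> sqint P Y.
Proof.
move=> /span_law[mY [m [s [s0 YE]]]]; split => //.
by apply: (@mgf_integrable_sqr _ _ _ P Y m s) => // h; exact: mgf_gaussian.
Qed.

Lemma sqint_integrable Y : sqint P Y -> P.-integrable setT (EFin \o Y).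
Proof.
move=> sY; have := @sqint_mul _ _ _ P Y (cst 1) sY.
rewrite (_ : _ \o (fun w => Y w * cst 1 w) = EFin \o Y); last by apply/funext => w /=; rewrite mulr1.
apply; split=> //.
rewrite (_ : _ \o _ = EFin \o cst 1); first exact: finite_measure_integrable_cst.
by apply/funext => w /=; rewrite expr1n.
Qed.

Lemma proc_mean t : 0 <= t -> \int[P]_w B t w = 0.
Proof.
by move=> t0; case: hB => _ _ + _ => /(_ t t0); rewrite unlock /Rintegral => ->.
Qed.

Lemma span_mean Y : span Y -> \int[P]_w Y w = 0.
Proof.
move=> [k [a [t [t0 ->]]]].
have iB j : P.-integrable setT (fun w => (a j * B (t j) w)%:E).
  rewrite (_ : (fun w => _) = (fun w => (a j)%:E * (B (t j) w)%:E)%E)//.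
  by apply: integrableZl => //; exact/sqint_integrable/span_sqint/span_proc.
rewrite /Rintegral; under eq_integral do rewrite -sumEFin.
rewrite integral_sum// big1 ?fine0// => j _.
under eq_integral do rewrite EFinM.
rewrite integralZl//; last exact/sqint_integrable/span_sqint/span_proc.
rewrite RintegralE; last exact/sqint_integrable/span_sqint/span_proc.
by rewrite proc_mean// mule0.
Qed.

Lemma span_gauss Y : span Y ->
  \int[P]_w expR (- Y w ^+ 2) = (1 + 2 * covar P Y Y) `^ (- 2^-1).
Proof.
move=> sY; have [mY [m [s [s0 YE]]]] := span_law sY.
have mg h := mgf_gaussian h mY YE.
have m0 : m = 0 by rewrite -(mgf_mean mY mg) span_mean.
have s2 : covar P Y Y = s ^+ 2.
  by have := mgf_second_moment mY mg; rewrite m0 expr0n/= add0r => <-.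
have YE0 (C : set R) : measurable C -> P (Y @^-1` C) = gaussian_law 0 s C.
  by rewrite -m0; exact: YE.
by rewrite s2 /Rintegral (expectation_gauss_gaussian s0 mY YE0).
Qed.

(** [gaussian_sqr_gauss] in the span of the process, with an inverse temperature [lam],
    absorbed in [W] through its square root. *)
Lemma span_gaussian_sqr (lam : R) A W : 0 <= lam -> span A -> span W ->
  \int[P]_w (A w ^+ 2 * expR (- (lam * W w ^+ 2))) =
  (1 + 2 * lam * covar P W W) `^ (- 2^-1) *
  (covar P A A - 2 * lam * covar P A W ^+ 2 / (1 + 2 * lam * covar P W W)).
Proof.
move=> l0 sA sW; pose W' w := Num.sqrt lam * W w + 0 * W w.
have qA := span_sqint sA; have qW := span_sqint sW.
have sW' : span W' by exact: span_comb.
have qW' := span_sqint sW'.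
have W'E w : W' w = Num.sqrt lam * W w by rewrite /W' mul0r addr0.
have l2 : Num.sqrt lam * Num.sqrt lam = lam by rewrite -expr2 sqr_sqrtr.
have cWW : covar P W' W' = lam * covar P W W.
  by rewrite /W' covar_combl// covar_combr// -[in RHS]l2; ring.
have cAW : covar P A W' = Num.sqrt lam * covar P A W.
  by rewrite /W' covar_combr//; ring.
have cxy (x y : R) : covar P (fun w => y * W' w + x * A w) (fun w => y * W' w + x * A w) =
   y ^+ 2 * covar P W' W' + 2 * x * y * covar P A W' + x ^+ 2 * covar P A A.
  rewrite covar_combl//; last exact: sqint_comb.
  by rewrite (covar_combr _ _ qW' qA qW') (covar_combr _ _ qW' qA qA) (covarC P W' A); ring.
have := @gaussian_sqr_gauss _ _ _ P A W' (covar P A A) (covar P A W') (covar P W' W').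
rewrite cWW cAW exprMn sqr_sqrtr// !mulrA => <-.
- by apply: eq_Rintegral => w _; rewrite W'E exprMn sqr_sqrtr.
- exact: qA.1.
- exact: qW'.1.
- exact: qA.2.
- by move=> x y; have := covar_ge0 P (fun w => y * W' w + x * A w); rewrite cxy cWW cAW !mulrA.
- move=> x y; rewrite span_gauss ?cxy ?cWW ?cAW ?mulrA//.
  exact: span_comb.
Qed.

Lemma span_gauss_lam (lam : R) W : 0 <= lam -> span W ->
  \int[P]_w expR (- (lam * W w ^+ 2)) = (1 + 2 * lam * covar P W W) `^ (- 2^-1).
Proof.
move=> l0 sW; pose W' w := Num.sqrt lam * W w + 0 * W w.
have qW := span_sqint sW.
have sW' : span W' by exact: span_comb.
have qW' := span_sqint sW'.
have W'E w : W' w = Num.sqrt lam * W w by rewrite /W' mul0r addr0.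
have l2 : Num.sqrt lam * Num.sqrt lam = lam by rewrite -expr2 sqr_sqrtr.
have cWW : covar P W' W' = lam * covar P W W.
  by rewrite /W' covar_combl// covar_combr// -[in RHS]l2; ring.
rewrite -mulrA -cWW -span_gauss//; apply: eq_Rintegral => w _.
by rewrite W'E exprMn sqr_sqrtr.
Qed.

Lemma proc_covar s t : 0 <= s -> 0 <= t ->
  covar P (B s) (B t) =
  2^-1 * (`|s| `^ (2 * H) + `|t| `^ (2 * H) - `|s - t| `^ (2 * H)).
Proof.
move=> s0 t0; case: hB => _ _ mB /(_ s t s0 t0).
rewrite unlock !mB//= => h; apply: EFin_inj; rewrite -h unlock.
rewrite -RintegralE; last by apply: sqint_mul; exact/span_sqint/span_proc.
by apply: eq_integral => w _; rewrite !fctE/= !subr0.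
Qed.

End gaussian_span.

(** * Products over independent coordinates *)

Section independence.
Context d (T : measurableType d) (R : realType) (P : probability T R).

(** [f] is a random variable whose superlevel sets belong to the class [F]; this is all that
    the layer-cake formula needs to exploit independence. *)
Definition sub_measurable (F : set (set T)) (f : T -> R) : Prop :=
  measurable_fun setT f /\ forall y, F [set w | y < f w].

(** The expectation of a product splits as soon as the expectation of [g] on each superlevel
    set of [f] does. *)
Lemma expectation_mul_indep (f : T -> R) (g : T -> \bar R) (k : \bar R) :
  measurable_fun setT f -> measurable_fun setT g ->
  (forall x, 0 <= f x) -> (forall x, 0 <= g x)%E -> (0 <= k)%E ->
  (forall y, \int[P]_(x in [set x | (y < f x)%R]) g x = k * P [set x | (y < f x)%R])%E ->
  (\int[P]_x ((f x)%:E * g x) = (\int[P]_x (f x)%:E) * k)%E.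
Proof.
move=> mf mg f0 g0 k0 fg.
rewrite -ge0_integralZr//; last 2 first.
- exact/measurable_EFinP.
- by move=> x _; rewrite lee_fin.
rewrite !(ge0_integral_layer P mf)//.
apply: eq_integral => y _; rewrite fg integral_cst//.
exact: measurable_superlevel.
Qed.

Variables (n : nat) (F : 'I_n -> set (set T)).
Hypothesis indF : mutually_independent P F.
Hypothesis FT : forall i, F i `<=` measurable.

Let P_bigcap (J : {set 'I_n}) (E : 'I_n -> set T) :
  (forall i, i \in J -> F i (E i)) -> measurable (\bigcap_(i in [set` J]) E i).
Proof.
by move=> FE; apply: fin_bigcap_measurable => // i iJ; apply/FT/FE.
Qed.

(** The factors are detached one at a time: by the layer-cake formula, integrating the factor
    [i] amounts to adding one of its superlevel sets to the family [E] of events, hence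
    the induction on the remaining factors [s] for every family of events indexed by a
    set [J] disjoint from [s]. *)
Lemma indep_prod_seq (f : 'I_n -> T -> R) (s : seq 'I_n) (J : {set 'I_n}) (E : 'I_n -> set T) :
  (forall i, sub_measurable (F i) (f i)) -> (forall i w, 0 <= f i w) ->
  uniq s -> (forall i, i \in J -> i \notin s) ->
  (forall i, i \in J -> F i (E i)) ->
  (\int[P]_(w in \bigcap_(i in [set` J]) E i) (\prod_(i <- s) f i w)%:E =
   \prod_(i <- s) (\int[P]_w (f i w)%:E) * P (\bigcap_(i in [set` J]) E i))%E.
Proof.
move=> mf f0; elim: s J E => [|i s IH] J E.
  move=> _ _ FE; rewrite big_nil mul1e.
  under eq_integral do rewrite big_nil.
  by rewrite integral_cst ?mul1e//; exact: P_bigcap.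
move=> /= /andP[is_ us] Js FE.
rewrite big_cons [LHS]integral_mkcond.
pose g w := ((fun w => (\prod_(i <- s) f i w)%:E) \_ (\bigcap_(i in [set` J]) E i)) w.
have mp : measurable_fun setT (fun w => \prod_(i <- s) f i w).
  by apply: measurable_prod => j _; have [] := mf j.
have g0 w : (0 <= g w)%E.
  by rewrite /g patchE; case: ifP => // _; rewrite lee_fin prodr_ge0.
have mg : measurable_fun setT g.
  apply/(measurable_restrictT _ (P_bigcap FE)).
  exact/measurable_funTS/measurable_EFinP.
transitivity (\int[P]_w ((f i w)%:E * g w))%E.
  apply: eq_integral => w _; rewrite /g !patchE; case: ifP => _; rewrite ?mule0//.
  by rewrite big_cons EFinM.
have k0 : (0 <= \prod_(j <- s) \int[P]_w (f j w)%:E * P (\bigcap_(j in [set` J]) E j))%E.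
  by rewrite mule_ge0// prode_ge0// => j _; apply: integral_ge0 => w _; rewrite lee_fin.
rewrite (expectation_mul_indep (k := (\prod_(j <- s) \int[P]_w (f j w)%:E * P (\bigcap_(j in [set` J]) E j))%E))//; first by rewrite muleA.
- by have [] := mf i.
move=> y.
pose J' := i |: J; pose E' j := if j == i then [set x | y < f i x] else E j.
have iJ : i \notin J by apply/negP => /Js; rewrite inE eqxx.
have E'J j : j \in J -> E' j = E j.
  by rewrite /E'; case: eqVneq => // -> ; rewrite (negbTE iJ).
have E'i : E' i = [set x | y < f i x] by rewrite /E' eqxx.
have capE : \bigcap_(j in [set` J']) E' j = [set x | y < f i x] `&` \bigcap_(j in [set` J]) E j.
  apply/seteqP; split => [x h|x [h1 h2] j].
    split; first by have := h i; rewrite E'i; apply; rewrite /= !inE eqxx.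
    by move=> j /= jJ; rewrite -E'J//; apply: h; rewrite /= !inE jJ orbT.
  rewrite /= !inE => /orP[/eqP ->|jJ]; first by rewrite E'i.
  by rewrite E'J//; exact: h2.
have FE' j : j \in J' -> F j (E' j).
  rewrite !inE => /orP[/eqP ->|jJ]; first by rewrite E'i; have [_] := mf i; exact.
  by rewrite E'J//; exact: FE.
have J's j : j \in J' -> j \notin s.
  rewrite !inE => /orP[/eqP ->//|/Js].
  by rewrite inE negb_or => /andP[].
have := IH J' E' us J's FE'.
have -> : (P (\bigcap_(j in [set` J']) E' j) = P (\bigcap_(j in [set` J]) E j) * P [set x | (y < f i x)%R])%E.
  rewrite indF// indF// /J' big_setU1//= E'i muleC; congr (_ * _)%E.
  by apply: eq_bigr => j jJ; rewrite E'J.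
rewrite muleA => <-; rewrite capE integral_mkcondr.
by apply: eq_integral => w _; rewrite /g.
Qed.

Lemma indep_prod (f : 'I_n -> T -> R) :
  (forall i, sub_measurable (F i) (f i)) -> (forall i w, 0 <= f i w) ->
  (\int[P]_w (\prod_i f i w)%:E = \prod_i \int[P]_w (f i w)%:E)%E.
Proof.
move=> mf f0.
have := @indep_prod_seq f (index_enum 'I_n) finset.set0 (fun=> setT) mf f0.
have -> : \bigcap_(i in [set` (finset.set0 : {set 'I_n})]) [set: T] = setT.
  by apply/seteqP; split => // x _ i.
move=> /(_ (index_enum_uniq _)).
rewrite probability_setT mule1; apply => i; rewrite inE//.
Qed.

End independence.

Section fbm_vector.
Context d (T : measurableType d) (R : realType) (P : probability T R).
Variables (n : nat) (H : R) (X : R -> T -> 'rV[R]_n).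
Hypothesis hX : fBm P H X.

Let B i := fun t w => X t w ord0 i.
Let F i := process_sigma_algebra (B i).

Let hB i : real_fBm P H (B i).
Proof. by case: hX => h _; exact: (h i). Qed.

Lemma process_sigma_sub i : F i `<=` measurable.
Proof.
apply: smallest_sub; first exact: sigma_algebra_measurable.
move=> _ [t [A [t0 mA ->]]].
have [mB _] := span_law (hB i) (span_proc (B i) t0).
by rewrite -[X in measurable X]setTI; exact: mB.
Qed.

Let G i := [set E | exists (t : R) (A : set R),
         [/\ 0 <= t, measurable A & E = B i t @^-1` A]].
Let OF i := g_sigma_algebraType (G i).

(** Elements of the span of a coordinate are measurable for the sigma-algebra generated by
    this coordinate. *)
Lemma span_measurable_sigma i Y : span (B i) Y -> measurable_fun [set: OF i] (Y : OF i -> R).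
Proof.
move=> [k [a [t [t0 ->]]]]; apply: measurable_sum => j.
apply: measurable_funM => //.
move=> _ A mA; rewrite setTI; apply: sub_sigma_algebra.
by exists (t j), A.
Qed.

Lemma sub_measurable_sigma i (f : T -> R) :
  measurable_fun [set: OF i] (f : OF i -> R) -> sub_measurable (F i) f.
Proof.
move=> mf; split.
  move=> _ A mA; rewrite setTI; apply: (process_sigma_sub (i := i)).
  by have := mf measurableT A mA; rewrite setTI.
by move=> y; exact: (measurable_superlevel (T := OF i) y mf).
Qed.

(** The vector form of the Gaussian identity: [|A|^2] is a sum over the coordinates, and each
    summand times [exp(-lam |W|^2)] is a product of functions of independent coordinates. *)
Lemma fbm_gauss_sqr_expectation (lam v c s : R) (A W : T -> 'rV[R]_n) :
  0 <= lam -> 0 <= s ->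
  (forall i, span (B i) (fun w => A w ord0 i)) ->
  (forall i, span (B i) (fun w => W w ord0 i)) ->
  (forall i, covar P (fun w => A w ord0 i) (fun w => A w ord0 i) = v) ->
  (forall i, covar P (fun w => A w ord0 i) (fun w => W w ord0 i) = c) ->
  (forall i, covar P (fun w => W w ord0 i) (fun w => W w ord0 i) = s) ->
  (\int[P]_w (dotp (A w) (A w) * expR (- (lam * dotp (W w) (W w))))%:E =
   (n%:R * (((1 + 2 * lam * s) `^ (- 2^-1)) ^+ n * (v - 2 * lam * c ^+ 2 / (1 + 2 * lam * s))))%:E)%E.
Proof.
move=> l0 s0 sA sW vE cE sE.
set q := _ `^ _; set b := v - _.
pose f (i j : 'I_n) w := (if j == i then A w ord0 j ^+ 2 else 1) * expR (- (lam * W w ord0 j ^+ 2)).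
have f0 i j w : 0 <= f i j w by rewrite mulr_ge0 ?expR_ge0//; case: ifP; rewrite ?sqr_ge0.
have mf i j : sub_measurable (F j) (f i j).
  have mA := span_measurable_sigma (sA j); have mW := span_measurable_sigma (sW j).
  apply: sub_measurable_sigma; apply: measurable_funM.
    by case: (j == i) => //; exact: measurable_funX.
  apply: measurableT_comp => //; apply: measurableT_comp => //.
  by apply: measurable_funM => //; exact: measurable_funX.
have mfT i j : measurable_fun setT (f i j) by have [] := mf i j.
have E1 j : (\int[P]_w (expR (- (lam * W w ord0 j ^+ 2)))%:E = q%:E)%E.
  have := span_gauss_lam (hB j) l0 (sW j); rewrite sE -/q => <-.
  rewrite RintegralE//; apply: (integrable_dom (g := cst 1)); first last.
  - move=> w; rewrite ger0_norm ?expR_ge0// -[leRHS]expR0 ler_expR oppr_le0.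
    by rewrite mulr_ge0// sqr_ge0.
  - exact: finite_measure_integrable_cst.
  - have [mW _] := span_law (hB j) (sW j).
    apply: measurableT_comp => //; apply: measurableT_comp => //.
    by apply: measurable_funM => //; exact: measurable_funX.
have E2 j : (\int[P]_w (A w ord0 j ^+ 2 * expR (- (lam * W w ord0 j ^+ 2)))%:E = (q * b)%:E)%E.
  have := span_gaussian_sqr (hB j) l0 (sA j) (sW j); rewrite sE vE cE -/q -/b => <-.
  rewrite RintegralE//; have [mA iA] := span_sqint (hB j) (sA j).
  have [mW _] := span_law (hB j) (sW j).
  apply: (integrable_dom _ iA).
    apply: measurable_funM; first exact: measurable_funX.
    apply: measurableT_comp => //; apply: measurableT_comp => //.
    by apply: measurable_funM => //; exact: measurable_funX.
  move=> w; rewrite normrM (ger0_norm (sqr_ge0 _)) ler_piMr ?sqr_ge0//.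
  rewrite ger0_norm ?expR_ge0// -[leRHS]expR0 ler_expR oppr_le0.
  by rewrite mulr_ge0// sqr_ge0.
transitivity (\int[P]_w \sum_(i < n) (\prod_(j < n) f i j w)%:E)%E.
  apply: eq_integral => w _; rewrite sumEFin; congr EFin.
  rewrite /dotp mulr_suml; apply: eq_bigr => i _.
  rewrite /f big_split/= -big_mkcond/= big_pred1_eq -expr2; congr (_ * _).
  by rewrite -expR_sum mulr_sumr -sumrN; congr expR; apply: eq_bigr => j _; rewrite expr2.
rewrite ge0_integral_sum//; last 2 first.
- move=> i; apply/measurable_EFinP; exact: measurable_prod.
- by move=> i w _; rewrite lee_fin prodr_ge0.
transitivity (\sum_(i < n) (q ^+ n * b)%:E)%E; last first.
  by rewrite sumEFin sumr_const card_ord -[in LHS]mulr_natl.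
apply: eq_bigr => i _.
rewrite (indep_prod (F := F)) //; last 2 first.
- by case: hX.
- exact: process_sigma_sub.
rewrite (bigD1 i)//= {1}/f eqxx E2.
rewrite (eq_bigr (fun=> q%:E)); last first.
  move=> j ji; rewrite -(E1 j); apply: eq_integral => w _.
  by rewrite /f (negbTE ji) mul1r.
rewrite prodEFin -EFinM prodr_const cardC1 card_ord; congr EFin.
by rewrite -{2}(ltn_predK (ltn_ord i)) exprS; ring.
Qed.

End fbm_vector.

Lemma measurable_inv (R : realType) : measurable_fun setT (fun x : R => x^-1).
Proof.
(* Squaring first avoids real powers of negative numbers. *)
rewrite (_ : (fun x : R => x^-1) = (fun x => x * (x ^+ 2) `^ (-1))).
  apply: measurable_funM => //.
  apply: (measurableT_comp (f := fun y : R => y `^ (-1))); [exact: measurable_powR|exact: measurable_funX].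
apply/funext => x; rewrite powR_inv1 ?sqr_ge0//.
have [->|x0] := eqVneq x 0; first by rewrite invr0 mul0r.
by field.
Qed.

Lemma measurable_funV d (T : measurableType d) (R : realType) (f : T -> R) :
  measurable_fun setT f -> measurable_fun setT (fun x => (f x)^-1).
Proof. by move=> mf; exact: (measurableT_comp (@measurable_inv R)). Qed.

(** * The kernel as a mixture of Gaussians *)

Section kernel.
Context (R : realType).

(** The normalising constant of the kernel. *)
Definition Kcst (n : nat) (alpha : R) : R :=
  (Gamma alpha * (4 * pi) `^ (n%:R / 2))^-1.

Lemma Kcst_ge0 n alpha : 0 <= Kcst n alpha.
Proof.
rewrite invr_ge0 mulr_ge0 ?powR_ge0//; apply: Rintegral_ge0 => t _.
by rewrite mulr_ge0 ?powR_ge0 ?expR_ge0.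
Qed.

(** The density in [u] of the Gaussian mixture. *)
Definition kern (n : nat) (alpha u : R) : R :=
  u `^ (alpha - n%:R / 2) * expR (- u) / u.

Lemma kern_ge0 n alpha u : 0 < u -> 0 <= kern n alpha u.
Proof. by move=> u0; rewrite divr_ge0 ?mulr_ge0 ?powR_ge0 ?expR_ge0 ?(ltW u0). Qed.

Lemma measurable_kern n alpha : measurable_fun setT (kern n alpha).
Proof.
apply: measurable_funM; last exact: measurable_funV.
apply: measurable_funM; first exact: measurable_powR.
by apply: measurableT_comp => //; exact: measurableT_comp.
Qed.

(** The kernel as a function of the squared Euclidean norm [y = |x|^2]. *)
Definition Kfun n alpha (y : R) : \bar R :=
  ((Kcst n alpha)%:E * \int[lebesgue_measure]_(u in `]0%R, +oo[)
     (kern n alpha u * expR (- ((4 * u)^-1 * y)))%:E)%E.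

Lemma KE n alpha (x : 'rV[R]_n) : K alpha x = Kfun n alpha (dotp x x).
Proof.
rewrite /K /Kfun; congr (_ * _)%E; apply: eq_integral => u _; congr EFin.
by rewrite /kern expRD (mulrC (dotp x x)); ring.
Qed.

Lemma Kfun_ge0 n alpha y : (0 <= Kfun n alpha y)%E.
Proof.
rewrite mule_ge0 ?lee_fin ?Kcst_ge0//; apply: integral_ge0 => u.
by rewrite /= in_itv/= andbT => u0; rewrite lee_fin mulr_ge0 ?expR_ge0 ?kern_ge0.
Qed.

Let D : set R := `]0%R, +oo[%classic.
Let mD : measurable (D : set (measurableTypeR R)). Proof. exact: measurable_itv. Qed.

Lemma measurable_Kfun n alpha : measurable_fun setT (Kfun n alpha).
Proof.
apply: emeasurable_funM => //.
pose h (p : R * measurableTypeR R) : \bar R := ((\1_D p.2 * (kern n alpha p.2 * expR (- ((4 * p.2)^-1 * p.1)))))%:E.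
rewrite (_ : (fun y => _) = fubini_F (@lebesgue_measure R) h); last first.
  apply/funext => y; rewrite /fubini_F [LHS]integral_mkcond; apply: eq_integral => u _.
  rewrite /h/= patchE indicE; case: ifPn => uD; first by rewrite mul1r.
  by rewrite mul0r.
apply: measurable_fun_fubini_tonelli_F => [|p].
  apply/measurable_EFinP; apply: measurable_funM.
    by apply: measurableT_comp => //.
  apply: measurable_funM; first by apply: measurableT_comp => //; exact: measurable_kern.
  apply: measurableT_comp => //; apply: measurableT_comp => //.
  apply: measurable_funM => //; apply: (measurableT_comp (f := fun x : R => (4 * x)^-1)) => //.
  by apply: measurable_funV; exact: measurable_funM.
rewrite lee_fin indicE; have [|] := boolP (p.2 \in D); last by rewrite mul0r.
by rewrite inE /D/= in_itv/= andbT => p0; rewrite mul1r mulr_ge0 ?expR_ge0 ?kern_ge0.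
Qed.

End kernel.

Lemma measurable_dotp d (T : measurableType d) (R : realType) n (A B : T -> 'rV[R]_n) :
  (forall i, measurable_fun setT (fun w => A w ord0 i)) ->
  (forall i, measurable_fun setT (fun w => B w ord0 i)) ->
  measurable_fun setT (fun w => dotp (A w) (B w)).
Proof. by move=> mA mB; apply: measurable_sum => i; exact: measurable_funM. Qed.

Lemma dotp_ge0 (R : realType) n (x : 'rV[R]_n) : 0 <= dotp x x.
Proof. by apply: sumr_ge0 => i _; rewrite -expr2 sqr_ge0. Qed.

Section K_expectation.
Context d (T : measurableType d) (R : realType) (P : probability T R).
Variables (n : nat) (H : R) (X : R -> T -> 'rV[R]_n).
Hypothesis hX : fBm P H X.
Hypothesis n0 : (0 < n)%N.
Variable alpha : R.

Let B i := fun t w => X t w ord0 i.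
Let hB i : real_fBm P H (B i).
Proof. by case: hX => h _; exact: (h i). Qed.

(** Random vectors each of whose coordinates is in the span of that coordinate of [X]. *)
Definition vspan (A : T -> 'rV[R]_n) := forall i, span (B i) (fun w => A w ord0 i).

(** The covariance of each coordinate of [A] with the same coordinate of [A'] is [c]. *)
Definition vcovar (A A' : T -> 'rV[R]_n) (c : R) :=
  forall i, covar P (fun w => A w ord0 i) (fun w => A' w ord0 i) = c.

Let q (s u : R) := (1 + 2 * (4 * u)^-1 * s) `^ (- 2^-1).

Let D : set R := `]0%R, +oo[%classic.
Let mD : measurable (D : set (measurableTypeR R)). Proof. exact: measurable_itv. Qed.

Let Dgt0 (u : R) : D u -> 0 < u. Proof. by rewrite /D/= in_itv/= andbT. Qed.

(** The density [kern] times the expectation of [exp(-|W|^2/(4u))] when the coordinates of [W] have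
    variance [s]. *)
Definition gker (s u : R) := kern n alpha u * q s u ^+ n.

(** The weight [w(s)]: up to [Kcst], the expectation of [K_alpha(W)] when the coordinates of
    [W] have variance [s].  It may be infinite. *)
Definition wgt (s : R) : \bar R := (\int[lebesgue_measure]_(u in D) (gker s u)%:E)%E.

(** The coefficient of [c^2] in the Gaussian identity with [l = 1/(4u)]. *)
Definition lam (s u : R) := 2 * (4 * u)^-1 / (1 + 2 * (4 * u)^-1 * s).

Lemma vspan_measurable A i : vspan A -> measurable_fun setT (fun w => A w ord0 i).
Proof. by move=> sA; have [] := span_law (hB i) (sA i). Qed.

Lemma gker_ge0 s u : 0 < u -> 0 <= gker s u.
Proof. by move=> u0; rewrite mulr_ge0 ?exprn_ge0 ?powR_ge0// kern_ge0. Qed.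

Lemma measurable_gker s : measurable_fun setT (gker s).
Proof.
apply: measurable_funM; first exact: measurable_kern.
apply: measurable_funX.
apply: (measurableT_comp (f := fun y : R => y `^ (- 2^-1))); first exact: measurable_powR.
apply: measurable_funD => //; apply: measurable_funM => //; apply: measurable_funM => //.
by apply: measurable_funV; exact: measurable_funM.
Qed.

Lemma measurable_lam s : measurable_fun setT (lam s).
Proof.
apply: measurable_funM.
  by apply: measurable_funM => //; apply: measurable_funV; exact: measurable_funM.
apply: measurable_funV.
apply: measurable_funD => //; apply: measurable_funM => //; apply: measurable_funM => //.
by apply: measurable_funV; exact: measurable_funM.
Qed.

(** The expectation of [K_alpha(W) |A|^2], by Tonelli and [fbm_gauss_sqr_expectation]. *)
Lemma K_sqr_expectation (v c s : R) (A W : T -> 'rV[R]_n) :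
  0 <= s -> vspan A -> vspan W -> vcovar A A v -> vcovar A W c -> vcovar W W s ->
  (\int[P]_w (Kfun n alpha (dotp (W w) (W w)) * (dotp (A w) (A w))%:E) =
   (Kcst n alpha)%:E * \int[lebesgue_measure]_(u in D)
      (n%:R * (gker s u * (v - lam s u * c ^+ 2)))%:E)%E.
Proof.
move=> s0 sA sW vE cE sE.
have mW := measurable_dotp (fun i => vspan_measurable i sW) (fun i => vspan_measurable i sW).
have mA := measurable_dotp (fun i => vspan_measurable i sA) (fun i => vspan_measurable i sA).
pose h (p : T * measurableTypeR R) : \bar R :=
  (\1_D p.2 * (kern n alpha p.2 * (dotp (A p.1) (A p.1) * expR (- ((4 * p.2)^-1 * dotp (W p.1) (W p.1))))))%:E.
have h0 p : (0 <= h p)%E.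
  rewrite lee_fin indicE; have [|] := boolP (p.2 \in D); last by rewrite mul0r.
  rewrite inE => /Dgt0 p0; rewrite mul1r; apply: mulr_ge0; first exact: kern_ge0.
  by rewrite mulr_ge0 ?expR_ge0 ?dotp_ge0.
have mh : measurable_fun setT h.
  apply/measurable_EFinP; apply: measurable_funM.
    by apply: measurableT_comp.
  apply: measurable_funM; first by apply: measurableT_comp => //; exact: measurable_kern.
  apply: measurable_funM; first exact: (measurableT_comp mA).
  apply: measurableT_comp => //; apply: measurableT_comp => //.
  apply: measurable_funM; last exact: (measurableT_comp mW).
  apply: (measurableT_comp (f := fun x : R => (4 * x)^-1)) => //.
  by apply: measurable_funV; exact: measurable_funM.
have C0 := @Kcst_ge0 R n alpha.
transitivity (\int[P]_w ((Kcst n alpha)%:E * \int[lebesgue_measure]_u h (w, u)))%E.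
  apply: eq_integral => w _; rewrite /Kfun -muleA; congr (_ * _)%E.
  rewrite -ge0_integralZr//; last 3 first.
  - apply/measurable_EFinP/measurable_funTS; apply: measurable_funM; first exact: measurable_kern.
    apply: measurableT_comp => //; apply: measurableT_comp => //.
    by apply: measurable_funM => //; apply: measurable_funV; exact: measurable_funM.
  - by move=> u /Dgt0 u0; rewrite lee_fin mulr_ge0 ?kern_ge0 ?expR_ge0.
  - by rewrite lee_fin dotp_ge0.
  rewrite [LHS]integral_mkcond; apply: eq_integral => u _.
  rewrite /h/= patchE indicE -/D; case: ifPn => uD; last by rewrite mul0r.
  by rewrite mul1r -EFinM -mulrA; congr (_ * _)%:E; rewrite mulrC.
rewrite ge0_integralZl//; last 2 first.
- exact: (measurable_fun_fubini_tonelli_F (m2 := (@lebesgue_measure R)) h mh h0).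
- by move=> w _; exact: integral_ge0.
congr (_ * _)%E.
have -> := fubini_tonelli (m1 := P) (m2 := (@lebesgue_measure R)) h mh h0.
rewrite [RHS]integral_mkcond; apply: eq_integral => u _.
rewrite patchE; case: ifPn => uD; last first.
  by apply: integral0_eq => w _; rewrite /h/= indicE (negbTE uD) mul0r.
have u0 : 0 < u by apply/Dgt0; rewrite inE in uD.
have l0 : 0 <= (4 * u)^-1 by rewrite invr_ge0 mulr_ge0// ltW.
transitivity (\int[P]_w ((kern n alpha u)%:E *
   (dotp (A w) (A w) * expR (- ((4 * u)^-1 * dotp (W w) (W w))))%:E))%E.
  by apply: eq_integral => w _; rewrite /h/= indicE uD mul1r EFinM.
rewrite ge0_integralZl//; last 3 first.
- apply/measurable_EFinP; apply: measurable_funM => //.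
  by apply: measurableT_comp => //; apply: measurableT_comp => //; exact: measurable_funM.
- by move=> w _; rewrite lee_fin mulr_ge0 ?dotp_ge0 ?expR_ge0.
- by rewrite lee_fin kern_ge0.
rewrite (fbm_gauss_sqr_expectation hX l0 s0 sA sW vE cE sE) -EFinM; congr EFin.
by rewrite /gker /lam /q; ring.
Qed.

(** Nonnegativity holds because the quantity is a positive multiple of the expectation of a nonnegative variable. *)
Lemma var_sub_ge0 (v c s u : R) (A W : T -> 'rV[R]_n) : 0 < u ->
  0 <= s -> vspan A -> vspan W -> vcovar A A v -> vcovar A W c -> vcovar W W s ->
  0 <= v - lam s u * c ^+ 2.
Proof.
move=> u0 s0 sA sW vE cE sE.
have l0 : 0 <= (4 * u)^-1 by rewrite invr_ge0 mulr_ge0// ltW.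
have Q0 : 0 < 1 + 2 * (4 * u)^-1 * s by rewrite ltr_wpDr// !mulr_ge0.
have := fbm_gauss_sqr_expectation hX l0 s0 sA sW vE cE sE => h.
have : (0 <= \int[P]_w (dotp (A w) (A w) * expR (- ((4 * u)^-1 * dotp (W w) (W w))))%:E)%E.
  by apply: integral_ge0 => w _; rewrite lee_fin mulr_ge0 ?dotp_ge0 ?expR_ge0.
rewrite h lee_fin pmulr_rge0 ?ltr0n// pmulr_rge0 ?exprn_gt0 ?powR_gt0//.
by rewrite /lam (_ : 2 * _ * _ / _ = 2 / (4 * u) / (1 + 2 / (4 * u) * s) * c ^+ 2)//; ring.
Qed.

End K_expectation.

(** The arithmetic of polarisation in the extended reals, once all terms are known to be finite. *)
Lemma lee_quarter (R : realType) (a b c w : \bar R) (k : R) :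
  a \is a fin_num -> b \is a fin_num -> c \is a fin_num -> w \is a fin_num ->
  (c <= b + (4 * k)%:E * w)%E -> (a + b * (4^-1)%:E <= c * (4^-1)%:E)%E ->
  (a <= k%:E * w)%E.
Proof.
case: a => // a _; case: b => // b _; case: c => // c _; case: w => // w _.
rewrite -!EFinM -!EFinD !lee_fin => h1 h2; lra.
Qed.

(** * Polarisation of the kernel expectation *)

Section K_polarization.
Local Opaque Kfun Kcst gker.
Context d (T : measurableType d) (R : realType) (P : probability T R).
Variables (n : nat) (H : R) (X : R -> T -> 'rV[R]_n).
Hypothesis hX : fBm P H X.
Hypothesis n0 : (0 < n)%N.
Variable alpha : R.

Let hB i : real_fBm P H (fun t w => X t w ord0 i).
Proof. by case: hX => h _; exact: (h i). Qed.

Lemma vspan_comb (a b : R) (A B : T -> 'rV[R]_n) : vspan X A -> vspan X B ->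
  vspan X (fun w => a *: A w + b *: B w).
Proof.
move=> sA sB i.
rewrite (_ : (fun w => _) = (fun w => a * A w ord0 i + b * B w ord0 i)).
  exact: span_comb (sA i) (sB i).
by apply/funext => w; rewrite !mxE.
Qed.

Lemma vcovar_combl (a b cA cB : R) (A B C : T -> 'rV[R]_n) :
  vspan X A -> vspan X B -> vspan X C ->
  vcovar P A C cA -> vcovar P B C cB ->
  vcovar P (fun w => a *: A w + b *: B w) C (a * cA + b * cB).
Proof.
move=> sA sB sC hA hB' i.
rewrite (_ : (fun w => _) = (fun w => a * A w ord0 i + b * B w ord0 i)).
  have qA := span_sqint (hB i) (sA i); have qB := span_sqint (hB i) (sB i).
  have qC := span_sqint (hB i) (sC i).
  by rewrite covar_combl// hA hB'.
by apply/funext => w; rewrite !mxE.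
Qed.

Lemma vcovarC (A B : T -> 'rV[R]_n) c : vcovar P A B c -> vcovar P B A c.
Proof. by move=> h i; rewrite covarC. Qed.

Let D : set R := `]0%R, +oo[%classic.
Let mD : measurable (D : set (measurableTypeR R)). Proof. exact: measurable_itv. Qed.
Let Dgt0 (u : R) : D u -> 0 < u. Proof. by rewrite /D/= in_itv/= andbT. Qed.

Lemma lam_ge0 (s u : R) : 0 <= s -> 0 < u -> 0 <= lam s u.
Proof.
move=> s0 u0; have l0 : 0 <= (4 * u)^-1 by rewrite invr_ge0 mulr_ge0// ltW.
by rewrite divr_ge0 ?addr_ge0 ?mulr_ge0.
Qed.

Lemma wgt_ge0 (s : R) : (0 <= wgt n alpha s)%E.
Proof. by apply: integral_ge0 => u /Dgt0 u0; rewrite lee_fin gker_ge0. Qed.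

Lemma integrable_gker s : (wgt n alpha s < +oo)%E ->
  lebesgue_measure.-integrable D (EFin \o gker n alpha s).
Proof.
move=> ws; apply/integrableP; split.
  by apply/measurable_EFinP/measurable_funTS; exact: measurable_gker.
apply: le_lt_trans ws; rewrite /wgt; apply: ge0_le_integral => //.
- apply: measurableT_comp => //.
  by apply/measurable_EFinP/measurable_funTS; exact: measurable_gker.
- by apply/measurable_EFinP/measurable_funTS; exact: measurable_gker.
- by move=> u /Dgt0 u0; rewrite /= ger0_norm ?gker_ge0.
Qed.

Let mker (s v c : R) : measurable_fun setT (fun u => n%:R * (gker n alpha s u * (v - lam s u * c ^+ 2))).
Proof.
apply: measurable_funM => //; apply: measurable_funM; first exact: measurable_gker.
by apply: measurable_funB => //; apply: measurable_funM => //; exact: measurable_lam.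
Qed.

Section one.
Variables (v c s : R) (A W : T -> 'rV[R]_n).
Hypotheses (s0 : 0 <= s) (sA : vspan X A) (sW : vspan X W).
Hypotheses (vE : vcovar P A A v) (cE : vcovar P A W c) (sE : vcovar P W W s).

Lemma vcovar_ge0 : 0 <= v.
Proof. by rewrite -(vE (Ordinal n0)) covar_ge0. Qed.

Let v0 := vcovar_ge0.

Lemma ker_bound u : 0 < u ->
  0 <= n%:R * (gker n alpha s u * (v - lam s u * c ^+ 2)) <= n%:R * v * gker n alpha s u.
Proof.
move=> u0; have g0 := gker_ge0 n alpha s u0.
have b0 := var_sub_ge0 hX n0 u0 s0 sA sW vE cE sE.
apply/andP; split; first by apply: mulr_ge0 => //; exact: mulr_ge0.
rewrite -[leRHS]mulrA; apply: ler_wpM2l => //.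
rewrite [leRHS]mulrC; apply: ler_wpM2l => //.
by rewrite gerBl mulr_ge0 ?sqr_ge0 ?lam_ge0.
Qed.

Lemma integrable_ker : (wgt n alpha s < +oo)%E ->
  lebesgue_measure.-integrable D
   (fun u => (n%:R * (gker n alpha s u * (v - lam s u * c ^+ 2)))%:E).
Proof.
move=> ws.
have ig : lebesgue_measure.-integrable D (fun u => ((n%:R * v)%:E * (gker n alpha s u)%:E)%E).
  by apply: integrableZl => //; exact: integrable_gker.
apply: (le_integrable _ _ _ ig) => //.
  by apply/measurable_EFinP/measurable_funTS; exact: mker.
move=> u /Dgt0 u0; have /andP[h1 h2] := ker_bound u0.
rewrite lee_fin ger0_norm// (le_trans h2)// ger0_norm//.
by apply: mulr_ge0; [exact: mulr_ge0|exact: gker_ge0].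
Qed.

(** The term in [c^2] is nonpositive, hence dropped. *)
Lemma K_sqr_le :
  (\int[P]_w (Kfun n alpha (dotp (W w) (W w)) * (dotp (A w) (A w))%:E) <=
   (Kcst n alpha * n%:R * v)%:E * wgt n alpha s)%E.
Proof.
rewrite (K_sqr_expectation hX alpha s0 sA sW vE cE sE) -mulrA EFinM -muleA.
rewrite lee_wpmul2l ?lee_fin ?Kcst_ge0// /wgt.
rewrite -ge0_integralZl//; last 3 first.
- by apply/measurable_EFinP/measurable_funTS; exact: measurable_gker.
- by move=> u /Dgt0 u0; rewrite lee_fin gker_ge0.
- by rewrite lee_fin mulr_ge0.
apply: ge0_le_integral => //.
- by move=> u /Dgt0 /ker_bound /andP[h1 _]; rewrite lee_fin.
- by apply/measurable_EFinP/measurable_funTS; exact: mker.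
- apply/measurable_EFinP/measurable_funTS; apply: measurable_funM => //.
  exact: measurable_gker.
- by move=> u /Dgt0 /ker_bound /andP[_ h2]; rewrite -EFinM lee_fin.
Qed.

End one.

(** Polarisation multiplied by a possibly infinite [k]; the negative term is moved to the left so
    that no difference of infinities occurs. *)
Lemma mule_polarization (k : \bar R) (x y z : R) : (0 <= k)%E ->
  4 * x = y - z -> 0 <= y -> 0 <= z ->
  (k * x%:E + k * (z / 4)%:E <= k * (y / 4)%:E)%E.
Proof.
case: k => [k| |] // k0 xyz y0 z0.
  rewrite -!EFinM -EFinD lee_fin -mulrDr ler_wpM2l//; lra.
have [x0|x0|x0] := ltgtP x 0.
- by rewrite (lt0_mulye (x := x%:E)) ?lte_fin// addNye leNye.
- have y1 : 0 < y by lra.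
  by rewrite [X in (_ <= X)%E]gt0_mulye ?lte_fin ?divr_gt0// leey.
- by rewrite x0 mule0 add0e (_ : y = z)//; lra.
Qed.

Variables (vA vB cAB cA cB s : R) (A B W : T -> 'rV[R]_n).
Hypotheses (s0 : 0 <= s) (sA : vspan X A) (sB : vspan X B) (sW : vspan X W).
Hypotheses (vAE : vcovar P A A vA) (vBE : vcovar P B B vB) (cABE : vcovar P A B cAB).
Hypotheses (cAE : vcovar P A W cA) (cBE : vcovar P B W cB) (sE : vcovar P W W s).
Hypothesis ws : (wgt n alpha s < +oo)%E.

Let kw w := Kfun n alpha (dotp (W w) (W w)).

Let mS (C : T -> 'rV[R]_n) : vspan X C -> measurable_fun setT (fun w => dotp (C w) (C w)).
Proof. by move=> sC; apply: measurable_dotp => i; exact: (vspan_measurable hX i sC). Qed.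

Let mAB : measurable_fun setT (fun w => dotp (A w) (B w)).
Proof.
by apply: measurable_dotp => i; [exact: (vspan_measurable hX i sA)|exact: (vspan_measurable hX i sB)].
Qed.

Let mkw : measurable_fun setT kw.
Proof. by apply: measurableT_comp; [exact: measurable_Kfun|exact: mS]. Qed.

Let kw0 w : (0 <= kw w)%E. Proof. exact: Kfun_ge0. Qed.

Let kwS0 (C : T -> 'rV[R]_n) w : (0 <= kw w * (dotp (C w) (C w))%:E)%E.
Proof. by apply: mule_ge0 => //; rewrite lee_fin; exact: dotp_ge0. Qed.

(** From [|<A,B>| <= |A|^2 + |B|^2]. *)
Lemma K_dotp_abs_le :
  (\int[P]_w `|kw w * (dotp (A w) (B w))%:E| <=
   (Kcst n alpha * n%:R * (vA + vB))%:E * wgt n alpha s)%E.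
Proof.
have vA0 := vcovar_ge0 vAE; have vB0 := vcovar_ge0 vBE.
apply: (@le_trans _ _ (\int[P]_w (kw w * (dotp (A w) (A w))%:E + kw w * (dotp (B w) (B w))%:E))%E).
  apply: ge0_le_integral => //.
  - by apply: measurableT_comp => //; apply: emeasurable_funM => //; exact/measurable_EFinP.
  - by apply: emeasurable_funD; apply: emeasurable_funM => //; apply/measurable_EFinP; exact: mS.
  - move=> w _; rewrite abseM gee0_abs// -ge0_muleDr ?lee_fin ?dotp_ge0//.
    rewrite lee_wpmul2l// -EFinD lee_fin /dotp -big_split/=.
    apply: le_trans (ler_norm_sum _ _ _) _; apply: ler_sum => i _.
    move: (A w ord0 i) (B w ord0 i) => x y.
    have := sqr_ge0 (x - y); have := sqr_ge0 (x + y); have := sqr_ge0 x; have := sqr_ge0 y.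
    by rewrite ler_norml; nra.
rewrite ge0_integralD//; last 2 first.
- by apply: emeasurable_funM => //; apply/measurable_EFinP; exact: mS.
- by apply: emeasurable_funM => //; apply/measurable_EFinP; exact: mS.
rewrite mulrDr EFinD ge0_muleDl ?lee_fin ?mulr_ge0 ?Kcst_ge0//.
by apply: leeD; [exact: (K_sqr_le s0 sA sW vAE cAE sE)|exact: (K_sqr_le s0 sB sW vBE cBE sE)].
Qed.

Lemma integrable_K_dotp :
  P.-integrable setT (fun w => kw w * (dotp (A w) (B w))%:E)%E.
Proof.
apply/integrableP; split; first by apply: emeasurable_funM => //; exact/measurable_EFinP.
apply: le_lt_trans K_dotp_abs_le _; apply: lte_mul_pinfty => //.
by rewrite lee_fin !mulr_ge0 ?Kcst_ge0 ?addr_ge0 ?(vcovar_ge0 vAE) ?(vcovar_ge0 vBE).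
Qed.

Hypothesis cAB0 : 0 <= cA * cB.

(** Polarisation of [K_sqr_expectation].  The difference of the two quadratic formulas contains
    [cAB] with a plus sign and [cA * cB] with a minus sign, whence the hypothesis on the
    sign of [cA * cB]. *)
Lemma K_dotp_le :
  (\int[P]_w (kw w * (dotp (A w) (B w))%:E) <=
   (Kcst n alpha * n%:R * cAB)%:E * wgt n alpha s)%E.
Proof.
pose Ap w := 1 *: A w + 1 *: B w.
pose Am w := 1 *: A w + (-1) *: B w.
have sp : vspan X Ap by exact: vspan_comb.
have sm : vspan X Am by exact: vspan_comb.
have cBA := vcovarC cABE.
have vp : vcovar P Ap Ap (vA + vB + 2 * cAB).
  have -> : vA + vB + 2 * cAB = 1 * (1 * vA + 1 * cAB) + 1 * (1 * cAB + 1 * vB) by ring.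
  apply: vcovar_combl => //; apply: vcovarC; exact: vcovar_combl.
have vm : vcovar P Am Am (vA + vB - 2 * cAB).
  have -> : vA + vB - 2 * cAB = 1 * (1 * vA + (-1) * cAB) + (-1) * (1 * cAB + (-1) * vB) by ring.
  apply: vcovar_combl => //; apply: vcovarC; exact: vcovar_combl.
have cp : vcovar P Ap W (1 * cA + 1 * cB) by exact: vcovar_combl.
have cm : vcovar P Am W (1 * cA + (-1) * cB) by exact: vcovar_combl.
have Ip := K_sqr_expectation hX alpha s0 sp sW vp cp sE.
have Im := K_sqr_expectation hX alpha s0 sm sW vm cm sE.
have Ipoo := K_sqr_le s0 sp sW vp cp sE.
have Imoo := K_sqr_le s0 sm sW vm cm sE.
set ip := (\int[P]_w (Kfun n alpha (dotp (W w) (W w)) * (dotp (Ap w) (Ap w))%:E))%E in Ip Ipoo.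
set im := (\int[P]_w (Kfun n alpha (dotp (W w) (W w)) * (dotp (Am w) (Am w))%:E))%E in Im Imoo.
have g0 : (0 <= wgt n alpha s)%E by exact: wgt_ge0.
have im0 : (0 <= im)%E.
  by apply: integral_ge0 => w _; exact: kwS0.
have ip0 : (0 <= ip)%E.
  by apply: integral_ge0 => w _; exact: kwS0.
have wfin : wgt n alpha s \is a fin_num by rewrite ge0_fin_numE.
have imf : im \is a fin_num.
  rewrite (ge0_fin_numE im0); apply: le_lt_trans Imoo _; apply: lte_mul_pinfty => //.
  by rewrite lee_fin !mulr_ge0 ?Kcst_ge0 ?(vcovar_ge0 vm).
have ipf : ip \is a fin_num.
  rewrite (ge0_fin_numE ip0); apply: le_lt_trans Ipoo _; apply: lte_mul_pinfty => //.
  by rewrite lee_fin !mulr_ge0 ?Kcst_ge0 ?(vcovar_ge0 vp).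
(* The formulas for [A + B] and [A - B] differ by [4 cAB] and by [-4 lam cA cB] inside the integral. *)
have ipm : (ip <= im + (4 * (Kcst n alpha * n%:R * cAB))%:E * wgt n alpha s)%E.
  rewrite Ip Im.
  have ik := integrable_ker s0 sp sW vp cp sE ws.
  have ik' := integrable_ker s0 sm sW vm cm sE ws.
  have ig : lebesgue_measure.-integrable D
      (fun u => ((4 * (n%:R * cAB))%:E * (gker n alpha s u)%:E)%E).
    by apply: integrableZl => //; exact: integrable_gker.
  have -> : ((4 * (Kcst n alpha * n%:R * cAB))%:E * wgt n alpha s =
    (Kcst n alpha)%:E * \int[lebesgue_measure]_(u in D) ((4 * (n%:R * cAB))%:E * (gker n alpha s u)%:E))%E.
    rewrite integralZl//; last exact: integrable_gker.
    by rewrite muleA -EFinM; congr (_%:E * _)%E; ring.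
  rewrite -muleDr//; last first.
    by apply: fin_num_adde_defl; exact: (integrable_fin_num mD ig).
  rewrite lee_wpmul2l ?lee_fin ?Kcst_ge0//.
  rewrite -integralD//; apply: le_integral => //; first exact: integrableD.
  move=> u; rewrite inE => /Dgt0 u0; rewrite -EFinM -EFinD lee_fin.
  have gu := gker_ge0 n alpha s u0; have lu := lam_ge0 s0 u0.
  rewrite -subr_ge0.
  rewrite (_ : _ - _ = 4 * n%:R * (gker n alpha s u * (lam s u * (cA * cB)))); last ring.
  by apply: mulr_ge0; [exact: mulr_ge0|apply: mulr_ge0 => //; exact: mulr_ge0].
have iAB := integrable_K_dotp.
have iAm : P.-integrable setT (fun w => kw w * (dotp (Am w) (Am w) / 4)%:E)%E.
  rewrite (_ : (fun w => _) = (fun w => kw w * (dotp (Am w) (Am w))%:E * (4^-1)%:E)%E); last first.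
    by apply/funext => w; rewrite EFinM muleA.
  apply: integrableZr => //; apply/integrableP; split.
    by apply: emeasurable_funM => //; apply/measurable_EFinP; exact: mS.
  under eq_integral do rewrite gee0_abs//.
  by move: imf; rewrite (ge0_fin_numE im0); exact.
have iAp : P.-integrable setT (fun w => kw w * (dotp (Ap w) (Ap w) / 4)%:E)%E.
  rewrite (_ : (fun w => _) = (fun w => kw w * (dotp (Ap w) (Ap w))%:E * (4^-1)%:E)%E); last first.
    by apply/funext => w; rewrite EFinM muleA.
  apply: integrableZr => //; apply/integrableP; split.
    by apply: emeasurable_funM => //; apply/measurable_EFinP; exact: mS.
  under eq_integral do rewrite gee0_abs//.
  by move: ipf; rewrite (ge0_fin_numE ip0); exact.
have q4 (C : T -> 'rV[R]_n) : vspan X C -> (\int[P]_w (kw w * (dotp (C w) (C w) / 4)%:E) =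
    \int[P]_w (kw w * (dotp (C w) (C w))%:E) * (4^-1)%:E)%E.
  move=> sC; rewrite -ge0_integralZr//; last first.
  - by apply: emeasurable_funM => //; apply/measurable_EFinP; exact: mS.
  by apply: eq_integral => w _; rewrite EFinM muleA.
have key : (\int[P]_w (kw w * (dotp (A w) (B w))%:E) +
    \int[P]_w (kw w * (dotp (Am w) (Am w) / 4)%:E) <=
    \int[P]_w (kw w * (dotp (Ap w) (Ap w) / 4)%:E))%E.
  rewrite -integralD//.
  apply: le_integral => //; first exact: integrableD.
  move=> w _; apply: mule_polarization; [exact: kw0| |exact: dotp_ge0|exact: dotp_ge0].
  rewrite /dotp mulr_sumr -sumrB; apply: eq_bigr => i _.
  by rewrite !mxE; ring.
rewrite (q4 _ sp) (q4 _ sm) in key.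
exact: (lee_quarter (integrable_fin_num measurableT iAB) imf ipf wfin ipm key).
Qed.

End K_polarization.

Lemma is_derive_continuous (R : realType) (F : R -> R) (x a : R) :
  is_derive x 1 F a -> {for x, continuous F}.
Proof. by move=> [dF _]; apply: differentiable_continuous; exact/derivable1_diffP. Qed.

Lemma integral_primitive (R : realType) (f F : R -> R) (a b : R) : a < b ->
  (forall x, a <= x <= b -> is_derive x 1 F (f x)) ->
  (forall x, a <= x <= b -> {for x, continuous f}) ->
  (\int[lebesgue_measure]_(x in `[a, b]) (f x)%:E = (F b - F a)%:E)%E.
Proof.
move=> ab dF cf; rewrite (@continuous_FTC2 _ f F a b ab) ?EFinB//.
- by apply: continuous_in_subspaceT => x /set_mem; rewrite /= in_itv/=; exact: cf.
- split.
  + move=> x /=; rewrite in_itv/= => /andP[ax xb]; have hx : a <= x <= b by rewrite !ltW.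
    by have [] := dF x hx.
  + apply: cvg_at_right_filter; apply: (is_derive_continuous (a := f a)).
    by apply: dF; rewrite lexx ltW.
  + apply: cvg_at_left_filter; apply: (is_derive_continuous (a := f b)).
    by apply: dF; rewrite lexx ltW.
- move=> x; rewrite in_itv/= => /andP[ax xb].
  have hx : a <= x <= b by rewrite !ltW.
  by rewrite derive1E; have [_ ->] := dF x hx.
Qed.

(** Upper bound for the integral of a nonnegative derivative over an increasing union of segments, by a
    bound on the increments of the primitive; no limit at the endpoints is computed. *)
Lemma integral_exhaust_le (R : realType) (f F : R -> R) (lo hi : nat -> R) (M : R) :
  (forall n, lo n < hi n) ->
  (forall n, lo n.+1 <= lo n) -> (forall n, hi n <= hi n.+1) ->
  measurable_fun setT f ->
  (forall n x, lo n <= x <= hi n -> 0 <= f x) ->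
  (forall n x, lo n <= x <= hi n -> is_derive x 1 F (f x)) ->
  (forall n x, lo n <= x <= hi n -> {for x, continuous f}) ->
  (forall n, F (hi n) - F (lo n) <= M) ->
  (\int[lebesgue_measure]_(x in \bigcup_n `[lo n, hi n]%classic) (f x)%:E <= M%:E)%E.
Proof.
move=> lohi lod hii mf f0 dF cf FM.
have cvgI := @ge0_nondecreasing_set_cvg_integral _ (measurableTypeR R) R (fun n => `[lo n, hi n]%classic)
  (EFin \o f) (@lebesgue_measure R).
have {}cvgI : (\int[lebesgue_measure]_(x in `[lo n, hi n]) (f x)%:E @[n --> \oo] -->
  \int[lebesgue_measure]_(x in \bigcup_n `[lo n, hi n]%classic) (f x)%:E)%E.
  apply: cvgI.
  - apply/nondecreasing_seqP => n; rewrite subsetEset => x /=.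
    by rewrite !in_itv/= => /andP[h1 h2]; rewrite (le_trans (lod n) h1) (le_trans h2 (hii n)).
  - by move=> n; exact: measurable_itv.
  - by move=> n; apply/measurable_EFinP; exact: measurable_funTS.
  - by move=> n x /=; rewrite in_itv/= => h; rewrite lee_fin (f0 n).
rewrite -(cvg_lim _ cvgI)//; apply: lime_le.
  by apply/cvg_ex; eexists; exact: cvgI.
apply: nearW => n; by rewrite (@integral_primitive _ f F _ _ (lohi n) (dF n) (cf n)) lee_fin.
Qed.

(** * Integrals of powers *)

Section beta_density.
Context (R : realType).
Implicit Types a x u c T : R.


(** The density of the increasing bounded function [(x / (1 + x)) `^ a].  It behaves as a multiple of
    [x `^ (a - 1)] at [0] and its total mass on the half-line is at most [1], so that both
    Gamma integrals and integrals of powers near [0] are dominated by it. *)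
Definition phi a x := a * (x / (1 + x)) `^ (a - 1) * ((1 + x) ^+ 2)^-1.

Lemma phi_ge0 a x : 0 < a -> 0 < x -> 0 <= phi a x.
Proof. by move=> a0 x0; rewrite !mulr_ge0 ?powR_ge0 ?ltW// invr_gt0 exprn_gt0// addr_gt0. Qed.

Lemma is_derive_phi a x : 0 < a -> 0 < x ->
  is_derive x 1 (fun x => (x / (1 + x)) `^ a) (phi a x).
Proof.
move=> a0 x0; have x1 : 0 < 1 + x by rewrite addr_gt0.
have h : is_derive x 1 (fun x => x / (1 + x)) (((1 + x) ^+ 2)^-1).
  have hV : is_derive x 1 (fun x => (1 + x)^-1) (- ((1 + x) ^- 2) *: 1).
    by apply: is_deriveV; rewrite ?gt_eqF//; apply: is_derive_eq; rewrite add0r.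
  apply: is_derive_eq; rewrite /GRing.scale/=; field.
  by rewrite gt_eqF.
by apply: is_derive_powR_comp => //; rewrite divr_gt0.
Qed.

Lemma continuous_phi a x : 0 < a -> 0 < x -> {for x, continuous (phi a)}.
Proof.
move=> a0 x0; have x1 : 0 < 1 + x by rewrite addr_gt0.
have h : is_derive x 1 (fun x => x / (1 + x)) (((1 + x) ^+ 2)^-1).
  have hV : is_derive x 1 (fun x => (1 + x)^-1) (- ((1 + x) ^- 2) *: 1).
    by apply: is_deriveV; rewrite ?gt_eqF//; apply: is_derive_eq; rewrite add0r.
  apply: is_derive_eq; rewrite /GRing.scale/=; field.
  by rewrite gt_eqF.
have h1 := is_derive_powR_comp (f := fun x => x / (1 + x)) (a - 1) (divr_gt0 x0 x1) h.
have h2 : is_derive x 1 (fun x => ((1 + x) ^+ 2)^-1) (- ((1 + x) ^+ 2) ^- 2 *: (2 * (1 + x))).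
  apply: is_deriveV; first by rewrite gt_eqF ?exprn_gt0.
  by apply: is_derive_eq; rewrite /GRing.scale/=; ring.
exact: is_derive_continuous.
Qed.

Lemma measurable_phi a : measurable_fun setT (phi a).
Proof.
apply: measurable_funM.
  apply: measurable_funM => //.
  apply: (measurableT_comp (f := fun y : R => y `^ (a - 1))); first exact: measurable_powR.
  by apply: measurable_funM => //; apply: measurable_funV; exact: measurable_funD.
by apply: measurable_funV; apply: measurable_funX; exact: measurable_funD.
Qed.

Lemma Phi_bounds a x : 0 < x -> 0 < a -> 0 <= (x / (1 + x)) `^ a <= 1.
Proof.
move=> x0 a0; have x1 : 0 < 1 + x by rewrite addr_gt0.
rewrite powR_ge0/= (@le_trans _ _ (1 `^ a))//; last by rewrite powR1.
apply: ge0_ler_powR; rewrite ?nnegrE ?ler01 ?(ltW a0) ?(ltW (divr_gt0 x0 x1))//.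
by rewrite ler_pdivrMr// mul1r lerDr.
Qed.

Lemma integral_phi_right a c : 0 < a ->
  (\int[lebesgue_measure]_(x in `]c, +oo[) (phi a (x - c))%:E <= 1)%E.
Proof.
move=> a0.
have -> : `]c, +oo[%classic = \bigcup_n `[c + n.+1%:R^-1, c + n.+2%:R]%classic.
  apply/seteqP; split => [x /=|x [n _] /=]; rewrite !in_itv/= ?andbT.
    move=> cx; have xc : 0 < x - c by rewrite subr_gt0.
    have [m hm] : exists m, x - c <= m%:R.
      by exists (Num.truncn (x - c)).+1; rewrite ltW// truncnS_gt.
    have [k hk] : exists k, (x - c)^-1 <= k%:R.
      by exists (Num.truncn (x - c)^-1).+1; rewrite ltW// truncnS_gt.
    exists (maxn m k) => //=; rewrite in_itv/=; apply/andP; split.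
      rewrite -lerBrDl -[leRHS]invrK lef_pV2 ?posrE ?invr_gt0// (le_trans hk)// ler_nat.
      by rewrite (leq_trans (leq_maxr m k)).
    by rewrite -lerBlDl (le_trans hm)// ler_nat (leq_trans (leq_maxl m k))// leqW.
  by move=> /andP[h _]; rewrite (lt_le_trans _ h)// ltrDl invr_gt0.
have pos n x : c + n.+1%:R^-1 <= x <= c + n.+2%:R -> 0 < x - c.
  by move=> /andP[h _]; rewrite subr_gt0 (lt_le_trans _ h)// ltrDl invr_gt0.
apply: (integral_exhaust_le (F := fun x => ((x - c) / (1 + (x - c))) `^ a)).
- move=> n; rewrite ltrD2l (@le_lt_trans _ _ 1)// ?ltr1n//.
  by rewrite invf_le1 ?ler1n.
- by move=> n; rewrite lerD2l lef_pV2 ?posrE// ler_nat.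
- by move=> n; rewrite lerD2l ler_nat.
- by apply: (measurableT_comp (f := phi a)); [exact: measurable_phi|exact: measurable_funB].
- by move=> n x /pos; exact: phi_ge0.
- move=> n x /pos h.
  have h1 : is_derive x 1 (fun x => x - c) 1 by apply: is_derive_eq; rewrite subr0.
  have := is_derive1_comp (f := fun x => (x / (1 + x)) `^ a) (g := fun x => x - c) (is_derive_phi a0 h) h1.
  by rewrite mulr1.
- move=> n x /pos h; apply: (continuous_comp (f := fun x => x - c)).
    by apply: (@cvgB _ R^o) => //; exact: cvg_cst.
  exact: continuous_phi.
- move=> n; have l1 : 0 < c + n.+2%:R - c by rewrite addrAC subrr add0r.
  have l2 : 0 < c + n.+1%:R^-1 - c by rewrite addrAC subrr add0r invr_gt0.
  have /andP[_ h1] := Phi_bounds l1 a0; have /andP[h2 _] := Phi_bounds l2 a0.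
  by rewrite lerBlDr (le_trans h1)// lerDl.
Qed.

Lemma integral_phi_left a c : 0 < a ->
  (\int[lebesgue_measure]_(x in `]-oo, c[) (phi a (c - x))%:E <= 1)%E.
Proof.
move=> a0.
have -> : `]-oo, c[%classic = \bigcup_n `[c - n.+2%:R, c - n.+1%:R^-1]%classic.
  apply/seteqP; split => [x /=|x [n _] /=]; rewrite !in_itv/=.
    move=> cx; have xc : 0 < c - x by rewrite subr_gt0.
    have [m hm] : exists m, c - x <= m%:R.
      by exists (Num.truncn (c - x)).+1; rewrite ltW// truncnS_gt.
    have [k hk] : exists k, (c - x)^-1 <= k%:R.
      by exists (Num.truncn (c - x)^-1).+1; rewrite ltW// truncnS_gt.
    exists (maxn m k) => //=; rewrite in_itv/=; apply/andP; split.
      by rewrite lerBlDr -lerBlDl (le_trans hm)// ler_nat (leq_trans (leq_maxl m k))// leqW.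
    rewrite lerBrDr -lerBrDl -[leRHS]invrK lef_pV2 ?posrE ?invr_gt0// (le_trans hk)// ler_nat.
    by rewrite (leq_trans (leq_maxr m k)).
  by move=> /andP[_ h]; rewrite (le_lt_trans h)// gtrBl invr_gt0.
have pos n x : c - n.+2%:R <= x <= c - n.+1%:R^-1 -> 0 < c - x.
  by move=> /andP[_ h]; rewrite subr_gt0 (le_lt_trans h)// gtrBl invr_gt0.
apply: (integral_exhaust_le (F := fun x => - ((c - x) / (1 + (c - x))) `^ a)).
- move=> n; rewrite ltrD2l ltrN2 (@le_lt_trans _ _ 1)// ?ltr1n//.
  by rewrite invf_le1 ?ler1n.
- by move=> n; rewrite lerD2l lerN2 ler_nat.
- by move=> n; rewrite lerD2l lerN2 lef_pV2 ?posrE// ler_nat.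
- by apply: (measurableT_comp (f := phi a)); [exact: measurable_phi|exact: measurable_funB].
- by move=> n x /pos; exact: phi_ge0.
- move=> n x /pos h.
  have h1 : is_derive x 1 (fun x => c - x) (-1).
    by apply: is_derive_eq; rewrite /GRing.scale/=; ring.
  have := is_derive1_comp (f := fun x => (x / (1 + x)) `^ a) (g := fun x => c - x) (is_derive_phi a0 h) h1.
  rewrite mulrN1 => {}h; rewrite -[phi _ _]opprK; exact: is_deriveN.
- move=> n x /pos h; apply: (continuous_comp (f := fun x => c - x)).
    by apply: (@cvgB _ R^o) => //; exact: cvg_cst.
  exact: continuous_phi.
- move=> n; have l1 : 0 < c - (c - n.+2%:R) by rewrite opprB addrC subrK.
  have l2 : 0 < c - (c - n.+1%:R^-1) by rewrite opprB addrC subrK invr_gt0.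
  have /andP[_ h1] := Phi_bounds l1 a0; have /andP[h2 _] := Phi_bounds l2 a0.
  by rewrite opprK addrC lerBlDr (le_trans h1)// lerDl.
Qed.

End beta_density.

Section power_integrals.
Context (R : realType).
Implicit Types a x u c T : R.

Lemma powR_phi a x : 0 < a -> 0 < x ->
  x `^ (a - 1) = phi a x / a * (1 + x) `^ (a + 1).
Proof.
move=> a0 x0; have x1 : 0 < 1 + x by rewrite addr_gt0.
rewrite -{1}(@divfK _ (1 + x) _ x) ?gt_eqF// powRM ?divr_ge0 ?ltW//.
have -> : (1 + x) `^ (a + 1) = (1 + x) `^ (a - 1) * (1 + x) ^+ 2.
  rewrite -(powR_mulrn _ (ltW x1)) -powRD ?(gt_eqF x1) ?implybT//.
  by congr (_ `^ _); ring.
by rewrite /phi; field; rewrite !gt_eqF.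
Qed.

Lemma powR_le_expR b x : 0 < b -> 0 <= x -> x `^ b <= b `^ b * expR x.
Proof.
move=> b0 x0; have -> : expR x = expR (x / b) `^ b.
  by rewrite -expRM mulfVK// gt_eqF.
rewrite -powRM ?expR_ge0 ?(ltW b0)//; apply: ge0_ler_powR; rewrite ?nnegrE ?(ltW b0)//.
  by rewrite mulr_ge0 ?expR_ge0 ?(ltW b0).
rewrite -ler_pdivrMl// mulrC (le_trans _ (expR_ge1Dx _))// lerDr//.
Qed.

(** [powR_phi] trades the power for [phi], and the exponential absorbs the factor [(1 + u) `^ (a + 1)]. *)
Lemma Gamma_lty a : 0 < a ->
  (\int[lebesgue_measure]_(u in `]0%R, +oo[) (u `^ (a - 1) * expR (- u))%:E < +oo)%E.
Proof.
move=> a0; pose C : R := (a + 1) `^ (a + 1) * expR 1 / a.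
have C0 : 0 <= C by rewrite !mulr_ge0 ?powR_ge0 ?expR_ge0 ?invr_ge0 ?(ltW a0).
apply: (@le_lt_trans _ _ (\int[lebesgue_measure]_(u in `]0%R, +oo[) (C%:E * (phi a (u - 0))%:E)%E)%E).
  apply: ge0_le_integral => //.
  - by move=> u _; rewrite lee_fin mulr_ge0 ?powR_ge0 ?expR_ge0.
  - apply/measurable_EFinP/measurable_funTS; apply: measurable_funM; first exact: measurable_powR.
    by apply: measurableT_comp => //; exact: measurableT_comp.
  - apply/measurable_EFinP/measurable_funTS; apply: measurable_funM => //.
    by apply: (measurableT_comp (f := phi a)); [exact: measurable_phi|exact: measurable_funB].
  - move=> u; rewrite /= in_itv/= andbT => u0; rewrite subr0 lee_fin (powR_phi a0 u0).
    have u1 : 0 <= 1 + u by rewrite addr_ge0// ltW.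
    have := powR_le_expR (addr_gt0 a0 ltr01) u1; rewrite expRD => h.
    have ph := phi_ge0 a0 u0.
    rewrite -mulrA; apply: (@le_trans _ _ (phi a u / a * ((a + 1) `^ (a + 1) * (expR 1 * expR u) * expR (- u)))).
      apply: ler_wpM2l; first by rewrite divr_ge0 ?(ltW a0).
      by apply: ler_wpM2r; [exact: expR_ge0|exact: h].
    rewrite expRN /C; set E := expR u; have E0 : E != 0 by rewrite gt_eqF ?expR_gt0.
    by rewrite le_eqVlt; apply/orP; left; apply/eqP; field; rewrite E0 gt_eqF.
rewrite ge0_integralZl//; last first.
- by move=> u; rewrite /= in_itv/= andbT => u0; rewrite lee_fin phi_ge0 ?subr0.
- apply/measurable_EFinP/measurable_funTS.
  by apply: (measurableT_comp (f := phi a)); [exact: measurable_phi|exact: measurable_funB].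
apply: lte_mul_pinfty => //; apply: le_lt_trans (integral_phi_right _ a0) _.
exact: ltry.
Qed.

Lemma integral_dist_powR a T t : 0 < a -> 0 <= t <= T ->
  (\int[lebesgue_measure]_(s in `[0%R, T]) (`|t - s| `^ (a - 1))%:E <=
   (2 * ((1 + T) `^ (a + 1) / a))%:E)%E.
Proof.
move=> a0 /andP[t0 tT]; set C := _ / a.
have T0 : 0 <= T by exact: le_trans t0 tT.
have C0 : 0 <= C by rewrite divr_ge0 ?powR_ge0 ?(ltW a0).
have mf : measurable_fun setT (fun s : R => (`|t - s| `^ (a - 1))%:E).
  apply/measurable_EFinP; apply: (measurableT_comp (f := fun y : R => y `^ (a - 1))).
    exact: measurable_powR.
  by apply: measurableT_comp => //; exact: measurable_funB.
have ml : measurable_fun setT (fun s : R => (phi a (t - s))%:E).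
  apply/measurable_EFinP.
  by apply: (measurableT_comp (f := phi a)); [exact: measurable_phi|exact: measurable_funB].
have mr : measurable_fun setT (fun s : R => (phi a (s - t))%:E).
  apply/measurable_EFinP.
  by apply: (measurableT_comp (f := phi a)); [exact: measurable_phi|exact: measurable_funB].
have key x : 0 < x -> x <= T -> x `^ (a - 1) <= C * phi a x.
  move=> x0 xT; rewrite (powR_phi a0 x0) /C [leRHS]mulrAC [leLHS]mulrAC ler_wpM2r ?invr_ge0 ?(ltW a0)//.
  rewrite mulrC ler_wpM2r ?phi_ge0//; apply: ge0_ler_powR; rewrite ?nnegrE ?addr_ge0 ?(ltW a0) ?(ltW x0)//.
  by rewrite lerD2l.
have gl : (\int[lebesgue_measure]_(s in `]-oo, t[) (C%:E * (phi a (t - s))%:E) <= C%:E)%E.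
  rewrite ge0_integralZl//.
  + by rewrite -[leRHS]mule1 lee_wpmul2l// integral_phi_left.
  + exact: measurable_funTS.
  + by move=> s; rewrite /= in_itv/= => st; rewrite lee_fin phi_ge0 ?subr_gt0.
have gr : (\int[lebesgue_measure]_(s in `]t, +oo[) (C%:E * (phi a (s - t))%:E) <= C%:E)%E.
  rewrite ge0_integralZl//.
  + by rewrite -[leRHS]mule1 lee_wpmul2l// integral_phi_right.
  + exact: measurable_funTS.
  + by move=> s; rewrite /= in_itv/= andbT => st; rewrite lee_fin phi_ge0 ?subr_gt0.
have f0 s : (0 <= (`|t - s| `^ (a - 1))%:E)%E by rewrite lee_fin powR_ge0.
have splitT : `[0, T]%classic = (`[0, t[ `|` `]t, T]) `|` [set t] :> set R.
  apply/seteqP; split => s /=; rewrite !in_itv/=.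
    move=> /andP[h1 h2]; case: (ltgtP s t) => [st|st|->]; [left; left|left; right|right] => //.
    by rewrite h1.
  by case => [[/andP[h1 h2]|/andP[h1 h2]]|->]; rewrite ?t0 ?tT ?h1 ?h2//= ?(le_trans (ltW h2) tT)// (le_trans t0 (ltW h1)).
rewrite splitT ge0_integral_setU//=; last 3 first.
- exact: measurableU.
- exact: measurable_funTS.
- apply/disj_setPLR => s /= [] ; rewrite in_itv/= => /andP[h1 h2] st; move: h1 h2; rewrite st ltxx ?andbF//.
rewrite integral_set1 adde0 ge0_integral_setU//=; last 2 first.
- exact: measurable_funTS.
- by apply/disj_setPLR => s /=; rewrite !in_itv/= => /andP[_ h1] /andP[h2 _]; move: (lt_trans h1 h2); rewrite ltxx.
rewrite mulr2n mulrDl mul1r EFinD; apply: leeD.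
- apply: le_trans gl.
  apply: (@le_trans _ _ (\int[lebesgue_measure]_(s in `[0%R, t[) (C%:E * (phi a (t - s))%:E))%E).
    apply: ge0_le_integral => //.
    + exact: measurable_funTS.
    + by apply: measurable_funTS; exact: measurable_funeM.
    + move=> s /=; rewrite in_itv/= => /andP[s0 st]; have h : 0 < t - s by rewrite subr_gt0.
      rewrite gtr0_norm// -EFinM lee_fin key// (le_trans _ tT)// gerBl//.
  apply: ge0_subset_integral => //.
  + by apply: measurable_funTS; exact: measurable_funeM.
  + by move=> s; rewrite /= in_itv/= => st; rewrite -EFinM lee_fin mulr_ge0 ?phi_ge0 ?subr_gt0.
  + by move=> s /=; rewrite !in_itv/= => /andP[].
- apply: le_trans gr.
  apply: (@le_trans _ _ (\int[lebesgue_measure]_(s in `]t, T]) (C%:E * (phi a (s - t))%:E))%E).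
    apply: ge0_le_integral => //.
    + exact: measurable_funTS.
    + by apply: measurable_funTS; exact: measurable_funeM.
    + move=> s /=; rewrite in_itv/= => /andP[ts sT]; have h : 0 < s - t by rewrite subr_gt0.
      rewrite distrC gtr0_norm// -EFinM lee_fin key// (le_trans _ sT)// gerBl//.
  apply: ge0_subset_integral => //.
  + by apply: measurable_funTS; exact: measurable_funeM.
  + by move=> s; rewrite /= in_itv/= andbT => st; rewrite -EFinM lee_fin mulr_ge0 ?phi_ge0 ?subr_gt0.
  + by move=> s /=; rewrite !in_itv/= andbT => /andP[].
Qed.

End power_integrals.

(** * Behaviour of the weight near zero *)

Section weight.
Context (R : realType) (n : nat).
Implicit Types s u x r a b : R.
Local Notation p := (n%:R / 2 : R).

Let D : set R := `]0%R, +oo[%classic.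
Let mD : measurable (D : set (measurableTypeR R)). Proof. exact: measurable_itv. Qed.
Let Dgt0 (u : R) : D u -> 0 < u. Proof. by rewrite /D/= in_itv/= andbT. Qed.

Lemma kernE alpha u : 0 < u -> kern n alpha u = u `^ (alpha - p - 1) * expR (- u).
Proof.
move=> u0; rewrite /kern (@powRB _ u (alpha - p) 1) ?(gt_eqF u0) ?implybT// powRr1 ?(ltW u0)//.
by ring.
Qed.

Lemma gkerE alpha s u : 0 < u -> 0 <= s ->
  gker n alpha s u = kern n alpha u * (1 + s / (2 * u)) `^ (- p).
Proof.
move=> u0 s0; rewrite /gker; congr (_ * _).
have -> : 1 + 2 * (4 * u)^-1 * s = 1 + s / (2 * u) by field; rewrite gt_eqF.
rewrite -powR_mulrn ?powR_ge0// -powRrM; congr (_ `^ _); ring.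
Qed.

Lemma integrable_Gamma a : 0 < a ->
  lebesgue_measure.-integrable D (EFin \o (fun u : R => u `^ (a - 1) * expR (- u))).
Proof.
move=> a0; apply/integrableP; split.
  apply/measurable_EFinP/measurable_funTS; apply: measurable_funM; first exact: measurable_powR.
  by apply: measurableT_comp => //; exact: measurableT_comp.
under eq_integral do rewrite /= ger0_norm ?mulr_ge0 ?powR_ge0 ?expR_ge0//.
exact: Gamma_lty.
Qed.

(** Interpolation between the linear bound (Bernoulli) for [x <= 1] and the trivial bound [1] for
    [x > 1]. *)
Lemma one_sub_powR_le x q k : 0 <= x -> 0 <= q -> 0 <= k <= 1 ->
  `|(1 + x) `^ (- q) - 1| <= (q + 1) * x `^ k.
Proof.
move=> x0 q0 /andP[k0 k1]; have x1 : 0 < 1 + x by rewrite ltr_pwDl.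
have y0 : 0 <= (1 + x) `^ (- q) by exact: powR_ge0.
have y1 : (1 + x) `^ (- q) <= 1.
  apply: (@le_trans _ _ ((1 + x) `^ 0)); last by rewrite powRr0.
  by apply: ler_powR; rewrite ?oppr_le0// lerDl.
have yx : 1 - q * x <= (1 + x) `^ (- q).
  rewrite /powR gt_eqF//; apply: le_trans (expR_ge1Dx _).
  rewrite lerD2l mulNr lerN2 ler_wpM2l//.
  have := @le_ln1Dx R x; apply; rewrite (lt_le_trans _ x0)//.
rewrite ler0_norm ?subr_le0// opprB.
have [x1'|x1'] := leP x 1.
  apply: (@le_trans _ _ (q * x)); first by rewrite lerBlDr -lerBlDl.
  apply: (@le_trans _ _ (q * x `^ k)); last by rewrite ler_wpM2r ?powR_ge0// lerDl.
  rewrite ler_wpM2l//; have [->|xn0] := eqVneq x 0; first exact: powR_ge0.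
  by apply: ger1_powR => //; rewrite lt_neqAle eq_sym xn0 x0.
have : 1 <= x `^ k by rewrite -(powRr0 x); apply: ler_powR => //; exact: ltW.
move=> h; apply: (@le_trans _ _ 1); first by rewrite gerBl.
by rewrite (le_trans h)// ler_peMl ?powR_ge0// lerDr.
Qed.

(** From a pointwise estimate of [gker] to an estimate of its integral.  The comparison function is either
    [kern] itself ([j = 1]), integrable when [n/2 < alpha], or zero ([j = 0]);
    [w0] is its integral. *)
Lemma wgt_near (alpha H j A a b : R) : 0 <= j -> 0 <= A -> 0 < a ->
  (j = 0 \/ p < alpha) ->
  (forall s u, 0 < s -> 0 < u ->
    `|gker n alpha s u - j * kern n alpha u| <= A * s `^ b * (u `^ (a - 1) * expR (- u))) ->
  exists w0 C : R, [/\ 0 <= w0, 0 <= C & forall r, 0 < r ->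
    exists w, wgt n alpha (r `^ (2 * H)) = w%:E /\ `|w - w0| <= C * r `^ (2 * H * b)].
Proof.
move=> j0 A0 a0 jp gA.
have ik : lebesgue_measure.-integrable D (EFin \o (fun u => j * kern n alpha u)).
  case: jp => [->|pa].
    rewrite (_ : _ \o _ = cst 0%E); first exact: integrable0.
    by apply/funext => u /=; rewrite mul0r.
  have ig := integrable_Gamma (_ : 0 < alpha - p).
  apply: (@eq_integrable _ _ _ _ _ mD (fun u => (j%:E * (u `^ (alpha - p - 1) * expR (- u))%:E)%E)).
    by move=> u; rewrite inE => /Dgt0 u0; rewrite /= kernE.
  by apply: integrableZl => //; apply: ig; rewrite subr_gt0.
have iG := integrable_Gamma a0.
pose G := \int[lebesgue_measure]_(u in D) (u `^ (a - 1) * expR (- u)).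
have G0 : 0 <= G by apply: Rintegral_ge0 => u _; rewrite mulr_ge0 ?powR_ge0 ?expR_ge0.
pose w0 := \int[lebesgue_measure]_(u in D) (j * kern n alpha u).
exists w0, (A * G); split.
- by apply: Rintegral_ge0 => u /Dgt0 u0; rewrite mulr_ge0 ?kern_ge0.
- exact: mulr_ge0.
move=> r r0; set s := r `^ (2 * H); have s0 : 0 < s by exact: powR_gt0.
have mg : measurable_fun D (gker n alpha s) by apply: measurable_funTS; exact: measurable_gker.
have mk : measurable_fun D (fun u => j * kern n alpha u).
  by apply: measurable_funTS; apply: measurable_funM => //; exact: measurable_kern.
have ib : lebesgue_measure.-integrable D (fun u => ((A * s `^ b)%:E * (u `^ (a - 1) * expR (- u))%:E)%E).
  by apply: integrableZl.
have id : lebesgue_measure.-integrable D (EFin \o (fun u => gker n alpha s u - j * kern n alpha u)).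
  apply: (le_integrable _ _ _ ib) => //.
    by apply/measurable_EFinP; exact: measurable_funB.
  by move=> u /Dgt0 u0; rewrite /= lee_fin (le_trans (gA _ _ s0 u0))// ler_norm.
have ig : lebesgue_measure.-integrable D (EFin \o gker n alpha s).
  rewrite (_ : _ \o _ = (fun u => (gker n alpha s u - j * kern n alpha u)%:E + (j * kern n alpha u)%:E)%E).
    exact: integrableD.
  by apply/funext => u; rewrite /= -EFinD subrK.
exists (\int[lebesgue_measure]_(u in D) gker n alpha s u); split.
  by rewrite /wgt /Rintegral fineK//; exact: integrable_fin_num.
rewrite -RintegralB//; apply: le_trans (le_normr_Rintegral _ _) _ => //.
have -> : A * G * r `^ (2 * H * b) = \int[lebesgue_measure]_(u in D) (A * s `^ b * (u `^ (a - 1) * expR (- u))).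
  by rewrite RintegralZl// /s -powRrM -/G; ring.
apply: le_Rintegral => //; first exact: integrable_norm.
by move=> u /Dgt0 u0; exact: gA.
Qed.

(** The expansion of the weight at [0] along [s = r^(2H)].  The two cases correspond to a weight that
    has a limit at [0], and to a weight that may blow up, for which [w0 = 0] and [beta] is
    negative. *)
Lemma wgt_asymp (H alpha : R) : (0 < n)%N -> 1 / 4 < H < 1 -> p - 1 + 1 / (2 * H) < alpha ->
  exists w0 C beta : R, [/\ 0 <= w0, 0 <= C, 1 - 2 * H < beta & forall r, 0 < r ->
    exists w, wgt n alpha (r `^ (2 * H)) = w%:E /\ `|w - w0| <= C * r `^ beta].
Proof.
move=> n0 /andP[H4 H1] aH.
have H0 : 0 < H by rewrite (lt_trans _ H4)// divr_gt0.
have H20 : 0 < 2 * H by rewrite mulr_gt0.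
have p12 : 1 / 2 <= p by rewrite ler_wpM2r// ler1n.
have beta_gt b : 1 / (2 * H) - 1 < b -> 1 - 2 * H < 2 * H * b.
  move=> hb; rewrite -(ltr_pM2l H20) in hb.
  by apply: le_lt_trans hb; rewrite mulrBr mulr1 mulrCA divff ?gt_eqF// mulr1.
have [H2|H2] := leP H (1 / 2).
- (* [n/2 < alpha]: the weight is finite at [0], and [1 - (1 + x)^(-n/2)] is compared with [x^k]. *)
  have h1 : 1 <= 1 / (2 * H) by rewrite ler_pdivlMr// mul1r; lra.
  have h2 : 1 / (2 * H) < 2 by rewrite ltr_pdivrMr//; lra.
  have [k [k1 k2 k3]] : exists k : R, [/\ 1 / (2 * H) - 1 < k, k < 1 & k < alpha - p].
    have [h|h] := leP (alpha - p) 1.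
      by exists ((1 / (2 * H) - 1 + (alpha - p)) / 2); split; lra.
    by exists ((1 / (2 * H) - 1 + 1) / 2); split; lra.
  have k0 : 0 < k by lra.
  have bound s u : 0 < s -> 0 < u ->
    `|gker n alpha s u - 1 * kern n alpha u| <=
      ((p + 1) * 2 `^ (- k)) * s `^ k * (u `^ (alpha - p - k - 1) * expR (- u)).
    move=> s0 u0; rewrite (gkerE _ u0 (ltW s0)) mul1r -[X in _ - X]mulr1 -mulrBr normrM.
    rewrite (ger0_norm (kern_ge0 n alpha u0)).
    have x0 : 0 <= s / (2 * u) by rewrite divr_ge0 ?mulr_ge0 ?ltW.
    have p0 : 0 <= p by rewrite divr_ge0.
    have k01 : 0 <= k <= 1 by rewrite !ltW.
    have h := one_sub_powR_le x0 p0 k01.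
    apply: (le_trans (ler_wpM2l (kern_ge0 n alpha u0) h)).
    rewrite kernE// powRM ?invr_ge0 ?mulr_ge0 ?(ltW s0) ?(ltW u0)//.
    rewrite -(powR_inv1 (_ : 0 <= 2 * u)) ?mulr_ge0 ?(ltW u0)// -powRrM mulN1r.
    rewrite powRM ?(ltW u0)//.
    rewrite (_ : alpha - p - k - 1 = (alpha - p - 1) + - k); last by ring.
    rewrite (@powRD _ u (alpha - p - 1) (- k)) ?(gt_eqF u0) ?implybT//.
    by rewrite le_eqVlt; apply/orP; left; apply/eqP; ring.
  have ap : p < alpha by lra.
  have a0 : 0 < alpha - p - k by lra.
  have A0 : 0 <= (p + 1) * 2 `^ (- k) by rewrite mulr_ge0 ?powR_ge0 ?addr_ge0 ?divr_ge0.
  have [w0 [C [w00 C0 h]]] := wgt_near H ler01 A0 a0 (or_intror ap) bound.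
  by exists w0, C, (2 * H * k); split => //; exact: beta_gt.
- (* The weight may be infinite at [0]: [(1 + x)^(-n/2)] is bounded by [x^(th - n/2)]. *)
  have h2 : 1 / (2 * H) < 1 by rewrite ltr_pdivrMr// mul1r; lra.
  have h1 : 1 / 2 < 1 / (2 * H) by rewrite ltr_pdivlMr//; lra.
  have [th [t1 t2 t3]] : exists th : R, [/\ p - 1 + 1 / (2 * H) < th, th < p & th < alpha].
    have [h|h] := leP alpha p.
      by exists ((p - 1 + 1 / (2 * H) + alpha) / 2); split; lra.
    by exists ((p - 1 + 1 / (2 * H) + p) / 2); split; lra.
  have th0 : 0 < th by lra.
  have bound s u : 0 < s -> 0 < u ->
    `|gker n alpha s u - 0 * kern n alpha u| <=
      (2 `^ (p - th)) * s `^ (th - p) * (u `^ (alpha - th - 1) * expR (- u)).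
    move=> s0 u0; rewrite (gkerE _ u0 (ltW s0)) mul0r subr0 normrM.
    rewrite (ger0_norm (kern_ge0 n alpha u0)) ger0_norm ?powR_ge0//.
    have x0 : 0 < s / (2 * u) by rewrite divr_gt0 ?mulr_gt0.
    have h : (1 + s / (2 * u)) `^ (- p) <= (s / (2 * u)) `^ (th - p).
      apply: (@le_trans _ _ ((1 + s / (2 * u)) `^ (th - p))).
        by apply: ler_powR; [rewrite lerDl ltW|rewrite lerDr ltW].
      rewrite -(opprB p th) !powRN lef_pV2 ?posrE ?powR_gt0 ?addr_gt0//.
      apply: ge0_ler_powR; [by rewrite subr_ge0 ltW|by rewrite nnegrE ltW| |by rewrite lerDr].
      by rewrite nnegrE addr_ge0// ltW.
    apply: (le_trans (ler_wpM2l (kern_ge0 n alpha u0) h)).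
    rewrite kernE// powRM ?invr_ge0 ?mulr_ge0 ?(ltW s0) ?(ltW u0)//.
    rewrite -(powR_inv1 (_ : 0 <= 2 * u)) ?mulr_ge0 ?(ltW u0)// -powRrM mulN1r opprB.
    rewrite powRM ?(ltW u0)//.
    rewrite (_ : alpha - th - 1 = (alpha - p - 1) + (p - th)); last by ring.
    rewrite (@powRD _ u (alpha - p - 1) (p - th)) ?(gt_eqF u0) ?implybT//.
    by rewrite le_eqVlt; apply/orP; left; apply/eqP; ring.
  have a0 : 0 < alpha - th by lra.
  have [w0 [C [w00 C0 h]]] := wgt_near H (lexx 0) (powR_ge0 _ _) a0 (or_introl erefl) bound.
  exists w0, C, (2 * H * (th - p)); split => //; apply: beta_gt; lra.
Qed.

End weight.

(** * Covariances of difference quotients *)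

Section fbm_kernel.
Context (R : realType) (H : R).
Hypothesis H0 : 0 < H.
Implicit Types a b s t eps : R.

(** The variogram [|a|^(2H)]. *)
Definition fH a : R := `|a| `^ (2 * H).

(** The covariance function of a real fractional Brownian motion. *)
Definition RH a b : R := 2^-1 * (fH a + fH b - fH (a - b)).

(** The left time of the symmetric difference quotient, [t - eps] replaced by [0] for
    [t < eps]; this is legitimate for covariances since the process vanishes at time [0] in
    mean square. *)
Definition mpos eps t : R := Num.max 0 (t - eps).

(** The covariance of the difference quotients at times [t] and [s]. *)
Definition Ceps eps t s : R := (2 * eps)^-1 ^+ 2 *
  (RH (t + eps) (s + eps) - RH (t + eps) (mpos eps s)
   - RH (mpos eps t) (s + eps) + RH (mpos eps t) (mpos eps s)).

(** [4 eps] times the covariance of the difference quotient at [t] with [X_t - X_s]. *)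
Definition cross eps t s : R :=
  fH (t + eps - s) - fH eps + fH (t - mpos eps t) - fH (s - mpos eps t).

Lemma fH0 : fH 0 = 0.
Proof. by rewrite /fH normr0 powR0// mulf_neq0// gt_eqF. Qed.

Lemma fHN a : fH (- a) = fH a.
Proof. by rewrite /fH normrN. Qed.

Lemma fHC a b : fH (a - b) = fH (b - a).
Proof. by rewrite -fHN opprB. Qed.

Lemma fH_ge0 a : 0 <= fH a. Proof. exact: powR_ge0. Qed.

Lemma le_fH a b : `|a| <= `|b| -> fH a <= fH b.
Proof.
by move=> ab; apply: ge0_ler_powR; rewrite ?nnegrE// mulr_ge0// ltW.
Qed.

Lemma le_fH_itv a b : - b <= a -> a <= b -> fH a <= fH b.
Proof.
move=> h1 h2; apply: le_fH; rewrite [leRHS]ger0_norm ?ler_norml ?h1//; lra.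
Qed.

Lemma RHC a b : RH a b = RH b a.
Proof. by rewrite /RH (fHC b a); ring. Qed.

Lemma RH0 a : RH 0 a = 0.
Proof. by rewrite /RH fH0 sub0r fHN; ring. Qed.

Lemma mposP eps t : 0 < eps ->
  (t < eps /\ mpos eps t = 0) \/ (eps <= t /\ mpos eps t = t - eps).
Proof.
move=> e0; rewrite /mpos; have [h|h] := ltP t eps; [left|right]; split => //.
  by rewrite max_l// subr_le0 ltW.
by rewrite max_r// subr_ge0.
Qed.

Lemma mpos_ge0 eps t : 0 <= mpos eps t.
Proof. by rewrite /mpos le_max lexx. Qed.

Lemma cross_le0 eps t s : 0 < eps -> 0 <= t -> t <= s -> cross eps t s <= 0.
Proof.
move=> e0 t0 ts; rewrite /cross; have m0 := mpos_ge0 eps t.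
have mt : t - eps <= mpos eps t <= t.
  by have [[? ->]|[? ->]] := mposP t e0; apply/andP; split; lra.
have /andP[mt1 mt2] := mt.
have h1 : fH (t - mpos eps t) <= fH (s - mpos eps t) by apply: le_fH_itv; lra.
have h2 : fH (t - mpos eps t) <= fH eps by apply: le_fH_itv; lra.
have [h|h] := leP (s - t) (2 * eps).
  have h3 : fH (t + eps - s) <= fH eps by apply: le_fH_itv; lra.
  lra.
have h3 : fH (t + eps - s) <= fH (s - mpos eps t) by apply: le_fH_itv; lra.
lra.
Qed.

Lemma cross_ge0 eps t s : 0 < eps -> 0 <= s -> s <= t -> 0 <= cross eps t s.
Proof.
move=> e0 s0 st; rewrite /cross; have m0 := mpos_ge0 eps t.
have h1 : fH eps <= fH (t + eps - s) by apply: le_fH_itv; lra.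
have [hm|hm] := leP (mpos eps t) s.
  have h2 : fH (s - mpos eps t) <= fH (t - mpos eps t) by apply: le_fH_itv; lra.
  lra.
have [[? mt]|[? mt]] := mposP t e0; first by rewrite mt in hm; lra.
rewrite mt (_ : t - (t - eps) = eps); last ring.
have h2 : fH (s - (t - eps)) <= fH (t + eps - s) by apply: le_fH_itv; lra.
lra.
Qed.

(** Each of the two covariances has the sign of [t - s]: a positive increment of the path between [s] and
    [t] makes both slopes larger on average. *)
Lemma cross_mul_ge0 eps t s : 0 < eps -> 0 <= t -> 0 <= s ->
  0 <= cross eps t s * - cross eps s t.
Proof.
move=> e0 t0 s0; have [ts|ts] := leP t s.
  by rewrite mulrN -mulNr mulr_ge0 ?oppr_ge0 ?cross_le0 ?cross_ge0.
by rewrite mulr_ge0 ?oppr_ge0 ?cross_le0 ?cross_ge0// ltW.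
Qed.

End fbm_kernel.

Section fbm_covariances.
Context d (T : measurableType d) (R : realType) (P : probability T R).
Variables (n : nat) (H : R) (X : R -> T -> 'rV[R]_n).
Hypothesis hX : fBm P H X.
Hypothesis H0 : 0 < H.

Let hB i : real_fBm P H (fun t w => X t w ord0 i).
Proof. by case: hX => h _; exact: (h i). Qed.

Lemma vspan_proc t : 0 <= t -> vspan X (X t).
Proof. by move=> t0 i; exact: (span_proc (fun t w => X t w ord0 i)). Qed.

Lemma vcovar_proc s t : 0 <= s -> 0 <= t -> vcovar P (X s) (X t) (RH H s t).
Proof. by move=> s0 t0 i; rewrite (proc_covar (hB i) s0 t0). Qed.

(** The cut-off of the left value: [X_{t-eps}] is replaced by [0] when [t < eps]. *)
Definition kap (eps t : R) : R := if t < eps then 0 else 1.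

Lemma D0E eps t w : 0 < eps ->
  D0 eps (X^~ w) t = (2 * eps)^-1 *: X (t + eps) w +
    (- ((2 * eps)^-1 * kap eps t)) *: X (mpos eps t) w.
Proof.
move=> e0; rewrite /D0 scalerBr scaleNr -scalerA /kap.
have [[h ->]|[h ->]] := mposP t e0; first by rewrite h scale0r.
by rewrite ltNge h/= scale1r.
Qed.

(** The cut-off is invisible to covariances because [RH 0 a = 0]. *)
Lemma kap_RH eps t a : 0 < eps -> kap eps t * RH H (mpos eps t) a = RH H (mpos eps t) a.
Proof.
move=> e0; rewrite /kap; have [[h ->]|[h ->]] := mposP t e0.
  by rewrite h (RH0 H0) mulr0.
by rewrite ltNge h/= mul1r.
Qed.

(** The difference quotient of the process as a random vector. *)
Definition DX eps t w := D0 eps (X^~ w) t.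
(** The increment of the process. *)
Definition WX t s w := X t w - X s w.

Section fixed.
Variables (eps t s : R).
Hypotheses (e0 : 0 < eps) (t0 : 0 <= t) (s0 : 0 <= s).

Let DXE u : DX eps u = fun w => (2 * eps)^-1 *: X (u + eps) w +
    (- ((2 * eps)^-1 * kap eps u)) *: X (mpos eps u) w.
Proof. by apply/funext => w; rewrite /DX D0E. Qed.

Let WXE : WX t s = fun w => 1 *: X t w + (-1) *: X s w.
Proof. by apply/funext => w; rewrite /WX scale1r scaleN1r. Qed.

Let pe (u : R) : 0 <= u -> 0 <= u + eps.
Proof. by move=> u0; rewrite addr_ge0// ltW. Qed.

Lemma vspan_DX u : 0 <= u -> vspan X (DX eps u).
Proof.
move=> u0; rewrite DXE; apply: vspan_comb; apply: vspan_proc; first exact: pe.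
exact: mpos_ge0.
Qed.

Lemma vspan_WX : vspan X (WX t s).
Proof. by rewrite WXE; apply: vspan_comb; exact: vspan_proc. Qed.

Lemma vcovar_DX_proc u a : 0 <= u -> 0 <= a ->
  vcovar P (DX eps u) (X a) ((2 * eps)^-1 * (RH H (u + eps) a - RH H (mpos eps u) a)).
Proof.
move=> u0 a0; rewrite DXE.
have -> : (2 * eps)^-1 * (RH H (u + eps) a - RH H (mpos eps u) a) =
   (2 * eps)^-1 * RH H (u + eps) a + (- ((2 * eps)^-1 * kap eps u)) * RH H (mpos eps u) a.
  by rewrite mulNr -(mulrA _ (kap eps u)) kap_RH//; ring.
apply: (vcovar_combl hX); try exact: vspan_proc.
- by apply: vspan_proc; exact: pe.
- by apply: vspan_proc; exact: mpos_ge0.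
- by apply: vcovar_proc => //; exact: pe.
- by apply: vcovar_proc => //; exact: mpos_ge0.
Qed.

Lemma vcovar_DX : vcovar P (DX eps t) (DX eps s) (Ceps H eps t s).
Proof.
apply: vcovarC; rewrite (DXE s).
have h1 := vcovarC (vcovar_DX_proc t0 (pe s0)).
have h2 := vcovarC (vcovar_DX_proc t0 (mpos_ge0 eps s)).
have := vcovar_combl hX (2 * eps)^-1 (- ((2 * eps)^-1 * kap eps s))
  (vspan_proc (pe s0)) (vspan_proc (mpos_ge0 eps s)) (vspan_DX t0) h1 h2.
congr (vcovar _ _ _ _); rewrite /Ceps.
transitivity ((2 * eps)^-1 * ((2 * eps)^-1 * (RH H (t + eps) (s + eps) - RH H (mpos eps t) (s + eps))) -
  (2 * eps)^-1 * (2 * eps)^-1 * (kap eps s * RH H (mpos eps s) (t + eps) - kap eps s * RH H (mpos eps s) (mpos eps t))).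
  by rewrite (RHC H (mpos eps s) (t + eps)) (RHC H (mpos eps s) (mpos eps t)); ring.
rewrite !(kap_RH _ _ e0) (RHC H (mpos eps s) (t + eps)) (RHC H (mpos eps s) (mpos eps t)).
ring.
Qed.

Lemma vcovar_DX_WX : vcovar P (DX eps t) (WX t s) ((4 * eps)^-1 * cross H eps t s).
Proof.
apply: vcovarC; rewrite WXE.
have h1 := vcovarC (vcovar_DX_proc t0 t0); have h2 := vcovarC (vcovar_DX_proc t0 s0).
have := vcovar_combl hX 1 (-1) (vspan_proc t0) (vspan_proc s0) (vspan_DX t0) h1 h2.
congr (vcovar _ _ _ _); rewrite /RH /cross.
rewrite (_ : t + eps - t = eps); last ring.
rewrite (fHC H (mpos eps t) t) (fHC H (mpos eps t) s).
by field; rewrite gt_eqF.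
Qed.

Lemma vcovar_DX_WX' : vcovar P (DX eps s) (WX t s) (- ((4 * eps)^-1 * cross H eps s t)).
Proof.
apply: vcovarC; rewrite WXE.
have h1 := vcovarC (vcovar_DX_proc s0 t0); have h2 := vcovarC (vcovar_DX_proc s0 s0).
have := vcovar_combl hX 1 (-1) (vspan_proc t0) (vspan_proc s0) (vspan_DX s0) h1 h2.
congr (vcovar _ _ _ _); rewrite /RH /cross.
rewrite (_ : s + eps - s = eps); last ring.
rewrite (fHC H (mpos eps s) t) (fHC H (mpos eps s) s).
by field; rewrite gt_eqF.
Qed.

Lemma vcovar_WX : vcovar P (WX t s) (WX t s) (fH H (t - s)).
Proof.
have h u : 0 <= u -> vcovar P (X u) (WX t s) (1 * RH H u t + (-1) * RH H u s).
  move=> u0; apply: vcovarC; rewrite WXE; apply: (vcovar_combl hX); try exact: vspan_proc.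
    by rewrite RHC; exact: vcovar_proc.
  by rewrite RHC; exact: vcovar_proc.
have := vcovar_combl hX 1 (-1) (vspan_proc t0) (vspan_proc s0) vspan_WX (h _ t0) (h _ s0).
rewrite {2}WXE; congr (vcovar _ _ _ _).
by rewrite /RH !subrr (fH0 H0) (fHC H s t); field.
Qed.

End fixed.

End fbm_covariances.

Lemma MVT_pos (R : realType) (f f' : R -> R) (a b : R) :
  (forall x : R, 0 < x -> is_derive x 1 f (f' x)) -> 0 < a -> a < b ->
  exists2 c, a < c < b & f b - f a = f' c * (b - a).
Proof.
move=> df a0 ab; have [||c] := @MVT R f f' a b ab.
- by move=> x; rewrite in_itv/= => /andP[/(lt_trans a0) x0 _]; exact: df.
- apply: continuous_in_subspaceT => x /set_mem; rewrite /= in_itv/= => /andP[ax _].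
  by apply: is_derive_continuous (df x _); rewrite (lt_le_trans a0).
- by rewrite in_itv/= => ? ?; exists c.
Qed.

(** * Off-diagonal bound on the covariance *)

Section covariance_bounds.
Context (R : realType) (H : R).
Hypotheses (H0 : 0 < H) (H1 : H < 1).
Implicit Types a b s t eps r y p q : R.

(** Mean value theorem twice; [2H - 2 <= 0] makes the second derivative largest at [y]. *)
Lemma second_difference_le y p q : 0 < y -> 0 < p -> 0 < q ->
  `|(y + p + q) `^ (2 * H) + y `^ (2 * H) - (y + p) `^ (2 * H) - (y + q) `^ (2 * H)|
   <= 2 * p * q * y `^ (2 * H - 2).
Proof.
move=> y0 p0 q0; have H0' := H0; have H1' := H1.
have h1 : `|2 * H - 1| <= 1 by rewrite ler_norml; apply/andP; split; lra.
have n1 : 0 <= `|2 * H - 1| by [].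
have HH : H * `|2 * H - 1| <= 1 by nra.
have H22 : 0 <= 2 - 2 * H by lra.
have dpow (e x c : R) : 0 < x + c -> is_derive x 1 (fun x => (x + c) `^ e) (e * (x + c) `^ (e - 1)).
  move=> xc; have h : is_derive x 1 (fun x => x + c) 1 by apply: is_derive_eq; rewrite addr0.
  by apply: (is_derive_eq (is_derive_powR_comp (f := fun x => x + c) e xc h)); rewrite mulr1.
(* The summand [0] makes [dpow] applicable to both terms. *)
pose g x := (x + q) `^ (2 * H) - (x + 0) `^ (2 * H).
pose g' x := 2 * H * ((x + q) `^ (2 * H - 1) - (x + 0) `^ (2 * H - 1)).
have dg (x : R) : 0 < x -> is_derive x 1 g (g' x).
  move=> x0; have hq := dpow (2 * H) x q (addr_gt0 x0 q0).
  have h2 : is_derive x 1 (fun x => (x + 0) `^ (2 * H)) (2 * H * (x + 0) `^ (2 * H - 1)).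
    by apply: dpow; rewrite addr0.
  by rewrite /g' mulrBr; apply: is_deriveB.
have yp : y < y + p by rewrite ltrDl.
have [c /andP[yc' _] gE] := MVT_pos dg y0 yp.
have c0 : 0 < c by exact: lt_trans y0 yc'.
have yc := ltW yc'.
have cq : c < c + q by rewrite ltrDl.
pose k x := (x + 0) `^ (2 * H - 1).
pose k' x := (2 * H - 1) * (x + 0) `^ (2 * H - 1 - 1).
have dk (x : R) : 0 < x -> is_derive x 1 k (k' x) by move=> x0; apply: dpow; rewrite addr0.
have [e /andP[ce _] kE] := MVT_pos dk c0 cq.
have e0 : 0 < e by exact: lt_trans c0 ce.
have ye : y <= e by exact: le_trans yc (ltW ce).
have -> : (y + p + q) `^ (2 * H) + y `^ (2 * H) - (y + p) `^ (2 * H) - (y + q) `^ (2 * H) =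
  g (y + p) - g y by rewrite /g !addr0; ring.
have gc : g' c = 2 * H * (k (c + q) - k c) by rewrite /g' /k !addr0.
rewrite gE gc.
rewrite kE /k' addr0 !(addrAC _ _ (- y)) subrr add0r !(addrAC _ _ (- c)) subrr add0r.
have -> : 2 * H - 1 - 1 = 2 * H - 2 by ring.
have ep : e `^ (2 * H - 2) <= y `^ (2 * H - 2).
  rewrite -(opprB 2 (2 * H)) !powRN lef_pV2 ?posrE ?powR_gt0//.
  by apply: ge0_ler_powR; rewrite ?nnegrE ?(ltW y0) ?(ltW e0).
have ep0 := powR_ge0 e (2 * H - 2).
rewrite !normrM (gtr0_norm p0) (gtr0_norm q0) (ger0_norm ep0) (gtr0_norm H0) (ger0_norm (ler0n _ 2)).
have HH0 : 0 <= H * `|2 * H - 1| by rewrite mulr_ge0// ltW.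
have pq : 0 <= p * q by rewrite mulr_ge0// ltW.
have : H * `|2 * H - 1| * (e `^ (2 * H - 2)) <= 1 * y `^ (2 * H - 2) by rewrite ler_pM.
move=> h; have := ler_wpM2l pq h.
rewrite mul1r; set z := `|_|; lra.
Qed.

Lemma CepsE eps t s : 0 < eps -> Ceps H eps t s = (8 * eps ^+ 2)^-1 *
  (fH H (t + eps - mpos eps s) + fH H (s + eps - mpos eps t) - fH H (t - s)
   - fH H (mpos eps t - mpos eps s)).
Proof.
move=> e0; rewrite /Ceps /RH (fHC H (mpos eps t) (s + eps)).
rewrite (_ : t + eps - (s + eps) = t - s); last ring.
by field; rewrite gt_eqF.
Qed.

Lemma CepsC eps t s : 0 < eps -> Ceps H eps t s = Ceps H eps s t.
Proof.
move=> e0; rewrite !CepsE// (fHC H t s) (fHC H (mpos eps t)).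
by congr (_ * _); ring.
Qed.

Lemma mpos_bounds eps t : 0 < eps -> 0 <= t -> t - eps <= mpos eps t <= t.
Proof. by move=> e0 t0; have [[? ->]|[? ->]] := mposP t e0; apply/andP; split; lra. Qed.

Lemma Ceps_diag_le eps t : 0 < eps -> 0 <= t ->
  Ceps H eps t t <= (4 * eps ^+ 2)^-1 * fH H (2 * eps).
Proof.
move=> e0 t0; rewrite CepsE// !subrr (fH0 H0) !subr0.
have /andP[m1 m2] := mpos_bounds e0 t0.
rewrite (_ : (8 * eps ^+ 2)^-1 = (4 * eps ^+ 2)^-1 * 2^-1); last by field; rewrite gt_eqF.
rewrite -mulrA; apply: ler_wpM2l; first by rewrite invr_ge0 mulr_ge0 ?sqr_ge0.
have h0 := fH_ge0 H (t + eps - mpos eps t).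
have h : fH H (t + eps - mpos eps t) <= fH H (2 * eps) by apply: (le_fH_itv H0); lra.
lra.
Qed.

Let Ceps_le_lt eps t s : 0 < eps -> 0 <= s -> s < t ->
  `|Ceps H eps t s| <= 144 * (t - s) `^ (2 * H - 2).
Proof.
move=> e0 s0 st; have H0' := H0; have H1' := H1; have t0 : 0 <= t by rewrite (le_trans s0)// ltW.
have r0 : 0 < t - s by rewrite subr_gt0.
have /andP[mt1 mt2] := mpos_bounds e0 t0; have /andP[ms1 ms2] := mpos_bounds e0 s0.
have mt0 := mpos_ge0 eps t; have ms0 := mpos_ge0 eps s.
have ee : 0 < eps ^+ 2 by rewrite exprn_gt0.
rewrite CepsE// normrM ger0_norm ?invr_ge0 ?mulr_ge0 ?(ltW ee)//.
have rp := powR_ge0 (t - s) (2 * H - 2).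
(* Since [2H - 2 >= -2], dividing the base by [c] costs at most the factor [c^2]. *)
have scale (c : R) : 1 <= c -> ((t - s) / c) `^ (2 * H - 2) <= c ^+ 2 * (t - s) `^ (2 * H - 2).
  move=> c1; have c0 : 0 < c by rewrite (lt_le_trans ltr01).
  rewrite powRM ?invr_ge0 ?(ltW r0) ?(ltW c0)// mulrC ler_wpM2r//.
  rewrite -(powR_inv1 (ltW c0)) -powRrM mulN1r opprB -(powR_mulrn 2 (ltW c0)).
  by apply: ler_powR => //; lra.
have [far|near] := leP (4 * eps) (t - s).
- have [[h _]|[_ mtE]] := mposP t e0; first by lra.
  pose y := t - s - 2 * eps; have y0 : 0 < y by rewrite /y; lra.
  have p0 : 0 < 2 * eps by rewrite mulr_gt0.
  have q0 : 0 < s + eps - mpos eps s by lra.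
  have := second_difference_le y0 p0 q0.
  rewrite mtE /fH (gtr0_norm (_ : 0 < t + eps - mpos eps s)); last lra.
  rewrite (ler0_norm (_ : s + eps - (t - eps) <= 0)); last lra.
  rewrite (gtr0_norm r0) (gtr0_norm (_ : 0 < t - eps - mpos eps s)); last lra.
  rewrite (_ : y + 2 * eps + (s + eps - mpos eps s) = t + eps - mpos eps s); last by rewrite /y; ring.
  rewrite (_ : y + 2 * eps = t - s); last by rewrite /y; ring.
  rewrite (_ : y + (s + eps - mpos eps s) = t - eps - mpos eps s); last by rewrite /y; ring.
  rewrite (_ : - (s + eps - (t - eps)) = y); last by rewrite /y; ring.
  set N := `|_|; move=> hN.
  have hy : y `^ (2 * H - 2) <= 4 * (t - s) `^ (2 * H - 2).
    apply: (@le_trans _ _ (((t - s) / 2) `^ (2 * H - 2))); last first.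
      have := scale 2 (ler1n _ 2); rewrite (_ : 2 ^+ 2 = 4)//; ring.
    rewrite -(opprB 2 (2 * H)) !powRN lef_pV2 ?posrE ?powR_gt0 ?divr_gt0//.
    by apply: ge0_ler_powR; rewrite ?nnegrE ?(ltW y0) ?divr_ge0 ?(ltW r0)//; rewrite /y; lra.
  have yp := powR_ge0 y (2 * H - 2).
  rewrite mulrC ler_pdivrMr ?mulr_gt0//; apply: (le_trans hN).
  apply: (@le_trans _ _ (2 * (2 * eps) * (2 * eps) * (4 * (t - s) `^ (2 * H - 2)))).
    by apply: ler_pM => //; [rewrite !mulr_ge0 ?ltW|rewrite ler_wpM2l ?mulr_ge0 ?(ltW e0)//; lra].
  have rE : 0 <= (t - s) `^ (2 * H - 2) * eps ^+ 2 by rewrite mulr_ge0// ltW.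
  lra.
- have f6 a : - (6 * eps) <= a -> a <= 6 * eps -> 0 <= fH H a <= fH H (6 * eps).
    by move=> h1 h2; rewrite fH_ge0/=; apply: (le_fH_itv H0); lra.
  have /andP[a1 a2] : 0 <= fH H (t + eps - mpos eps s) <= fH H (6 * eps) by apply: f6; lra.
  have /andP[b1 b2] : 0 <= fH H (s + eps - mpos eps t) <= fH H (6 * eps) by apply: f6; lra.
  have /andP[c1 c2] : 0 <= fH H (t - s) <= fH H (6 * eps) by apply: f6; lra.
  have /andP[d1 d2] : 0 <= fH H (mpos eps t - mpos eps s) <= fH H (6 * eps) by apply: f6; lra.
  have hN : `|fH H (t + eps - mpos eps s) + fH H (s + eps - mpos eps t) - fH H (t - s)
   - fH H (mpos eps t - mpos eps s)| <= 2 * fH H (6 * eps) by rewrite ler_norml; apply/andP; split; lra.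
  have e6 : fH H (6 * eps) <= 36 * (eps ^+ 2 * eps `^ (2 * H - 2)).
    rewrite /fH gtr0_norm ?mulr_gt0// powRM ?(ltW e0)//.
    have -> : eps `^ (2 * H) = eps ^+ 2 * eps `^ (2 * H - 2).
      rewrite -(powR_mulrn 2 (ltW e0)) -powRD ?(gt_eqF e0) ?implybT//.
      by congr (_ `^ _); ring.
    apply: ler_wpM2r; first by rewrite mulr_ge0 ?powR_ge0 ?(ltW ee).
    apply: (@le_trans _ _ (6 `^ 2)); last by rewrite (powR_mulrn 2)// expr2 -natrM.
    by apply: ler_powR; rewrite ?ler1n//; lra.
  have ge : eps `^ (2 * H - 2) <= 16 * (t - s) `^ (2 * H - 2).
    apply: (@le_trans _ _ (((t - s) / 4) `^ (2 * H - 2))); last first.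
      have := scale 4 (ler1n _ 4); rewrite (_ : 4 ^+ 2 = 16)//; ring.
    rewrite -(opprB 2 (2 * H)) !powRN lef_pV2 ?posrE ?powR_gt0 ?divr_gt0//.
    by apply: ge0_ler_powR; rewrite ?nnegrE ?(ltW e0) ?divr_ge0 ?(ltW r0)//; lra.
  rewrite mulrC ler_pdivrMr ?mulr_gt0//; apply: (le_trans hN).
  have h := ler_wpM2l (ltW ee) ge.
  lra.
Unshelve. all: exact: ltW.
Qed.

(** For [|t - s| >= 4 eps] the covariance is a second difference of the variogram at distance at least
    [|t - s|/2]; for smaller distances each of the four terms of [CepsE] is at
    most [(6 eps)^(2H)].
    The second case dictates the constant. *)
Lemma Ceps_le eps t s : 0 < eps -> 0 <= t -> 0 <= s -> t != s ->
  `|Ceps H eps t s| <= 144 * `|t - s| `^ (2 * H - 2).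
Proof.
move=> e0 t0 s0; case: (ltgtP s t) => // st _.
  have r0 : 0 < t - s by rewrite subr_gt0.
  by rewrite (gtr0_norm r0) Ceps_le_lt.
have r0 : 0 < s - t by rewrite subr_gt0.
by rewrite CepsC// (distrC t s) (gtr0_norm r0) Ceps_le_lt.
Qed.

End covariance_bounds.

(** * The double integral of the covariance *)

Section telescoping.
Context (R : realType).
Implicit Types (T eps M : R) (phi : R -> R).

(** The integral of a symmetric difference telescopes to integrals over two intervals of length [2 eps].  The
    margins around [[0, T]] leave room for the shifts. *)
Lemma integral_shift_difference_le T eps M phi :
  0 < T -> 0 < eps < 1 ->
  (forall x, -2 < x < T + 2 -> {for x, continuous phi}) ->
  (forall x, -1 <= x <= T + 1 -> `|phi x| <= M) ->
  exists2 I : R, (\int[lebesgue_measure]_(s in `[0%R, T]) (phi (s + eps) - phi (s - eps))%:E = I%:E)%E &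
    `|I| <= 4 * eps * M.
Proof.
move=> T0 /andP[e0 e1] cphi bphi.
(* The primitive is based on a segment containing all shifted times in its interior. *)
pose a : R := - (3 / 2); pose u : R := T + 3 / 2.
pose F y := \int[lebesgue_measure]_(t in `[a, y]) phi t.
have iphi : lebesgue_measure.-integrable `[a, u] (EFin \o phi).
  apply: continuous_compact_integrable; first exact: segment_compact.
  apply: continuous_in_subspaceT => x /set_mem; rewrite /= in_itv/= => /andP[h1 h2].
  by apply: cphi; apply/andP; split; rewrite /a /u in h1 h2; lra.
have dF x : -1 <= x <= T + 1 -> is_derive x 1 F (phi x).
  move=> /andP[h1 h2]; have xu : x < u by rewrite /u; lra.
  have ax : a < x by rewrite /a; lra.
  have [|d1 d2] := continuous_FTC1_closed xu iphi ax.
    by apply: cphi; apply/andP; split; lra.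
  by apply: DeriveDef; [exact: d1|rewrite -derive1E; exact: d2].
clearbody F.
pose Psi s := F (s + eps) - F (s - eps).
have shift (c x l : R) : is_derive (x + c) 1 F l -> is_derive x 1 (fun x => F (x + c)) l.
  move=> h; have h1 : is_derive x 1 (fun x => x + c) 1 by apply: is_derive_eq; rewrite addr0.
  by have := is_derive1_comp (f := F) (g := fun x => x + c) h h1; rewrite mulr1.
have dPsi x : 0 <= x <= T -> is_derive x 1 Psi (phi (x + eps) - phi (x - eps)).
  move=> /andP[x0 xT].
  have h1 : is_derive x 1 (fun x => F (x + eps)) (phi (x + eps)).
    by apply: shift; apply: dF; apply/andP; split; lra.
  have h2 : is_derive x 1 (fun x => F (x - eps)) (phi (x - eps)).
    by apply: (shift (- eps)); apply: dF; apply/andP; split; lra.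
  exact: (is_deriveB h1 h2).
have cs (c x : R) : {for x + c, continuous phi} -> {for x, continuous (fun x => phi (x + c))}.
  move=> h; apply: (continuous_comp (f := fun x => x + c)) => //.
  by apply: (@cvgD _ R^o) => //; exact: cvg_cst.
exists (Psi T - Psi 0).
  rewrite (integral_primitive T0 dPsi)// => x /andP[x0 xT].
  apply: (@cvgB _ R^o).
    by apply: cs; apply: cphi; apply/andP; split; lra.
  by apply: (cs (- eps)); apply: cphi; apply/andP; split; lra.
have psib x : 0 <= x <= T -> `|Psi x| <= 2 * eps * M.
  move=> /andP[x0 xT].
  have lt : x - eps < x + eps by lra.
  have [||c] := @MVT R F phi (x - eps) (x + eps) lt.
  - by move=> y; rewrite in_itv/= => /andP[h1 h2]; apply: dF; apply/andP; split; lra.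
  - apply: continuous_in_subspaceT => y /set_mem; rewrite /= in_itv/= => /andP[h1 h2].
    by apply: is_derive_continuous (dF y _); apply/andP; split; lra.
  rewrite in_itv/= => /andP[h1 h2]; rewrite /Psi => ->.
  rewrite (_ : x + eps - (x - eps) = 2 * eps); last ring.
  rewrite normrM (gtr0_norm (_ : 0 < 2 * eps)) ?mulr_gt0// mulrC ler_wpM2l ?mulr_ge0 ?(ltW e0)//.
  by apply: bphi; apply/andP; split; lra.
apply: le_trans (ler_normB _ _) _.
have := psib T; rewrite (ltW T0) lexx => /(_ isT) h1.
have := psib 0; rewrite (ltW T0) lexx => /(_ isT) h2.
lra.
Qed.

End telescoping.

Section double_covariance.
Context (R : realType) (H : R).
Hypotheses (H0 : 0 < H) (H1 : H < 1).
Implicit Types a b s t eps T x y : R.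

Lemma continuous_fH : continuous (fH H).
Proof.
move=> x; have H20 : 0 < 2 * H by rewrite mulr_gt0.
have [->|x0] := eqVneq x 0.
  apply/cvgrPdist_lt => e e0; rewrite (fH0 H0).
  near=> y; rewrite sub0r normrN ger0_norm ?fH_ge0// /fH.
  have -> : e = (e `^ (2 * H)^-1) `^ (2 * H).
    by rewrite -powRrM mulVf ?gt_eqF// powRr1// ltW.
  apply: gt0_ltr_powR; rewrite ?nnegrE ?powR_ge0//.
  near: y; apply: (nbhs0_lt (V := R^o)); exact: powR_gt0.
apply: (continuous_comp (f := fun y : R => `|y|) (g := fun y : R => y `^ (2 * H))).
  exact: norm_continuous.
have xn : 0 < `|x| by rewrite normr_gt0.
exact: (is_derive_continuous (is_derive1_powR (2 * H) xn)).
Unshelve. all: by end_near. Qed.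

Lemma max0E x : Num.max 0 x = (x + `|x|) / 2.
Proof.
have [x0|x0] := leP 0 x; first by rewrite ger0_norm//; field.
by rewrite ltr0_norm//; field.
Qed.

Lemma continuous_max0 : continuous (fun x : R => Num.max 0 x).
Proof.
move=> x; rewrite (_ : (fun x => _) = (fun x => (x + `|x|) / 2)); last by apply/funext => y; exact: max0E.
apply: (@continuousM R R^o (fun x => x + `|x|) (fun=> 2^-1)); last exact: cvg_cst.
by apply: (@continuousD R R^o R^o); [exact: cvg_id|exact: norm_continuous].
Qed.

(** The covariance function extended to negative times by freezing the process at time [0]. *)
Definition RHp a b : R := RH H (Num.max 0 a) (Num.max 0 b).

Lemma RHpC a b : RHp a b = RHp b a.
Proof. exact: RHC. Qed.

Lemma continuous_RHp a : continuous (RHp a).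
Proof.
move=> b; rewrite /RHp /RH.
have cm := @continuous_max0 b.
apply: cvgM; first exact: cvg_cst.
apply: (@cvgB _ R^o).
  apply: (@cvgD _ R^o); first exact: cvg_cst.
  by apply: continuous_comp; [exact: cm|exact: continuous_fH].
apply: (continuous_comp (f := fun b => Num.max 0 a - Num.max 0 b) (g := fH H)).
  by apply: (@cvgB _ R^o); [exact: cvg_cst|exact: cm].
exact: continuous_fH.
Qed.

Lemma continuous_RHpl b : continuous (RHp ^~ b).
Proof.
rewrite (_ : RHp ^~ b = RHp b); first exact: continuous_RHp.
by apply/funext => a; exact: RHpC.
Qed.

Lemma RHp_le a b L : 0 <= L -> a <= L -> b <= L -> `|RHp a b| <= 2 * fH H L.
Proof.
move=> L0 aL bL; rewrite /RHp /RH.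
set a' := Num.max 0 a; set b' := Num.max 0 b.
have a0 : 0 <= a' by rewrite le_max lexx.
have b0 : 0 <= b' by rewrite le_max lexx.
have aL' : a' <= L by rewrite ge_max L0.
have bL' : b' <= L by rewrite ge_max L0.
have h1 : fH H a' <= fH H L by apply: (le_fH_itv H0); lra.
have h2 : fH H b' <= fH H L by apply: (le_fH_itv H0); lra.
have h3 : fH H (a' - b') <= fH H L by apply: (le_fH_itv H0); lra.
have p1 := fH_ge0 H a'; have p2 := fH_ge0 H b'; have p3 := fH_ge0 H (a' - b').
by rewrite ler_norml; apply/andP; split; lra.
Qed.

Lemma CepsRHp eps t s : 0 < eps -> 0 <= t -> 0 <= s ->
  Ceps H eps t s = (2 * eps)^-1 ^+ 2 *
   ((RHp (t + eps) (s + eps) - RHp (t + eps) (s - eps)) -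
    (RHp (t - eps) (s + eps) - RHp (t - eps) (s - eps))).
Proof.
move=> e0 t0 s0; rewrite /Ceps /RHp /mpos !(max_r (_ : 0 <= _ + eps)) ?addr_ge0 ?(ltW e0)//.
by ring.
Qed.

Lemma integrable_Ceps T eps t : 0 < eps -> 0 <= t ->
  lebesgue_measure.-integrable `[0, T] (fun s => (Ceps H eps t s)%:E).
Proof.
move=> e0 t0.
have cR a (h : R) : continuous (fun s => RHp a (s + h)).
  move=> s; apply: (continuous_comp (f := fun s => s + h)); last exact: continuous_RHp.
  by apply: (@cvgD _ R^o) => //; exact: cvg_cst.
pose f (s : R) : R := (2 * eps)^-1 ^+ 2 *
   ((RHp (t + eps) (s + eps) - RHp (t + eps) (s - eps)) -
    (RHp (t - eps) (s + eps) - RHp (t - eps) (s - eps))).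
have : lebesgue_measure.-integrable `[0, T] (EFin \o f).
  apply: continuous_compact_integrable; first exact: segment_compact.
  apply: continuous_subspaceT => s; rewrite /f; apply: cvgM; first exact: cvg_cst.
  by apply: (@cvgB _ R^o); apply: (@cvgB _ R^o); exact: cR.
apply: eq_integrable => //= s; rewrite inE /= in_itv/= => /andP[s0 _].
by rewrite /f CepsRHp.
Qed.

(** By [CepsRHp] the covariance is a difference of shifts in each variable, divided by
    [(2 eps)^2]; [integral_shift_difference_le] applied in [s] and then in [t] gains
    a factor [4 eps] each time. *)
Lemma double_integral_Ceps T eps : 0 < T -> 0 < eps < 1 ->
  lebesgue_measure.-integrable `[0, T] (fun t =>
     \int[lebesgue_measure]_(s in `[0%R, T]) (Ceps H eps t s)%:E)%E /\
  (\int[lebesgue_measure]_(t in `[0%R, T]) \int[lebesgue_measure]_(s in `[0%R, T])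
     (Ceps H eps t s)%:E <= (8 * fH H (T + 2))%:E)%E.
Proof.
move=> T0 e01; have /andP[e0 e1] := e01.
pose M := 2 * fH H (T + 2).
have M0 : 0 <= M by rewrite mulr_ge0 ?fH_ge0.
have bM a x : a <= T + 2 -> x <= T + 2 -> `|RHp a x| <= M.
  by move=> h1 h2; apply: RHp_le => //; rewrite addr_ge0// ltW.
have tele a : a <= T + 2 -> exists2 I : R,
   (\int[lebesgue_measure]_(s in `[0%R, T]) (RHp a (s + eps) - RHp a (s - eps))%:E = I%:E)%E &
    `|I| <= 4 * eps * M.
  move=> aT; apply: integral_shift_difference_le => //.
    by move=> x _; exact: continuous_RHp.
  by move=> x /andP[_ h]; apply: bM => //; lra.
pose psi a := \int[lebesgue_measure]_(s in `[0%R, T]) (RHp a (s + eps) - RHp a (s - eps)).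
have psiE a : a <= T + 2 -> (\int[lebesgue_measure]_(s in `[0%R, T]) (RHp a (s + eps) - RHp a (s - eps))%:E = (psi a)%:E)%E.
  by move=> /tele[I IE _]; rewrite /psi /Rintegral IE.
have psib a : a <= T + 2 -> `|psi a| <= 4 * eps * M.
  by move=> /tele[I IE Ib]; rewrite /psi /Rintegral IE.
have cdiff a : continuous (fun s => RHp a (s + eps) - RHp a (s - eps)).
  move=> s; apply: (@cvgB _ R^o).
    apply: (continuous_comp (f := fun s => s + eps)); last exact: continuous_RHp.
    by apply: (@cvgD _ R^o) => //; exact: cvg_cst.
  apply: (continuous_comp (f := fun s => s - eps)); last exact: continuous_RHp.
  by apply: (@cvgB _ R^o) => //; exact: cvg_cst.
have idiff a : lebesgue_measure.-integrable `[0, T] (EFin \o (fun s => RHp a (s + eps) - RHp a (s - eps))).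
  apply: continuous_compact_integrable; first exact: segment_compact.
  by apply: continuous_subspaceT => x; exact: cdiff.
have cpsi : {in `]-2, (T + 2)[%classic, continuous psi}.
  apply: (@continuity_under_integral R _ _ (@lebesgue_measure R) (fun a s => RHp a (s + eps) - RHp a (s - eps)) `[0, T]
     _ (-2) (T + 2) _ _ (cst (2 * fH H (T + 3) + 2 * fH H (T + 3)))).
  - exact: measurable_itv.
  - by move=> x _; exact: idiff.
  - by apply: aeW => s _ x _; apply: (@cvgB _ R^o); exact: continuous_RHpl.
  - apply: continuous_compact_integrable; first exact: segment_compact.
    by apply: continuous_subspaceT => x; exact: cvg_cst.
  - move=> a; rewrite /= in_itv/= => /andP[a1 a2]; apply: aeW => s; rewrite /= in_itv/= => /andP[s1 s2].
    apply: le_trans (ler_normB _ _) _; apply: lerD; apply: RHp_le; lra.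
clearbody psi.
have inner t : 0 <= t <= T -> (\int[lebesgue_measure]_(s in `[0%R, T]) (Ceps H eps t s)%:E =
    ((2 * eps)^-1 ^+ 2)%:E * (psi (t + eps) - psi (t - eps))%:E)%E.
  move=> /andP[t0 tT].
  have tp : t + eps <= T + 2 by lra.
  have tm : t - eps <= T + 2 by lra.
  rewrite EFinB -(psiE _ tp) -(psiE _ tm).
  rewrite -integralB//; [|exact: idiff|exact: idiff].
  rewrite -integralZl//; last by apply: integrableB => //; exact: idiff.
  apply: eq_integral => s; rewrite inE /= in_itv/= => /andP[s0 sT].
  by rewrite CepsRHp.
have outE : (\int[lebesgue_measure]_(t in `[0%R, T]) \int[lebesgue_measure]_(s in `[0%R, T]) (Ceps H eps t s)%:E =
   \int[lebesgue_measure]_(t in `[0%R, T]) (((2 * eps)^-1 ^+ 2)%:E * (psi (t + eps) - psi (t - eps))%:E))%E.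
  by apply: eq_integral => t; rewrite inE /= in_itv/= => h; exact: inner.
have cpsi' x : -2 < x < T + 2 -> {for x, continuous psi}.
  by move=> h; apply: cpsi; rewrite inE /= in_itv/=.
have ipsi : lebesgue_measure.-integrable `[0, T] (EFin \o (fun t => psi (t + eps) - psi (t - eps))).
  apply: continuous_compact_integrable; first exact: segment_compact.
  apply: continuous_in_subspaceT => x /set_mem; rewrite /= in_itv/= => /andP[x0 xT].
  apply: (@cvgB _ R^o).
    apply: (continuous_comp (f := fun s => s + eps)); first by apply: (@cvgD _ R^o) => //; exact: cvg_cst.
    by apply: cpsi'; apply/andP; split; lra.
  apply: (continuous_comp (f := fun s => s - eps)); first by apply: (@cvgB _ R^o) => //; exact: cvg_cst.
  by apply: cpsi'; apply/andP; split; lra.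
split.
  have : lebesgue_measure.-integrable `[0, T] (fun t =>
      ((2 * eps)^-1 ^+ 2)%:E * (psi (t + eps) - psi (t - eps))%:E)%E by apply: integrableZl.
  apply: eq_integrable => // t; rewrite inE /= in_itv/= => h.
  by rewrite inner.
rewrite outE.
have [] := integral_shift_difference_le (phi := psi) (M := 4 * eps * M) T0 e01 cpsi'.
  by move=> x /andP[_ h]; apply: psib; lra.
move=> I IE Ib; rewrite integralZl//.
rewrite IE -EFinM lee_fin.
apply: (@le_trans _ _ ((2 * eps)^-1 ^+ 2 * (4 * eps * (4 * eps * M)))).
  by rewrite ler_wpM2l ?sqr_ge0// (le_trans (ler_norm _)).
by rewrite le_eqVlt; apply/orP; left; apply/eqP; rewrite /M; field; rewrite gt_eqF.
Qed.

End double_covariance.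

(** A family of random variables with continuous paths is jointly measurable: the time is replaced by
    [floor(k tau)/k], which takes countably many values and tends to [tau]. *)
Lemma measurable_fun_continuous_process d (S : measurableType d) d' (T : measurableType d')
    (R : realType) (Y : R -> T -> R) (tau : S -> R) (p : S -> T) :
  (forall t, measurable_fun setT (Y t)) -> (forall w, continuous (fun t => Y t w)) ->
  measurable_fun setT tau -> measurable_fun setT p ->
  measurable_fun setT (fun x => Y (tau x) (p x)).
Proof.
move=> mY cY mtau mp.
pose a k x : R := (Num.floor (k.+1%:R * tau x))%:~R / k.+1%:R.
apply: (@measurable_fun_cvg _ _ _ _ (fun k x => Y (a k x) (p x))) => [k|x _].
  move=> _ A mA; rewrite setTI.
  rewrite (_ : _ @^-1` A = \bigcup_(z : int)
      ([set x | z%:~R <= k.+1%:R * tau x < (z + 1)%:~R] `&`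
       (fun x => Y (z%:~R / k.+1%:R) (p x)) @^-1` A)); last first.
    apply/seteqP; split => x/=.
      move=> h; exists (Num.floor (k.+1%:R * tau x)) => //; split => //=.
      exact: floor_itv.
    by move=> [z _ [/=]]; rewrite -floor_eq => /eqP zE; rewrite /a zE.
  apply: countable_bigcupT_measurable => // z; apply: measurableI.
    have mk : measurable_fun setT (fun x => k.+1%:R * tau x) by exact: measurable_funM.
    have := mk measurableT _ (@measurable_itv R `[z%:~R, (z + 1)%:~R[).
    by rewrite setTI; congr (measurable _); apply/seteqP; split => y; rewrite /= in_itv.
  by rewrite -[X in measurable X]setTI; apply: (measurableT_comp (mY _) mp).
have : a ^~ x @ \oo --> tau x.
  apply: (squeeze_cvgr (f := fun k : nat => tau x - k.+1%:R^-1) (h := fun=> tau x)).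
  - apply: nearW => k; have k0 : (0 : R) < k.+1%:R by [].
    have /andP[h1 h2] := floor_itv (k.+1%:R * tau x); apply/andP; split.
      rewrite /a ler_pdivlMr// mulrBl mulVf ?gt_eqF//.
      by rewrite lerBlDr -[X in _ + X]/(1%:~R) -intrD (mulrC (tau x)) ltW.
    by rewrite /a ler_pdivrMr// (mulrC (tau x)).
  - rewrite -[X in _ --> X]subr0; apply: (@cvgB _ R^o); first exact: cvg_cst.
    exact: cvg_harmonic.
  - exact: cvg_cst.
by move=> h; exact: (cvg_comp (a ^~ x) (fun t => Y t (p x)) h (cY (p x) (tau x))).
Qed.

(** * Joint measurability of the integrand *)

Section joint_measurability.
Context d (T : measurableType d) (R : realType) (P : probability T R).
Variables (n : nat) (H : R) (X : R -> T -> 'rV[R]_n).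
Hypothesis hX : fBm P H X.
Variables (alpha eps : R).
Hypothesis e0 : 0 < eps.

Let hB i : real_fBm P H (fun t w => X t w ord0 i).
Proof. by case: hX => h _; exact: (h i). Qed.

(** The process extended to all real times by its value at [0]; its paths are continuous on the whole line. *)
Definition Xpos t w := X (Num.max 0 t) w.

(** The difference quotient written with [Xpos]. *)
Definition DXpos t w := (2 * eps)^-1 *: Xpos (t + eps) w +
    (- ((2 * eps)^-1 * kap eps t)) *: Xpos (t - eps) w.

(** The integrand of [Z] at times [t] and [s], with arguments reordered; it is meaningful and jointly
    measurable for all real times and agrees with [Z_integrand] at nonnegative ones. *)
Definition integrand t s w : \bar R :=
  (Kfun n alpha (dotp (Xpos t w - Xpos s w)%R (Xpos t w - Xpos s w)%R) *
   (dotp (DXpos t w) (DXpos s w))%:E)%E.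

Lemma integrandE t s w : 0 <= t -> 0 <= s ->
  Z_integrand alpha eps (X^~ w) t s = integrand t s w.
Proof.
move=> t0 s0; rewrite /Z_integrand KE /integrand /DXpos /Xpos.
rewrite !(max_r t0) !(max_r s0) !D0E// /mpos.
by rewrite (max_r (addr_ge0 t0 (ltW e0))) (max_r (addr_ge0 s0 (ltW e0))).
Qed.

Lemma continuous_Xpos w i : continuous (fun t => Xpos t w ord0 i).
Proof.
move=> t; have [_ c _ _] := hB i; have /subspace_continuousP := c w => /(_ (Num.max 0 t)).
have m0 u : (`[0%R, +oo[%classic : set R) (Num.max 0 u).
  by rewrite /= in_itv/= andbT le_max lexx.
move=> /(_ (m0 t)) h; rewrite /Xpos.
have k : Num.max 0 u @[u --> t] --> within `[0, +oo[%classic (nbhs (Num.max 0 t)).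
  move=> A hA; have := @continuous_max0 R t _ hA.
  by apply: (@filterS _ (nbhs t)) => u /=; apply; exact: m0.
exact: (cvg_comp (fun u => Num.max 0 u) (fun u => X u w ord0 i) k h).
Qed.

Context d' (S : measurableType d').
Implicit Types tau sig : S -> R.

Lemma measurable_Xpos tau (p : S -> T) i :
  measurable_fun setT tau -> measurable_fun setT p ->
  measurable_fun setT (fun x => Xpos (tau x) (p x) ord0 i).
Proof.
move=> mtau mp; apply: (measurable_fun_continuous_process (Y := fun t w => Xpos t w ord0 i)) => //.
  move=> t; apply: (vspan_measurable hX (A := X (Num.max 0 t))).
  by apply: vspan_proc; rewrite le_max lexx.
by move=> w; exact: continuous_Xpos.
Qed.

Lemma measurable_kap : measurable_fun setT (kap eps : R -> R).
Proof. by apply: measurable_fun_if => //; exact: measurable_fun_ltr. Qed.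

Lemma measurable_integrand tau sig (p : S -> T) :
  measurable_fun setT tau -> measurable_fun setT sig -> measurable_fun setT p ->
  measurable_fun setT (fun x => integrand (tau x) (sig x) (p x)).
Proof.
move=> mtau msig mp.
have mW i : measurable_fun setT (fun x => (Xpos (tau x) (p x) - Xpos (sig x) (p x)) ord0 i).
  under eq_fun do rewrite !mxE.
  by apply: measurable_funB; exact: measurable_Xpos.
have mD f i : measurable_fun setT f -> measurable_fun setT (fun x => DXpos (f x) (p x) ord0 i).
  move=> mf; under eq_fun do rewrite !mxE.
  apply: measurable_funD; apply: measurable_funM => //.
  - by apply: measurable_Xpos => //; exact: measurable_funD.
  - apply: measurableT_comp => //; apply: measurable_funM => //.
    exact: (measurableT_comp measurable_kap).
  - by apply: measurable_Xpos => //; exact: measurable_funB.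
apply: emeasurable_funM.
  by apply: (measurableT_comp (measurable_Kfun n alpha)); exact: measurable_dotp.
by apply/measurable_EFinP; apply: measurable_dotp => i; exact: mD.
Qed.

End joint_measurability.

Section fubini_complements.
Context d1 d2 (T1 : measurableType d1) (T2 : measurableType d2) (R : realType).
Variables (m1 : {sigma_finite_measure set T1 -> \bar R})
  (m2 : {sigma_finite_measure set T2 -> \bar R}).
Local Open Scope ereal_scope.

(** Measurability of a partial integral, without integrability: both the positive and the negative
    parts are covered by Tonelli. *)
Lemma measurable_partial_integral (f : T1 * T2 -> \bar R) : measurable_fun setT f ->
  measurable_fun setT (fun x => \int[m2]_y f (x, y)).
Proof.
move=> mf.
rewrite (_ : (fun x => _) = (fun x => \int[m2]_y f^\+ (x, y)) \-
    (fun x => \int[m2]_y f^\- (x, y))); last first.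
  apply/funext=> x; rewrite [LHS]integralE.
  under eq_integral do rewrite funepos_comp/=.
  by under [X in _ - X = _]eq_integral do rewrite funeneg_comp/=.
apply: emeasurable_funB; apply: measurable_fun_fubini_tonelli_F => //.
  exact: measurable_funepos.
exact: measurable_funeneg.
Qed.

End fubini_complements.

(** * Fubini with one parameter and two times *)

Section fubini_triple.
Context d1 d2 (T : measurableType d1) (U : measurableType d2) (R : realType).
Variables (m : {sigma_finite_measure set T -> \bar R})
  (mu : {sigma_finite_measure set U -> \bar R}).
Variable f : T -> U -> U -> \bar R.
Hypothesis mf : measurable_fun setT (fun p : (T * U) * U => f p.1.1 p.1.2 p.2).
Local Open Scope ereal_scope.
Hypothesis intf1 : forall t, \int[mu]_s \int[m]_w `|f w t s| < +oo.
Hypothesis intf : \int[mu]_t \int[mu]_s \int[m]_w `|f w t s| < +oo.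

Let maf : measurable_fun setT (fun p : (T * U) * U => `|f p.1.1 p.1.2 p.2|).
Proof. exact: measurableT_comp. Qed.

Let sec_t (g : T -> U -> U -> \bar R) t :
  measurable_fun setT (fun p : (T * U) * U => g p.1.1 p.1.2 p.2) ->
  measurable_fun setT (fun p : T * U => g p.1 t p.2).
Proof.
move=> mg; apply: (measurableT_comp mg (g := fun p : T * U => ((p.1, t), p.2))).
by apply: measurable_fun_pair => //; exact: measurable_fun_pair.
Qed.

Let sec_w w : measurable_fun setT (fun p : U * U => f w p.1 p.2).
Proof.
apply: (measurableT_comp mf (g := fun p : U * U => ((w, p.1), p.2))).
by apply: measurable_fun_pair => //; exact: measurable_fun_pair.
Qed.

Let B (p : T * U) := \int[mu]_s `|f p.1 p.2 s|.
Let mB : measurable_fun setT B. Proof. exact: (measurable_partial_integral mu maf). Qed.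
Let B0 p : 0 <= B p. Proof. exact: integral_ge0. Qed.

Let A w := \int[mu]_t \int[mu]_s `|f w t s|.
Let mA : measurable_fun setT A. Proof. exact: (measurable_partial_integral mu mB). Qed.
Let A0 w : 0 <= A w. Proof. by apply: integral_ge0 => t _; exact: integral_ge0. Qed.

Let Aoo : \int[m]_w A w < +oo.
Proof.
rewrite (fubini_tonelli _ mB B0); apply: le_lt_trans intf; rewrite le_eqVlt.
apply/orP; left; apply/eqP; apply: eq_integral => t _.
rewrite (fubini_tonelli (fun p : T * U => `|f p.1 t p.2|))//.
exact: (sec_t (g := fun w t s => `|f w t s|)).
Qed.

(** Fubini is applied to two variables at a time throughout this section, so that only
    products of two of the given measures are used. *)
Lemma ae_integrable_section :
  {ae m, forall w, (mu \x mu).-integrable setT (fun p => f w p.1 p.2)}.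
Proof.
have : m.-integrable setT A.
  by apply/integrableP; split => //; under eq_integral do rewrite gee0_abs//.
move=> /(integrable_ae measurableT); apply: filterS => w /(_ Logic.I) h.
by apply/(integrable12ltyP _ _ (sec_w w)); rewrite ltey_eq h.
Qed.

Let g (p : T * U) := \int[mu]_s f p.1 p.2 s.
Let mg : measurable_fun setT g. Proof. exact: (measurable_partial_integral mu mf). Qed.
Let g_le p : `|g p| <= B p.
Proof.
apply: le_abse_integral => //.
exact: (measurable_fun_pair2 p mf).
Qed.

Let Z w := \int[mu]_t g (w, t).
Let mZ : measurable_fun setT Z. Proof. exact: (measurable_partial_integral mu mg). Qed.

Let gA w : \int[mu]_t `|g (w, t)| <= A w.
Proof.
apply: ge0_le_integral => //.
- by apply: measurableT_comp => //; exact: measurableT_comp.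
- exact: (measurable_fun_pair2 w mB).
Qed.

Lemma integrable_iterated : m.-integrable setT (fun w => \int[mu]_t \int[mu]_s f w t s).
Proof.
apply/integrableP; split => //; apply: le_lt_trans Aoo.
apply: ge0_le_integral => //; first exact: measurableT_comp.
move=> w _; apply: le_trans (gA w); apply: le_abse_integral => //.
exact: (measurable_fun_pair2 w mg).
Qed.

Let mean_meas (h : T -> U -> U -> \bar R) :
  measurable_fun setT (fun p : (T * U) * U => h p.1.1 p.1.2 p.2) ->
  measurable_fun setT (fun p : U * U => \int[m]_w h w p.1 p.2).
Proof.
move=> mh; apply: (measurable_partial_integral m (f := fun q : (U * U) * T => h q.2 q.1.1 q.1.2)).
apply: (measurableT_comp mh (g := fun q : (U * U) * T => ((q.2, q.1.1), q.1.2))).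
apply: measurable_fun_pair; last exact: measurableT_comp.
by apply: measurable_fun_pair => //; exact: measurableT_comp.
Qed.

Lemma measurable_mean t : measurable_fun setT (fun s => \int[m]_w f w t s).
Proof. exact: (measurable_fun_pair2 t (mean_meas mf)). Qed.

Lemma measurable_mean_abs t : measurable_fun setT (fun s => \int[m]_w `|f w t s|).
Proof. exact: (measurable_fun_pair2 t (mean_meas (h := fun w t s => `|f w t s|) maf)). Qed.

Lemma mean_abs_le t s : `|\int[m]_w f w t s| <= \int[m]_w `|f w t s|.
Proof.
apply: le_abse_integral => //.
exact: (measurable_fun_pair1 t (measurable_fun_pair1 s mf)).
Qed.

Lemma measurable_section_abs :
  measurable_fun setT (fun t => \int[mu]_s \int[m]_w `|f w t s|).
Proof.
exact: (measurable_partial_integral mu (mean_meas (h := fun w t s => `|f w t s|) maf)).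
Qed.

Lemma integrable_mean : mu.-integrable setT (fun t => \int[mu]_s \int[m]_w f w t s).
Proof.
have m1 : measurable_fun setT (fun t => \int[mu]_s \int[m]_w f w t s).
  exact: (measurable_partial_integral mu (mean_meas mf)).
have m2 := measurable_section_abs.
apply/integrableP; split; [exact: m1|apply: le_lt_trans intf].
apply: ge0_le_integral; [by []|by []| |exact: m2|].
- by apply: measurableT_comp; [|exact: m1].
- move=> t _; apply: le_trans (le_abse_integral _ _ _) _ => //; first exact: measurable_mean.
  apply: ge0_le_integral => //.
  + by apply: measurableT_comp => //; exact: measurable_mean.
  + exact: measurable_mean_abs.
  + by move=> s _; exact: mean_abs_le.
Qed.

Lemma fubini_triple :
  \int[m]_w \int[mu]_t \int[mu]_s f w t s = \int[mu]_t \int[mu]_s \int[m]_w f w t s.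
Proof.
have ig : (m \x mu).-integrable setT g.
  apply/(integrable12ltyP _ _ mg); apply: le_lt_trans Aoo.
  apply: ge0_le_integral; [by []| | |exact: mA|by move=> w _; exact: gA].
    by move=> w _; exact: integral_ge0.
  by apply: (measurable_fun_fubini_tonelli_F (abse \o g)) => [|p]; [exact: measurableT_comp|exact: abse_ge0].
rewrite (Fubini ig); apply: eq_integral => t _.
have mft : measurable_fun setT (fun p : T * U => f p.1 t p.2) by exact: (sec_t t mf).
have ift : (m \x mu).-integrable setT (fun p : T * U => f p.1 t p.2).
  apply/(integrable12ltyP _ _ mft); rewrite (fubini_tonelli (fun p : T * U => `|f p.1 t p.2|)) ?intf1//.
  exact: (sec_t (g := fun w t s => `|f w t s|)).
exact: (Fubini ift).
Qed.

End fubini_triple.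

(** * Bounds on the mean of the integrand *)

Section off_diagonal.
Context d (T : measurableType d) (R : realType) (P : probability T R).
Variables (n : nat) (H : R) (X : R -> T -> 'rV[R]_n).
Hypothesis hX : fBm P H X.
Hypothesis n0 : (0 < n)%N.
Hypotheses (H0 : 0 < H) (H1 : H < 1).
Variables (alpha eps w0 C beta : R).
Hypothesis e0 : 0 < eps.
Hypothesis asymp : forall r, 0 < r ->
  exists w, wgt n alpha (r `^ (2 * H)) = w%:E /\ `|w - w0| <= C * r `^ beta.

Lemma integrand_DX t s w : 0 <= t -> 0 <= s -> integrand X alpha eps t s w =
  (Kfun n alpha (dotp (WX X t s w) (WX X t s w)) * (dotp (DX X eps t w) (DX X eps s w))%:E)%E.
Proof. by move=> t0 s0; rewrite -integrandE// /Z_integrand KE. Qed.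

(** The expansion of the weight at the variance of [X_t - X_s]. *)
Lemma wgt_fH t s : t != s -> exists w,
  [/\ wgt n alpha (fH H (t - s)) = w%:E, 0 <= w & `|w - w0| <= C * `|t - s| `^ beta].
Proof.
move=> ts; have r0 : 0 < `|t - s| by rewrite normr_gt0 subr_eq0.
have [w [wE wb]] := asymp r0; exists w; split => //.
by rewrite -lee_fin -wE wgt_ge0.
Qed.

Let c0 : 0 <= Kcst n alpha * n%:R.
Proof. by apply: mulr_ge0; rewrite ?Kcst_ge0. Qed.

Lemma mean_abs_integrand_le t s : 0 <= t -> 0 <= s -> t != s ->
  (\int[P]_w `|integrand X alpha eps t s w| <=
   (Kcst n alpha * n%:R * (2 * ((4 * eps ^+ 2)^-1 * fH H (2 * eps))) *
    (w0 + C * `|t - s| `^ beta))%:E)%E.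
Proof.
move=> t0 s0 ts; under eq_integral do rewrite integrand_DX//.
have [w [wE wp wb]] := wgt_fH ts.
apply: le_trans.
  apply: (K_dotp_abs_le hX n0 alpha (fH_ge0 H (t - s)) (vspan_DX _ e0 t0) (vspan_DX _ e0 s0)
    (vspan_WX _ t0 s0) (vcovar_DX hX H0 e0 t0 t0) (vcovar_DX hX H0 e0 s0 s0)
    (vcovar_DX_WX hX H0 e0 t0 s0) (vcovar_DX_WX' hX H0 e0 t0 s0) (vcovar_WX hX H0 t0 s0)).
rewrite wE -EFinM lee_fin; have w1 : w <= w0 + C * `|t - s| `^ beta.
  by move: wb; rewrite ler_norml => /andP[_]; rewrite lerBlDl.
set v := _^-1 * _; have v0 : 0 <= v by rewrite mulr_ge0 ?fH_ge0// invr_ge0 mulr_ge0 ?sqr_ge0.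
apply: (@le_trans _ _ (Kcst n alpha * n%:R * (2 * v) * w)).
  rewrite ler_wpM2r// ler_wpM2l// mulr_natl mulr2n lerD//; exact: Ceps_diag_le.
by rewrite ler_wpM2l// mulr_ge0// mulr_ge0.
Qed.

Lemma mean_integrand_le t s : 0 <= t -> 0 <= s -> t != s ->
  (\int[P]_w integrand X alpha eps t s w <=
   (Kcst n alpha * n%:R * w0 * Ceps H eps t s +
    Kcst n alpha * n%:R * C * 144 * `|t - s| `^ (beta + 2 * H - 2))%:E)%E.
Proof.
move=> t0 s0 ts; under eq_integral do rewrite integrand_DX//.
have [w [wE wp wb]] := wgt_fH ts.
have fw : (wgt n alpha (fH H (t - s)) < +oo)%E by rewrite wE ltry.
have cc : 0 <= (4 * eps)^-1 * cross H eps t s * - ((4 * eps)^-1 * cross H eps s t).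
  have := cross_mul_ge0 H0 e0 t0 s0 => h.
  rewrite (_ : _ * _ = (4 * eps)^-1 ^+ 2 * (cross H eps t s * - cross H eps s t)); last by ring.
  by rewrite mulr_ge0 ?sqr_ge0.
apply: le_trans.
  apply: (K_dotp_le hX n0 (fH_ge0 H (t - s)) (vspan_DX _ e0 t0) (vspan_DX _ e0 s0)
    (vspan_WX _ t0 s0) (vcovar_DX hX H0 e0 t0 t0) (vcovar_DX hX H0 e0 s0 s0) (vcovar_DX hX H0 e0 t0 s0)
    (vcovar_DX_WX hX H0 e0 t0 s0) (vcovar_DX_WX' hX H0 e0 t0 s0) (vcovar_WX hX H0 t0 s0) fw cc).
rewrite wE -EFinM lee_fin; set c := Kcst n alpha * n%:R; have c0' : 0 <= c := c0.
have -> : c * Ceps H eps t s * w = c * w0 * Ceps H eps t s + c * (Ceps H eps t s * (w - w0)) by ring.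
have -> : c * C * 144 * `|t - s| `^ (beta + 2 * H - 2) =
   c * (144 * `|t - s| `^ (2 * H - 2) * (C * `|t - s| `^ beta)).
  rewrite (_ : beta + 2 * H - 2 = (2 * H - 2) + beta); last by ring.
  by rewrite powRD; [ring|rewrite normr_eq0 subr_eq0 (negbTE ts) implybT].
rewrite lerD2l ler_wpM2l//; apply: le_trans (ler_norm _) _; rewrite normrM.
by apply: ler_pM => //; exact: Ceps_le.
Qed.

End off_diagonal.

(** * Restriction to the time square *)

Section square.
Context (R : realType) (T : R).
Local Notation U := (measurableTypeR R).
Local Notation mu := (@lebesgue_measure R).

(** Membership of [(t, s)] in the square [[0, T] x [0, T]]. *)
Definition insq (t s : R) : bool := (t \in `[0, T]) && (s \in `[0, T]).

(** A function of two times, extended by [0] outside the square. *)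
Definition cutsq (h : R -> R -> \bar R) t s : \bar R := if insq t s then h t s else 0%E.

Lemma integral_cutsq (h : R -> R -> \bar R) :
  (\int[mu]_t \int[mu]_s cutsq h t s =
   \int[mu]_(t in `[0%R, T]) \int[mu]_(s in `[0%R, T]) h t s)%E.
Proof.
rewrite [RHS]integral_mkcond; apply: eq_integral => t _; rewrite patchE.
rewrite /cutsq /insq mem_setE; case: ifPn => tT /=; last by rewrite integral0.
rewrite [RHS]integral_mkcond; apply: eq_integral => s _; rewrite patchE.
by rewrite mem_setE.
Qed.

Lemma integral_cutsq_in (h : R -> R -> \bar R) t : t \in `[0, T] ->
  (\int[mu]_s cutsq h t s = \int[mu]_(s in `[0%R, T]) h t s)%E.
Proof.
move=> tT; rewrite [RHS]integral_mkcond; apply: eq_integral => s _; rewrite patchE.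
by rewrite mem_setE /cutsq /insq tT.
Qed.

Lemma integral_cutsq_out (h : R -> R -> \bar R) t : t \notin `[0, T] ->
  (\int[mu]_s cutsq h t s = 0)%E.
Proof.
move=> tT; rewrite -[RHS](@integral0 _ U R mu setT).
by apply: eq_integral => s _; rewrite /cutsq /insq (negbTE tT).
Qed.

Lemma measurable_cutsq d (S : measurableType d) (h : S -> R -> R -> \bar R) :
  measurable_fun setT (fun p : (S * U) * U => h p.1.1 p.1.2 p.2) ->
  measurable_fun setT (fun p : (S * U) * U => cutsq (h p.1.1) p.1.2 p.2).
Proof.
move=> mh.
pose D : set U := `[0, T]%classic.
have mD : measurable D by exact: measurable_itv.
rewrite (_ : (fun p => _) = (fun p : (S * U) * U =>
    ((\1_D p.1.2 * \1_D p.2)%:E * h p.1.1 p.1.2 p.2)%E)); last first.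
  apply/funext => p; rewrite /cutsq /insq !indicE.
  have E (x : R) : (x \in D) = (x \in `[0, T]) by apply/idP/idP => [/set_mem|xT]; [|exact: mem_set].
  rewrite !E; case: (p.1.2 \in `[0, T]); case: (p.2 \in `[0, T]);
  by rewrite /= ?mul1r ?mulr1 ?mulr0 ?mul0r ?mul1e ?mul0e.
apply: emeasurable_funM => //; apply/measurable_EFinP; apply: measurable_funM.
  apply: (measurableT_comp (f := \1_D : U -> R)); last exact: measurableT_comp.
  exact: measurable_indic.
by apply: (measurableT_comp (f := \1_D : U -> R)).
Qed.

Lemma integral_segment_cst (c : R) : 0 <= T ->
  (\int[mu]_(t in `[0%R, T]) c%:E = (c * T)%:E)%E.
Proof.
move=> T0; rewrite integral_cst//.
transitivity (c%:E * (T%:E))%E => //; congr (_ * _)%E.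
have /= -> := lebesgue_measure_itv `[0, T].
rewrite lte_fin; case: ltP => [_|T0']; first by rewrite oppr0 adde0.
by congr EFin; lra.
Qed.

Lemma integral_majorant_le (p q a t : R) : 0 <= p -> 0 <= q -> 0 < a -> 0 <= t <= T ->
  (\int[mu]_(s in `[0%R, T]) (p + q * `|t - s| `^ (a - 1))%:E <=
   (p * T + q * (2 * ((1 + T) `^ (a + 1) / a)))%:E)%E.
Proof.
move=> p0 q0 a0 tT; have /andP[t0 tT'] := tT.
have mpow : measurable_fun setT (fun s : U => (`|t - s| `^ (a - 1) : R)).
  apply: (measurableT_comp (f := fun x : U => (x `^ (a - 1) : R))); first exact: measurable_powR.
  apply: (measurableT_comp (f := fun x : U => (`|x| : R))); first exact: measurableT_comp.
  exact: measurable_funB.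
under eq_integral do rewrite EFinD EFinM.
rewrite ge0_integralD//=; last 2 first.
- by move=> s _; rewrite -EFinM lee_fin mulr_ge0 ?powR_ge0.
- apply: measurable_funTS; apply/measurable_EFinP; exact: measurable_funM.
rewrite integral_segment_cst ?(le_trans t0)// EFinD; apply: leeD => //.
rewrite ge0_integralZl//; last first.
- apply: measurable_funTS; exact/measurable_EFinP.
by rewrite EFinM lee_wpmul2l ?lee_fin//; exact: integral_dist_powR.
Qed.

End square.

Section cut_complements.
Context d (S : measurableType d) (R : realType) (T : R) (m : {measure set S -> \bar R}).
Local Open Scope ereal_scope.

Lemma abse_cutsq (h : R -> R -> \bar R) t s :
  `|cutsq T h t s| = cutsq T (fun t s => `|h t s|) t s.
Proof. by rewrite /cutsq; case: ifP => // _; rewrite abse0. Qed.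

Lemma integral_cutsq_param (h : S -> R -> R -> \bar R) t s :
  \int[m]_w cutsq T (h w) t s = cutsq T (fun t s => \int[m]_w h w t s) t s.
Proof. by rewrite /cutsq; case: ifP => // _; rewrite integral0. Qed.

End cut_complements.

(** * Integration in one time variable *)

Section expectation_bound.
Context d (S : measurableType d) (R : realType) (P : probability S R).
Variables (n : nat) (H : R) (X : R -> S -> 'rV[R]_n).
Hypothesis hX : fBm P H X.
Hypothesis n0 : (0 < n)%N.
Hypotheses (H0 : 0 < H) (H1 : H < 1).
Variables (T alpha eps w0 C beta : R).
Hypothesis e01 : 0 < eps < 1.
Hypotheses (w00 : 0 <= w0) (C0 : 0 <= C) (hbeta : 1 - 2 * H < beta).
Hypothesis asymp : forall r, 0 < r ->
  exists w, wgt n alpha (r `^ (2 * H)) = w%:E /\ `|w - w0| <= C * r `^ beta.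

Local Notation U := (measurableTypeR R).
Local Notation mu := (@lebesgue_measure R).

Let e0 : 0 < eps. Proof. by case/andP: e01. Qed.
Let D : set U := `[0, T]%classic.
Let mD : measurable D. Proof. exact: measurable_itv. Qed.
Let mD1 t : measurable (D `\ t). Proof. exact: measurableD. Qed.
Let DP t : D t -> 0 <= t <= T. Proof. by rewrite /D/= in_itv. Qed.

Let c := Kcst n alpha * n%:R.
Let c0 : 0 <= c. Proof. by apply: mulr_ge0; rewrite ?Kcst_ge0. Qed.

Lemma measurable_mean_integrand t :
  measurable_fun setT (fun s : U => \int[P]_w integrand X alpha eps t s w)%E.
Proof.
apply: (measurable_partial_integral P (f := fun p : U * S => integrand X alpha eps t p.1 p.2)).
exact: (measurable_integrand hX).
Qed.

Lemma measurable_mean_abs_integrand t :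
  measurable_fun setT (fun s : U => \int[P]_w `|integrand X alpha eps t s w|)%E.
Proof.
apply: (measurable_partial_integral P (f := fun p : U * S => `|integrand X alpha eps t p.1 p.2|)%E).
by apply: measurableT_comp => //; exact: (measurable_integrand hX).
Qed.

Let M := c * (2 * ((4 * eps ^+ 2)^-1 * fH H (2 * eps))).
Let M0 : 0 <= M.
Proof.
rewrite /M mulr_ge0//; apply: mulr_ge0 => //; apply: mulr_ge0; last exact: fH_ge0.
by rewrite invr_ge0; apply: mulr_ge0 => //; exact: sqr_ge0.
Qed.

Let pw (b t s : R) : R := `|t - s| `^ b.
Let mpw b t : measurable_fun setT (pw b t : U -> R).
Proof.
apply: (measurableT_comp (f := fun x : U => (x `^ b : R))); first exact: measurable_powR.
apply: (measurableT_comp (f := fun x : U => (`|x| : R))); first exact: measurableT_comp.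
exact: measurable_funB.
Qed.

Let J (a : R) := 2 * ((1 + T) `^ (a + 1) / a).

(** The diagonal [s = t], where the pointwise bound is not available, is a null set of times [s]. *)
Lemma mean_abs_section_le t : D t ->
  (\int[mu]_(s in D) \int[P]_w `|integrand X alpha eps t s w| <=
   (M * w0 * T + M * C * J (beta + 1))%:E)%E.
Proof.
move=> Dt; have tT := DP Dt; have /andP[t0 _] := tT.
have H1' := H1; have hb := hbeta.
have mm := measurable_mean_abs_integrand t.
(* Remove the time [s = t]. *)
rewrite -(integral_setD1 (r := t)); [|exact: mD1|exact: measurable_funTS].
have mg : measurable_fun setT (fun s : U => (M * w0 + M * C * pw (beta + 1 - 1) t s)%:E).
  by apply/measurable_EFinP; apply: measurable_funD => //; apply: measurable_funM.
apply: le_trans; last first.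
  apply: (integral_majorant_le (T := T) (p := M * w0) (q := M * C) (a := beta + 1) (t := t)) => //; try exact: mulr_ge0.
  lra.
rewrite -(integral_setD1 (r := t) (D := D)); [|exact: mD1|exact: measurable_funTS].
apply: ge0_le_integral; [exact: mD1|by move=> s _; exact: integral_ge0|exact: measurable_funTS|exact: measurable_funTS|].
move=> s [/= Ds st]; have /andP[s0 _] := DP Ds.
apply: le_trans (mean_abs_integrand_le hX n0 H0 e0 asymp t0 s0 _) _ => //.
  by apply/eqP => ts; apply: st.
by rewrite lee_fin le_eqVlt -/c -/M addrK mulrDr mulrA eqxx.
Qed.

Let a := beta + 2 * H - 1.
Let a0 : 0 < a. Proof. by have := hbeta; rewrite /a; lra. Qed.

Let G1 t := (\int[mu]_(s in D) (Ceps H eps t s)%:E)%E.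

Lemma mean_section_le t : D t ->
  (\int[mu]_(s in D) \int[P]_w integrand X alpha eps t s w <=
   (c * w0)%:E * G1 t + (c * C * 144 * J a)%:E)%E.
Proof.
move=> Dt; have tT := DP Dt; have /andP[t0 _] := tT.
have mm := measurable_mean_integrand t.
have im : mu.-integrable D (fun s => \int[P]_w integrand X alpha eps t s w)%E.
  apply/integrableP; split; first exact: measurable_funTS.
  apply: le_lt_trans (ltry (M * w0 * T + M * C * J (beta + 1))).
  apply: le_trans (mean_abs_section_le Dt); apply: ge0_le_integral => //.
  - by apply: measurable_funTS; exact: measurableT_comp.
  - by apply: measurable_funTS; exact: measurable_mean_abs_integrand.
  - move=> s _; apply: le_abse_integral => //.
    exact: (measurable_integrand hX).
have iC : mu.-integrable D (fun s => (c * w0)%:E * (Ceps H eps t s)%:E)%E.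
  by apply: integrableZl => //; exact: integrable_Ceps.
have q0 : 0 <= c * C * 144 by rewrite mulr_ge0// mulr_ge0.
have ple : (\int[mu]_(s in D) (c * C * 144 * pw (a - 1) t s)%:E <= (c * C * 144 * J a)%:E)%E.
  have := integral_majorant_le (T := T) (p := 0) (q := c * C * 144) (a := a) (t := t) (lexx 0) q0 a0 tT.
  rewrite mul0r add0r; apply: le_trans; rewrite le_eqVlt; apply/orP; left; apply/eqP.
  by apply: eq_integral => s _; rewrite add0r.
have ip : mu.-integrable D (fun s => (c * C * 144 * pw (a - 1) t s)%:E).
  apply/integrableP; split.
    by apply: measurable_funTS; apply/measurable_EFinP; exact: measurable_funM.
  apply: le_lt_trans (ltry (c * C * 144 * J a)); apply: le_trans ple.
  rewrite le_eqVlt; apply/orP; left; apply/eqP; apply: eq_integral => s _.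
  by rewrite gee0_abs// lee_fin mulr_ge0// powR_ge0.
have -> : ((c * w0)%:E * G1 t = \int[mu]_(s in D) ((c * w0)%:E * (Ceps H eps t s)%:E))%E.
  by rewrite integralZl//; exact: integrable_Ceps.
apply: le_trans (leeD2l _ ple); rewrite -integralD//.
have ig := integrableD mD iC ip.
rewrite -(integral_setD1 (r := t)); [|exact: mD1|exact: measurable_funTS].
rewrite -[leRHS](integral_setD1 (r := t)); [|exact: mD1|]; last first.
  apply: measurable_funS (measurable_int _ ig) => //.
have subD : D `\ t `<=` D by move=> s [].
apply: (le_integral (mD1 t) (integrableS mD (mD1 t) subD im) (integrableS mD (mD1 t) subD ig)).
move=> s /set_mem[/= Ds st]; have /andP[s0 _] := DP Ds.
apply: le_trans (mean_integrand_le hX n0 H0 H1 e0 asymp t0 s0 _) _ => //.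
  by apply/eqP => ts; apply: st.
by rewrite -EFinM -EFinD lee_fin le_eqVlt -/c /a (_ : beta + 2 * H - 2 = beta + 2 * H - 1 - 1) ?eqxx//; ring.
Qed.

End expectation_bound.

(** * Integrability and expectation of Z *)

Section expectation_Z.
Context d (S : measurableType d) (R : realType) (P : probability S R).
Variables (n : nat) (H : R) (X : R -> S -> 'rV[R]_n).
Hypothesis hX : fBm P H X.
Hypothesis n0 : (0 < n)%N.
Hypotheses (H0 : 0 < H) (H1 : H < 1).
Variables (T alpha eps w0 C beta : R).
Hypothesis T0 : 0 < T.
Hypothesis e01 : 0 < eps < 1.
Hypotheses (w00 : 0 <= w0) (C0 : 0 <= C) (hbeta : 1 - 2 * H < beta).
Hypothesis asymp : forall r, 0 < r ->
  exists w, wgt n alpha (r `^ (2 * H)) = w%:E /\ `|w - w0| <= C * r `^ beta.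

Local Notation U := (measurableTypeR R).
Local Notation mu := (@lebesgue_measure R).

Let e0 : 0 < eps. Proof. by case/andP: e01. Qed.
Let D : set U := `[0, T]%classic.
Let mD : measurable D. Proof. exact: measurable_itv. Qed.
Let DP t : D t -> 0 <= t <= T. Proof. by rewrite /D/= in_itv. Qed.

Let I (w : S) (t s : U) := integrand X alpha eps t s w.
Let f (w : S) := cutsq T (I w).

Let mf : measurable_fun setT (fun p : (S * U) * U => f p.1.1 p.1.2 p.2).
Proof.
apply: (measurable_cutsq T (h := I)).
by apply: (measurable_integrand hX) => //; exact: measurableT_comp.
Qed.

Let meanE t s : (\int[P]_w f w t s = cutsq T (fun t s => \int[P]_w I w t s) t s)%E.
Proof. exact: (integral_cutsq_param T P I). Qed.

Let mean_absE t s :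
  (\int[P]_w `|f w t s| = cutsq T (fun t s => \int[P]_w `|I w t s|) t s)%E.
Proof.
rewrite -(integral_cutsq_param T P (fun w t s => `|I w t s|%E)).
by apply: eq_integral => w _; rewrite -abse_cutsq.
Qed.

Let cut_mean_absE t : (\int[mu]_s \int[P]_w `|f w t s| =
  \int[mu]_s cutsq T (fun t s => \int[P]_w `|I w t s|) t s)%E.
Proof. by apply: eq_integral => s _; exact: mean_absE. Qed.

Let bound := mean_abs_section_le (T := T) hX n0 H0 H1 e01 w00 C0 hbeta asymp.

Let intf1 t : (\int[mu]_s \int[P]_w `|f w t s| < +oo)%E.
Proof.
rewrite cut_mean_absE; have [tT|tT] := boolP (t \in `[0, T]).
  by rewrite integral_cutsq_in//; apply: le_lt_trans (bound tT) _; exact: ltry.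
by rewrite integral_cutsq_out// ltry.
Qed.

Let intf : (\int[mu]_t \int[mu]_s \int[P]_w `|f w t s| < +oo)%E.
Proof.
pose A t := (\int[mu]_s \int[P]_w `|f w t s|)%E.
have -> : (\int[mu]_t A t = \int[mu]_(t in D) A t)%E.
  rewrite [RHS]integral_mkcond; apply: eq_integral => t _; rewrite patchE mem_setE.
  by case: ifPn => // tT; rewrite /A cut_mean_absE integral_cutsq_out.
have [M bM] : exists M : R, forall t, D t ->
    (\int[mu]_(s in D) \int[P]_w `|I w t s| <= M%:E)%E by eexists; exact: bound.
apply: le_lt_trans (ltry (M * T)).
rewrite -(integral_segment_cst M (ltW T0)).
apply: ge0_le_integral; [exact: mD| | |exact: measurable_cst|].
- by move=> t _; apply: integral_ge0 => s _; exact: integral_ge0.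
- by apply: measurable_funTS; exact: measurable_section_abs mf.
- by move=> t Dt; rewrite /A cut_mean_absE integral_cutsq_in//; exact: bM.
Qed.

Lemma ZE w : (Z T alpha eps (X^~ w) = \int[mu]_t \int[mu]_s f w t s)%E.
Proof.
rewrite integral_cutsq; apply: eq_integral => t /set_mem/DP/andP[t0 _].
apply: eq_integral => s /set_mem/DP/andP[s0 _]; exact: integrandE.
Qed.

Lemma ae_integrable_Z_integrand : {ae P, forall w,
  (lebesgue_measure \x lebesgue_measure)%E.-integrable (`[0, T] `*` `[0, T])
    (fun p : R * R => Z_integrand alpha eps (X^~ w) p.1 p.2)}.
Proof.
apply: filterS (ae_integrable_section mf intf) => w h.
apply/integrable_mkcond; first exact: measurableX.
move: h; apply: eq_integrable => // p _; rewrite patchE.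
rewrite in_setX !mem_setE /f /cutsq /insq; case: ifPn => // /andP[].
by rewrite !in_itv/= => /andP[t0 _] /andP[s0 _]; rewrite integrandE.
Qed.

Lemma integrable_Z : P.-integrable setT (fun w => Z T alpha eps (X^~ w)).
Proof.
by under eq_fun do rewrite ZE; exact: integrable_iterated.
Qed.

(** The bound does not depend on [eps]. *)
Lemma expectation_Z_le : (\int[P]_w Z T alpha eps (X^~ w) <=
  (Kcst n alpha * n%:R * w0 * (8 * fH H (T + 2)) +
   Kcst n alpha * n%:R * C * 144 *
     (2 * ((1 + T) `^ (beta + 2 * H - 1 + 1) / (beta + 2 * H - 1))) * T)%:E)%E.
Proof.
under eq_integral do rewrite ZE.
rewrite (fubini_triple mf intf1 intf).
have meanDE t : D t -> (\int[mu]_s \int[P]_w f w t s = \int[mu]_(s in D) \int[P]_w I w t s)%E.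
  move=> tT; rewrite -(integral_cutsq_in (fun t s => \int[P]_w I w t s)%E tT); apply: eq_integral => s _; exact: meanE.
have im : mu.-integrable D (fun t => \int[mu]_(s in D) \int[P]_w I w t s)%E.
  have := integrableS measurableT mD (@subsetT _ D) (integrable_mean mf intf).
  by apply: eq_integrable => // t /set_mem; exact: meanDE.
have -> : (\int[mu]_t \int[mu]_s \int[P]_w f w t s =
    \int[mu]_(t in D) \int[mu]_(s in D) \int[P]_w I w t s)%E.
  rewrite -(integral_cutsq T (fun t s => \int[P]_w I w t s)%E); apply: eq_integral => t _; apply: eq_integral => s _; exact: meanE.
have [iC leC] := double_integral_Ceps H0 T0 e01.
set c := Kcst n alpha * n%:R; have c0 : 0 <= c by apply: mulr_ge0; rewrite ?Kcst_ge0.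
set q := c * C * 144 * _.
have icC : mu.-integrable D (fun t => (c * w0)%:E * \int[mu]_(s in D) (Ceps H eps t s)%:E)%E.
  exact: integrableZl.
have iq : mu.-integrable D (fun t => q%:E).
  apply/integrableP; split; first exact: measurable_cst.
  by under eq_integral do rewrite /=; rewrite integral_segment_cst ?ltry// ltW.
apply: (@le_trans _ _ (\int[mu]_(t in D) ((c * w0)%:E * \int[mu]_(s in D) (Ceps H eps t s)%:E + q%:E))%E).
  apply: (le_integral mD im (integrableD mD icC iq)) => t /set_mem tT.
  exact: (mean_section_le (T := T) hX n0 H0 H1 e01 w00 C0 hbeta asymp).
rewrite integralD// integralZl// integral_segment_cst ?(ltW T0)// EFinD leeD2r//.
rewrite [leRHS]EFinM; apply: lee_wpmul2l; last exact: leC.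
by rewrite lee_fin; exact: mulr_ge0.
Qed.

End expectation_Z.

Theorem theorem18 (R : realType) (dO : measure_display)
    (Omega : measurableType dO) (P : probability Omega R)
    (d : nat) (hd : (1 <= d)%N) (T : R) (hT : 0 < T)
    (H : R) (hH : 1 / 4 < H < 1)
    (X : R -> Omega -> 'rV[R]_d) (hX : fBm P H X)
    (alpha : R) (halpha : d%:R / 2 - 1 + 1 / (2 * H) < alpha) :
  (* Z_{alpha,eps} and its expectation are well defined *)
  (forall eps : R, 0 < eps < 1 ->
     {ae P, forall w : Omega,
        (lebesgue_measure \x lebesgue_measure)%E.-integrable
          (`[0, T] `*` `[0, T])
          (fun p : R * R => Z_integrand alpha eps (X^~ w) p.1 p.2)} /\
     P.-integrable setT (fun w : Omega => Z T alpha eps (X^~ w))) /\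
  (ereal_sup [set \int[P]_w Z T alpha eps (X^~ w) | eps in `]0%R, 1%R[]
     < +oo)%E.
Proof.
have [w0 [C [beta [w00 C0 hb asymp]]]] := wgt_asymp hd hH halpha.
have /andP[H14 H1] := hH; have H0 : 0 < H by lra.
split=> [eps e01|].
  split; first exact: (ae_integrable_Z_integrand hX hd H0 H1 hT e01 w00 C0 hb asymp).
  exact: (integrable_Z hX hd H0 H1 hT e01 w00 C0 hb asymp).
apply: le_lt_trans (ltry _); apply: ge_ereal_sup => _ [eps /= e01 <-].
rewrite in_itv/= in e01.
exact: (expectation_Z_le hX hd H0 H1 hT e01 w00 C0 hb asymp).
Qed.
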